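(* For $\mathbf w=(w_1,w_2)\in R$, where $$R=\{\text{unordered pairs }(w_1,w_2)\in(\mathbf P(\mathbf F_3^5))^2: q(w_1)=q(w_2)=2,\ w_1\cdot w_2=0\},$$ define $I(\mathbf w)=\{v\in S/\{\pm1\}: v\cdot w_1=v\cdot w_2=0\}$. Choose a set of representatives $\tilde I(\mathbf w)=\{v_1,\dots,v_4\}\subset S$ of $I(\mathbf w)$ such that $v_i\cdot v_j=-1$ for $i\ne j$. Then $$\sum_{v\in\tilde I(\mathbf w)}\Theta_v^3(\tau)=0\qquad\text{for all }\tau\in\mathbf B_4 .$$
   Context: $\mathbf F_3^5$ carries the bilinear form $v\cdot w=\sum_iv^{(i)}w^{(i)}$ and $q(v)=v\cdot v$; $S=\{v\in\mathbf F_3^5\setminus\{0\}:q(v)=0\}$. $H=\mathrm{diag}(1,1,1,1,-1)$, $\mathbf 1=(1,1,1,1,1)$, $\mathbf e(x)=\exp(2\pi\sqrt{-1}x)$. $\mathfrak H_5$ is the Siegel upper half space of degree 5 and $\mathbf B_4=\{\tau\in\mathfrak H_5:(H\tau)^2+H\tau+I=0\}$. For $m=(m',m'')\in\mathbf R^{10}$ let $\Theta_m(\tau)=\sum_{p\in\mathbf Z^5}\mathbf e(\frac12(p+m')\tau\,{}^t(p+m')+(p+m')\,{}^tm'')$. Let $r_1=(1,1,1,1,1)$, $r_2=(1,-1,-1,-1,-1)$, $r_3=(0,1,-1,0,0)$, $r_4=(0,0,0,1,-1)$, $r_5=(0,1,1,-1,-1)$. For $v\in S$ choose a lift $\tilde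 v\in\mathbf Z^5$ of $v$, put $\tilde\beta=(r_1\cdot\tilde v,\dots,r_5\cdot\tilde v)$, $\tilde m=\frac12(\mathbf 1,\mathbf 1)+\frac13(-\tilde\beta H,\tilde\beta)$ and $\Theta_v^3(\tau):=\Theta_{\tilde m}(\tau)^3$, which is independent of the lift. *)

(* Defs.v *)
From HB Require Import structures.
From mathcomp Require Import all_boot all_order all_algebra.
From mathcomp Require Import complex.
From mathcomp Require Import all_classical all_reals all_analysis.
From mathcomp.analysis.showcase Require summability.

Set Implicit Arguments.
Unset Strict Implicit.
Unset Printing Implicit Defensive.

Import Order.TTheory GRing.Theory Num.Theory.
Import numFieldNormedType.Exports.

Local Open Scope ring_scope.
Local Open Scope complex_scope.

Definition dot (K : pzRingType) (n : nat) (v w : 'rV[K]_n) : K :=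
  \sum_(i < n) v 0 i * w 0 i.

Notation F35 := 'rV['F_3]_5.

Definition qform (v : F35) : 'F_3 := dot v v.

Definition Siso : {set F35} := [set v | (v != 0) && (qform v == 0)].

(* As the units of F_3 are 1 and -1, a point of P(F_3^5), and likewise an
   element of S/{+-1}, is encoded as a set {v, -v} with v nonzero. *)
Definition pm (v : F35) : {set F35} := [set v; - v].

(* The unordered pair (w_1, w_2) is the set of the two points; they are distinct
   because w_1.w_2 = 0 while q(w_1) = 2. *)
Definition Rpairs : {set {set {set F35}}} :=
  [set [set pm w.1; pm w.2] | w : F35 * F35 &
    [&& w.1 != 0, w.2 != 0, qform w.1 == 2, qform w.2 == 2 & dot w.1 w.2 == 0]].

Definition Iset (W : {set {set F35}}) : {set {set F35}} :=
  [set pm v | v in Siso & [forall P in W, forall w in P, dot v w == 0]].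

Definition good_representatives (W : {set {set F35}}) (X : {set F35}) : Prop :=
  is_transversal X (Iset W) (finset.cover (Iset W)) /\
  {in X &, forall v v', v != v' -> dot v v' = -1}.

Definition is_lift (lift : F35 -> 'rV[int]_5) : Prop :=
  {in Siso, forall v, map_mx (intr : int -> 'F_3) (lift v) = v}.

Definition Hmx (K : pzRingType) : 'M[K]_5 :=
  diag_mx (\row_(j < 5) (if j == ord_max then -1 else 1)).

Definition siegel (R : realType) (n : nat) (tau : 'M[R[i]]_n) : Prop :=
  tau^T = tau /\
  forall x : 'rV[R]_n, x != 0 -> 0 < (x *m map_mx (@complex.Im R) tau *m x^T) 0 0.

Definition ball4 (R : realType) (tau : 'M[R[i]]_5) : Prop :=
  siegel tau /\ (Hmx _ *m tau) ^+ 2 + Hmx _ *m tau + 1%:M = 0.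

Definition cexp (R : realType) (z : R[i]) : R[i] :=
  (expR (complex.Re z))%:C * (cos (complex.Im z) +i* sin (complex.Im z)).

Definition ee (R : realType) (z : R[i]) : R[i] :=
  cexp (2 * pi%:C * (0 +i* 1) * z).

Definition theta_term (R : realType) (m' m'' : 'rV[R]_5) (tau : 'M[R[i]]_5)
    (p : 'rV[int]_5) : R[i] :=
  let z := map_mx (fun x : R => x%:C) (map_mx intr p + m') in
  let t := map_mx (fun x : R => x%:C) m'' in
  ee (2^-1 * (z *m tau *m z^T) 0 0 + (z *m t^T) 0 0).

(* Unordered sum over Z^5: the limit of the finite partial sums along the
   directed set of finite subsets.  R[i]^o is C as a normed space over itself. *)
Definition Theta (R : realType) (m' m'' : 'rV[R]_5) (tau : 'M[R[i]]_5) : R[i] :=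
  summability.sum (theta_term m' m'' tau : 'rV[int]_5 -> R[i]^o).

Definition rmx : 'M[int]_5 :=
  \matrix_(i, j) nth 0 (nth [::]
    [:: [:: 1;  1;  1;  1;  1];
        [:: 1; -1; -1; -1; -1];
        [:: 0;  1; -1;  0;  0];
        [:: 0;  0;  0;  1; -1];
        [:: 0;  1;  1; -1; -1]] i) j.

Definition beta_tilde (vt : 'rV[int]_5) : 'rV[int]_5 :=
  \row_i dot (row i rmx) vt.

(* vt is an integral lift of v, and Theta_v^3 does not depend on its choice. *)
Definition Theta3 (R : realType) (vt : 'rV[int]_5) (tau : 'M[R[i]]_5) : R[i] :=
  Theta (const_mx 2^-1 + 3^-1 *: map_mx intr (- (beta_tilde vt *m Hmx _)))
        (const_mx 2^-1 + 3^-1 *: map_mx intr (beta_tilde vt)) tau ^+ 3.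

(* Main.v *)
Require Import Defs.
From mathcomp Require Import all_boot all_order all_algebra finmap.
From mathcomp Require Import complex.
From mathcomp Require Import all_classical all_reals all_analysis.
From mathcomp.analysis.showcase Require summability.
From mathcomp Require Import ring lra zify.

(** The relation is a statement in the Fourier analysis of F_3^5, once the right
    function on F_3^5 has been isolated.  Write omega = e(1/3) and attach to an
    integral vector b the characteristic m(b) = 1/2 (1, 1) + 1/3 (- b H, b).

    Theta inversion (theta_inversion) says that Theta_{x,y}(T) is a constant,
    depending only on T, times a series in - T^-1.  On the ball - tau^-1 is
    H tau H + H (ball_invmx), which is tau up to a change of basis and an integral
    translation; so inversion relates theta series at one and the same point: the
    points of the ball are fixed by an element of order 3 of Sp(10, Z).  This
    is used twice.

    - At tau itself m(b) is fixed modulo 1, and inversion reads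
      Theta_{m(b)} = kappa omega^(- b H b) Theta_{m(b)} (theta_fixed).  So the
      Theta_{m(b)} that do not vanish share one value of b H b modulo 3.

    - The cube of Theta_{m(b)} is a sum over three copies of Z^5.  Taking the
      differences of the summation indices as new variables turns the remaining
      sum into a theta series at 3 tau with characteristic in 1/2 + 1/3 Z
      (theta_char_cube).  There are 3^5 of these, and inversion at 3 tau acts on
      them by a finite quadratic kernel (theta_third_dual).  Substituting gives
      Theta_{m(b)}^3 = kappa omega^(- b H b) Sum_c omega^(b H c) Theta_{m(c)}^3
      (cube_sum_relation).

    Through b = (r_1.v, ..., r_5.v) one has b H c = - v.u modulo 3, so
    g(v) = Theta_v^3 is an odd function on F_3^5, supported on one quadric
    q = c0, with g(v) = kappa omega^(q(v)) Sum_u omega^(- v.u) g(u).  If c0 is not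
    0 then g vanishes on S.  If c0 = 0 then, unless g = 0, the Fourier transform
    of g vanishes at every v with q(v) <> 0, in particular at v + w_1 and v - w_1
    for v in the set I~ of representatives, where q takes the value 2.  Adding
    these 2 |I~| equations up, the oddness of g replaces each character by its odd
    part, and the sum over v in I~ of the odd parts is, on isotropic u, a nonzero
    multiple of the indicator function of I~ minus that of - I~ (balanced_unit).
    What remains is a nonzero multiple of the sum of g over I~
    (odd_sum_isotropic).

    Theta inversion is Poisson summation for a Gaussian (poisson).  The constants
    of proportionality are never evaluated, which makes an elementary proof
    possible, without integrals.  In one variable, finite Fourier inversion on
    the mesh of width 1/N expresses Sum_p gauss(x + p) through Riemann sums of
    translates of the Gaussian along horizontal lines (fourier_decomp).  As N
    grows such a Riemann sum forgets the line (riemann_sum_shift), the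
    coefficients decay uniformly in N (fourier_coef_decay), and dominated
    convergence concludes (poisson_limit).  The general case follows by induction
    on the dimension: one variable is inverted at a time, and the quadratic form
    in the others changes by a Schur complement. *)

Set Implicit Arguments.
Unset Strict Implicit.
Unset Printing Implicit Defensive.
Import Order.TTheory GRing.Theory Num.Theory.
Import numFieldNormedType.Exports.
Import Normc.
Local Open Scope ring_scope.
Local Open Scope complex_scope.

(** * Unconditional sums of complex families *)

Section Sums.
Variable R : realType.
Local Notation C := (R[i]).

Lemma normc_ge0 (z : C) : 0 <= normc z.
Proof. by case: z => a b; rewrite sqrtr_ge0. Qed.

Lemma normc_real (a : R) : normc a%:C = `|a|.
Proof. by rewrite /= expr0n addr0 sqrtr_sqr. Qed.

Lemma normc_le_ReIm (z : C) : normc z <= `|complex.Re z| + `|complex.Im z|.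
Proof.
case: z => a b /=.
rewrite -[leRHS]ger0_norm ?addr_ge0 // -sqrtr_sqr ler_wsqrtr //.
rewrite sqrrD !real_normK ?num_real // addrAC lerDl mulrn_wge0 // mulr_ge0.
Qed.

Lemma Re_le_normc (z : C) : `|complex.Re z| <= normc z.
Proof. by case: z => a b /=; rewrite -sqrtr_sqr ler_wsqrtr // lerDl sqr_ge0. Qed.

Lemma Im_le_normc (z : C) : `|complex.Im z| <= normc z.
Proof. by case: z => a b /=; rewrite -sqrtr_sqr ler_wsqrtr // lerDr sqr_ge0. Qed.

Lemma normc_sum (I : Type) (s : seq I) (P : pred I) (f : I -> C) :
  normc (\sum_(i <- s | P i) f i) <= \sum_(i <- s | P i) normc (f i).
Proof.
elim/big_rec2: _ => [|i y x _ le]; first by rewrite normc0.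
by apply: le_trans (le_normcD _ _) _; rewrite lerD2l.
Qed.

Lemma normcB (x y : C) : normc (x - y) = normc (y - x).
Proof. by rewrite -opprB normcN. Qed.

Lemma normc_small (z : C) : (forall e, 0 < e -> normc z < e) -> z = 0.
Proof.
move=> h; apply: eq0_normc; apply/eqP; rewrite eq_le normc_ge0 andbT leNgt.
by apply/negP => /h; rewrite ltxx.
Qed.

Lemma big_fsetM (V : nmodType) (I J : choiceType) (A : {fset I}) (B : {fset J})
    (f : I * J -> V) :
  \sum_(x <- (A `*` B)%fset) f x = \sum_(i <- A) \sum_(j <- B) f (i, j).
Proof.
rewrite -big_allpairs; apply: perm_big.
apply: uniq_perm; [exact: fset_uniq|by apply: allpairs_uniq => // -[? ?] []|].
move=> -[i j]; rewrite in_fsetM; apply/andP/allpairsP => /= [[iA jB]|]; first by exists (i, j).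
by move=> [[k l] /= [kA lB [-> ->]]].
Qed.

Lemma fsum_sub (I : choiceType) (g : I -> R) (A B : {fset I}) :
  (forall i, 0 <= g i) -> (A `<=` B)%fset ->
  \sum_(i <- A) g i <= \sum_(i <- B) g i.
Proof.
move=> g0 AB; rewrite [leRHS](big_fsetID _ [in A]) /=.
rewrite (_ : [fset _ in _ | _]%fset = A); last first.
  apply/fsetP => i; rewrite !inE /=; apply/andP/idP => [[]//|iA].
  by split=> //; exact: (fsubsetP AB).
by rewrite lerDl sumr_ge0.
Qed.

(** Convergence along the directed set of finite subsets.  The theta series are
    unordered sums, and this is the form in which they are rearranged. *)
Definition hasSum (I : choiceType) (f : I -> C) (s : C) :=
  forall e : R, 0 < e -> exists A : {fset I}, forall B : {fset I},
    (A `<=` B)%fset -> normc (\sum_(i <- B) f i - s) < e.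

Definition absSum (I : choiceType) (f : I -> C) :=
  exists M : R, forall A : {fset I}, \sum_(i <- A) normc (f i) <= M.

(** The default value 0 is returned for a family that is not summable; all uses
    below come with a proof of absolute summability. *)
Definition csum (I : choiceType) (f : I -> C) : C := xget 0 (hasSum f).

Section OneIndex.
Variable I : choiceType.
Implicit Types f g : I -> C.

Lemma hasSum_unique f s t : hasSum f s -> hasSum f t -> s = t.
Proof.
move=> hs ht; apply/eqP; rewrite -subr_eq0; apply/eqP/normc_small => e e0.
have e2 : 0 < e / 2 by lra.
have [A hA] := hs _ e2; have [B hB] := ht _ e2.
have := hA (A `|` B)%fset (fsubsetUl _ _).
have := hB (A `|` B)%fset (fsubsetUr _ _).
set x := \sum_(i <- _) _ => h1; rewrite normcB => h2.
rewrite (_ : s - t = (s - x) + (x - t)); last by ring.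
by apply: le_lt_trans (le_normcD _ _) _; lra.
Qed.

Lemma hasSum_csum f s : hasSum f s -> csum f = s.
Proof. by move=> h; rewrite /csum; case: xgetP => [t _ /hasSum_unique|/(_ s)//]; apply. Qed.

Lemma eq_csum f g : f =1 g -> csum f = csum g.
Proof. by move=> /funext ->. Qed.

Lemma hasSumD f g s t : hasSum f s -> hasSum g t -> hasSum (fun i => f i + g i) (s + t).
Proof.
move=> hs ht e e0; have e2 : 0 < e / 2 by lra.
have [A hA] := hs _ e2; have [B hB] := ht _ e2.
exists (A `|` B)%fset => D; rewrite fsubUset => /andP[/hA h1 /hB h2].
rewrite big_split /= opprD addrACA.
by apply: le_lt_trans (le_normcD _ _) _; lra.
Qed.

Lemma hasSumZ c f s : hasSum f s -> hasSum (fun i => c * f i) (c * s).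
Proof.
move=> hs e e0; have c1 : 0 < normc c + 1 by have := normc_ge0 c; lra.
have [A hA] := hs (e / (normc c + 1)) (divr_gt0 e0 c1).
exists A => B /hA; rewrite -mulr_sumr -mulrBr normcM ltr_pdivlMr // => h.
apply: le_lt_trans h; rewrite mulrC ler_wpM2l ?normc_ge0 //; lra.
Qed.

Lemma hasSum0 : hasSum (fun _ : I => 0) 0.
Proof. by move=> e e0; exists fset0 => B _; rewrite big1 // subrr normc0. Qed.

Lemma hasSum_sum (K : Type) (r : seq K) (f : K -> I -> C) (s : K -> C) :
  (forall k, hasSum (f k) (s k)) ->
  hasSum (fun i => \sum_(k <- r) f k i) (\sum_(k <- r) s k).
Proof.
move=> h; elim: r => [|k r IH].
  by rewrite big_nil; under eq_fun do rewrite big_nil; exact: hasSum0.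
by rewrite big_cons; under eq_fun do rewrite big_cons; exact: hasSumD.
Qed.

Lemma absSum_le f g : (forall i, normc (f i) <= normc (g i)) -> absSum g -> absSum f.
Proof.
move=> le [M hM]; exists M => A; apply: le_trans (hM A).
by apply: ler_sum => i _.
Qed.

Lemma absSumD f g : absSum f -> absSum g -> absSum (fun i => f i + g i).
Proof.
move=> [M hM] [N hN]; exists (M + N) => A; apply: le_trans (lerD (hM A) (hN A)).
by rewrite -big_split /=; apply: ler_sum => i _; exact: le_normcD.
Qed.

Lemma absSumZ c f : absSum f -> absSum (fun i => c * f i).
Proof.
move=> [M hM]; exists (normc c * M) => A.
under eq_bigr do rewrite normcM.
by rewrite -mulr_sumr ler_wpM2l ?normc_ge0.
Qed.

Lemma nonneg_hasSum (g : I -> R) M : (forall i, 0 <= g i) ->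
  (forall A : {fset I}, \sum_(i <- A) g i <= M) ->
  exists s, hasSum (fun i => (g i)%:C) s.
Proof.
move=> g0 gM; pose E := [set \sum_(i <- A) g i | A in [set: {fset I}]]%classic.
have hE : has_sup E.
  split; first by exists (\sum_(i <- fset0) g i); exists fset0.
  by exists M => _ [A _ <-].
exists (sup E)%:C => e e0.
have [_ [A _ <-] hA] := sup_adherent e0 hE.
exists A => B AB; rewrite -rmorph_sum -rmorphB normc_real /=.
have h1 : \sum_(i <- B) g i <= sup E.
  by apply: ub_le_sup; [exact: hE.2|exists B].
have h2 := fsum_sub g0 AB.
by rewrite distrC ger0_norm; lra.
Qed.

Lemma absSum_hasSum f : absSum f -> exists s, hasSum f s.
Proof.
move=> [M hM].
have [n hn] : exists s, hasSum (fun i => (normc (f i))%:C) s.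
  by apply: (@nonneg_hasSum _ M) => // i; exact: normc_ge0.
have key (g : I -> R) : (forall i, `|g i| <= normc (f i)) ->
    exists s, hasSum (fun i => (g i)%:C) s.
  move=> gf; have [s hs] : exists s, hasSum (fun i => (g i + normc (f i))%:C) s.
    apply: (@nonneg_hasSum _ (2 * M)) => [i|A].
      by have := gf i; rewrite ler_norml => /andP[]; lra.
    apply: (@le_trans _ _ (\sum_(i <- A) 2 * normc (f i))).
      by apply: ler_sum => i _; have := gf i; rewrite ler_norml => /andP[]; lra.
    by rewrite -mulr_sumr ler_wpM2l.
  exists (s + (-1) * n); have := hasSumD hs (hasSumZ (-1) hn).
  by congr hasSum; apply/funext => i; rewrite rmorphD mulN1r addrK.
have [a ha] := key (fun i => complex.Re (f i)) (fun i => Re_le_normc _).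
have [b hb] := key (fun i => complex.Im (f i)) (fun i => Im_le_normc _).
exists (a + 'i%C * b); have := hasSumD ha (hasSumZ 'i%C hb).
by congr hasSum; apply/funext => i; rewrite [RHS]complexE.
Qed.

Lemma csumP f : absSum f -> hasSum f (csum f).
Proof. by move=> /absSum_hasSum [s hs]; rewrite (hasSum_csum hs). Qed.

Lemma csumZ c f : absSum f -> csum (fun i => c * f i) = c * csum f.
Proof. by move=> /csumP /(hasSumZ c) /hasSum_csum. Qed.

Lemma csumD f g : absSum f -> absSum g ->
  csum (fun i => f i + g i) = csum f + csum g.
Proof. by move=> /csumP hf /csumP hg; exact/hasSum_csum/hasSumD. Qed.

Lemma normc_csum_le f M : (forall A : {fset I}, \sum_(i <- A) normc (f i) <= M) ->
  normc (csum f) <= M.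
Proof.
move=> hM; apply/ler_addgt0Pl => e e0.
have [A /(_ A (fsubset_refl _))] := csumP (ex_intro _ M hM) e0.
set x := \sum_(i <- A) _; rewrite normcB => h.
rewrite (_ : csum f = (csum f - x) + x); last by ring.
apply: le_trans (le_normcD _ _) _; rewrite lerD ?(ltW h) //.
exact: le_trans (normc_sum _ _ _) (hM A).
Qed.

Lemma hasSum_finite f (A : {fset I}) : (forall i, i \notin A -> f i = 0) ->
  hasSum f (\sum_(i <- A) f i).
Proof.
move=> fA e e0; exists A => B AB.
suff -> : \sum_(i <- B) f i = \sum_(i <- A) f i by rewrite subrr normc0.
rewrite (big_fsetID _ [in A]) /= [X in _ + X]big1_fset ?addr0; last first.
  by move=> i; rewrite !inE => /andP[_ /= iA] _; exact: fA.
rewrite (_ : [fset _ in _ | _]%fset = A) //.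
apply/fsetP => i; rewrite !inE /=; apply/andP/idP => [[]//|iA].
by split=> //; exact: (fsubsetP AB).
Qed.

End OneIndex.

Lemma hasSum_bij (I J : choiceType) (h : J -> I) (h' : I -> J) (f : I -> C) s :
  cancel h h' -> cancel h' h -> hasSum f s -> hasSum (f \o h) s.
Proof.
move=> hK h'K hs e /hs [A hA]; exists (h' @` A)%fset => B AB.
have inj : injective h := can_inj hK.
rewrite (_ : \sum_(i <- B) _ = \sum_(i <- (h @` B)%fset) f i).
  apply: hA; apply/fsubsetP => i iA; apply/imfsetP; exists (h' i); last by rewrite h'K.
  by apply: (fsubsetP AB); apply/imfsetP; exists i.
by rewrite big_imfset //= => x y _ _ /inj.
Qed.

Lemma absSum_inj (I J : choiceType) (h : J -> I) (f : I -> C) :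
  injective h -> absSum f -> absSum (f \o h).
Proof.
move=> inj [M hM]; exists M => A; apply: le_trans (hM (h @` A)%fset).
by rewrite big_imfset //= => x y _ _ /inj.
Qed.

Lemma csum_bij (I J : choiceType) (h : J -> I) (h' : I -> J) (f : I -> C) :
  cancel h h' -> cancel h' h -> absSum f -> csum (f \o h) = csum f.
Proof. by move=> hK h'K /csumP hf; exact/hasSum_csum/(hasSum_bij hK h'K). Qed.

Section Product.
Variables I J : choiceType.

Lemma absSum_tensor (f : I * J -> C) (a : I -> R) (b : J -> R) Ma Mb :
  (forall i, 0 <= a i) -> (forall j, 0 <= b j) ->
  (forall A : {fset I}, \sum_(i <- A) a i <= Ma) ->
  (forall A : {fset J}, \sum_(i <- A) b i <= Mb) ->
  (forall x, normc (f x) <= a x.1 * b x.2) -> absSum f.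
Proof.
move=> a0 b0 hMa hMb fab; exists (Ma * Mb) => A.
pose A1 := ((@fst I J) @` A)%fset; pose A2 := ((@snd I J) @` A)%fset.
apply: (@le_trans _ _ (\sum_(x <- (A1 `*` A2)%fset) a x.1 * b x.2)).
  apply: (@le_trans _ _ (\sum_(x <- A) a x.1 * b x.2)).
    by apply: ler_sum => x _.
  apply: fsum_sub => [x|]; first exact: mulr_ge0.
  apply/fsubsetP => -[i j] ij; rewrite in_fsetM; apply/andP.
  by split; apply/imfsetP; exists (i, j).
rewrite big_fsetM /=.
under eq_bigr do rewrite -mulr_sumr.
rewrite -mulr_suml; apply: ler_pM => //; exact: sumr_ge0.
Qed.

Variable f : I * J -> C.
Hypothesis absf : absSum f.

Lemma absSum_row i : absSum (fun j => f (i, j)).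
Proof. by apply: (@absSum_inj _ _ (fun j => (i, j))) absf => x y []. Qed.

(** Finitely many rows can be approximated with one and the same finite set of
    columns; this is what makes the exchange of summations work. *)
Lemma csum_row_uniform (A : {fset I}) (e : R) : 0 < e ->
  exists B : {fset J}, forall B', (B `<=` B')%fset -> forall i, i \in A ->
    normc (\sum_(j <- B') f (i, j) - csum (fun j => f (i, j))) < e.
Proof.
move=> e0; suff : forall s : seq I, exists B : {fset J}, forall B', (B `<=` B')%fset ->
    forall i, i \in s -> normc (\sum_(j <- B') f (i, j) - csum (fun j => f (i, j))) < e.
  by move=> /(_ A).
elim=> [|i s [B hB]]; first by exists fset0.
have [B2 h2] := csumP (absSum_row i) e0.
exists (B `|` B2)%fset => B'; rewrite fsubUset => /andP[/hB h /h2 h'] k.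
by rewrite inE => /orP[/eqP ->|/h].
Qed.

Lemma absSum_fst : absSum (fun i => csum (fun j => f (i, j))).
Proof.
case: absf => M hM; exists M => A; apply/ler_addgt0Pl => e e0.
have e1 : 0 < e / (size A).+1%:R by rewrite divr_gt0 ?ltr0Sn.
have [B /(_ B (fsubset_refl _)) hB] := csum_row_uniform A e1.
apply: (@le_trans _ _ (\sum_(i <- A) (e / (size A).+1%:R + \sum_(j <- B) normc (f (i, j))))).
  rewrite !big_seq; apply: ler_sum => i iA; rewrite -lerBlDr.
  have := hB i iA; set x : C := \sum_(j <- B) f (i, j); rewrite normcB => h.
  rewrite lerBlDr (_ : csum _ = (csum (fun j => f (i, j)) - x) + x); last by ring.
  apply: le_trans (le_normcD _ _) _; apply: lerD; first exact: ltW.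
  exact: normc_sum.
rewrite big_split /=; apply: lerD.
  rewrite big_const_seq count_predT iter_addr_0 -[X in X <= _]mulr_natr mulrAC ler_pdivrMr; last first.
    exact: ltr0Sn.
  by rewrite ler_wpM2l ?(ltW e0) // ler_nat.
have := hM (A `*` B)%fset; apply: le_trans.
by rewrite big_fsetM.
Qed.

(** Fubini: a large finite set of pairs can be enlarged to a rectangle whose
    rows are already close to their sums. *)
Lemma csum_pair : csum f = csum (fun i => csum (fun j => f (i, j))).
Proof.
symmetry; apply: hasSum_csum => e e0; have e2 : 0 < e / 2 by lra.
have [A hA] := csumP absf e2; exists ((@fst I J) @` A)%fset => B AB.
have e1 : 0 < e / 2 / (size B).+1%:R by rewrite divr_gt0 ?ltr0Sn.
have [D hD] := csum_row_uniform B e1.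
pose D' := (D `|` (@snd I J) @` A)%fset.
have {hD} := hD D' (fsubsetUl _ _) => hD.
have /hA : (A `<=` B `*` D')%fset.
  apply/fsubsetP => -[i j] ij; rewrite in_fsetM; apply/andP; split.
    by apply: (fsubsetP AB); apply/imfsetP; exists (i, j).
  by rewrite inE; apply/orP; right; apply/imfsetP; exists (i, j).
rewrite big_fsetM /= => h.
set S := \sum_(i <- B) csum _; set T := \sum_(i <- B) _ in h.
have hST : normc (S - T) <= e / 2.
  rewrite /S /T -sumrB; apply: le_trans (normc_sum _ _ _) _.
  apply: (@le_trans _ _ (\sum_(i <- B) (e / 2 / (size B).+1%:R))).
    by rewrite !big_seq; apply: ler_sum => i /hD /ltW; rewrite normcB.
  rewrite big_const_seq count_predT iter_addr_0 -[X in X <= _]mulr_natr mulrAC ler_pdivrMr; last first.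
    exact: ltr0Sn.
  by rewrite ler_wpM2l ?(ltW e2) // ler_nat.
rewrite (_ : S - _ = (S - T) + (T - csum f)); last by ring.
by apply: le_lt_trans (le_normcD _ _) _; lra.
Qed.

End Product.

Lemma csum_pair_swap (I J : choiceType) (f : I * J -> C) : absSum f ->
  csum f = csum (fun j => csum (fun i => f (i, j))).
Proof.
move=> absf; pose sw (x : J * I) := (x.2, x.1); pose sw' (x : I * J) := (x.2, x.1).
have K : cancel sw sw' by case.
have K' : cancel sw' sw by case.
rewrite -(csum_bij K K' absf) csum_pair //.
by apply: absSum_inj absf; exact: can_inj K.
Qed.

Lemma csum_mul (I J : choiceType) (f : I -> C) (g : J -> C) :
  absSum f -> absSum g -> absSum (fun x : I * J => f x.1 * g x.2) /\
  csum (fun x : I * J => f x.1 * g x.2) = csum f * csum g.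
Proof.
move=> af ag; have afg : absSum (fun x : I * J => f x.1 * g x.2).
  case: (af) (ag) => Mf hf [Mg hg].
  apply: (absSum_tensor (a := fun i => normc (f i)) (b := fun i => normc (g i))) hf hg _.
  - by move=> i; exact: normc_ge0.
  - by move=> i; exact: normc_ge0.
  - by move=> x; rewrite normcM.
split=> //; rewrite csum_pair //=.
under eq_csum => i do rewrite csumZ // mulrC.
by rewrite csumZ // mulrC.
Qed.

Lemma sum_hasSum (I : choiceType) (f : I -> C) s : hasSum f s ->
  summability.sum (f : I -> C^o) = s.
Proof.
have FF := @summability.totally_filter I.
move=> hs; rewrite /summability.sum; apply/(cvg_lim (@norm_hausdorff _ _)).
apply/cvgrPdist_lt => e; rewrite ltcE /= => /andP[/eqP ime e0].
have [A hA] := hs _ e0.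
exists A => //= B AB; rewrite /summability.partial_sum.
rewrite (_ : \sum_(i : B) _ = \sum_(i <- B) f i); last by rewrite big_seq_fsetE.
have := hA B AB; rewrite normcB => h.
rewrite (_ : `|_|%R = (normc (s - \sum_(i <- B) f i))%:C) //.
by rewrite ltcE /= ime eqxx.
Qed.

End Sums.

(** * Elementary estimates and the character e *)

Section Elementary.
Variable R : realType.
Local Notation C := (R[i]).

(** The mean value theorem between 0 and x, in a form that covers both signs of x. *)
Lemma MVT_from0 (f df : R -> R) (x : R) :
  (forall y : R, is_derive y (1 : R) f (df y)) ->
  exists2 c, `|c| <= `|x| & f x - f 0 = df c * x.
Proof.
move=> fd; have fc y : {for y, continuous f}.
  by apply/differentiable_continuous/derivable1_diffP; case: (fd y).
case: (ler0P x) => x0.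
  have [c] := @MVT_segment R f df x 0 x0 (fun y _ => fd y)
    (continuous_subspaceT fc).
  rewrite in_itv /= => /andP[xc c0] h; exists c; last by rewrite -opprB h sub0r mulrN opprK.
  by rewrite (ler0_norm c0) lerN2.
have [c] := @MVT_segment R f df 0 x (ltW x0) (fun y _ => fd y)
  (continuous_subspaceT fc).
rewrite in_itv /= subr0 => /andP[xc c0] h; exists c => //.
by rewrite ger0_norm.
Qed.

Lemma norm_sin_le (x : R) : `|sin x| <= `|x|.
Proof.
have [c _] := MVT_from0 x (@is_derive_sin R).
by rewrite sin0 subr0 => ->; rewrite normrM ler_piMl // cos_max.
Qed.

Lemma cos_half (x : R) : 1 - cos x = 2 * sin (x / 2) ^+ 2.
Proof.
have {1}-> : x = (x / 2) *+ 2 by rewrite -mulr_natr divfK.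
by rewrite cos_mulr2n cos2sin2; ring.
Qed.

Lemma norm_1Bcos_le2 (x : R) : `|1 - cos x| <= x ^+ 2.
Proof.
rewrite cos_half ger0_norm; last by apply: mulr_ge0 => //; exact: sqr_ge0.
rewrite -[x ^+ 2]real_normK ?num_real // -[sin _ ^+ 2]real_normK ?num_real //.
have := norm_sin_le (x / 2); rewrite normrM [ `|2^-1| ]ger0_norm // => h.
have := normr_ge0 (sin (x / 2)); have := normr_ge0 x; nra.
Qed.

Lemma norm_1Bcos_le (x : R) : `|1 - cos x| <= `|x|.
Proof.
rewrite cos_half ger0_norm; last by apply: mulr_ge0 => //; exact: sqr_ge0.
rewrite -[sin _ ^+ 2]real_normK ?num_real //.
have := norm_sin_le (x / 2); rewrite normrM [ `|2^-1| ]ger0_norm // => h.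
have := normr_ge0 (sin (x / 2)); have := sin_max (x / 2); nra.
Qed.

Lemma norm_sinB_le (x : R) : `|sin x - x| <= x ^+ 2.
Proof.
have [c hc] := MVT_from0 x (@is_derive_sin R).
rewrite sin0 subr0 => ->; rewrite (_ : _ - x = - ((1 - cos c) * x)); last by ring.
rewrite normrN normrM -[x ^+ 2]real_normK ?num_real // expr2 ler_wpM2r //.
exact: le_trans (norm_1Bcos_le c) hc.
Qed.

(** A lower bound that is linear up to pi / 2: halving the angle twice reduces it
    to cos (pi / 4) ^ 2 = 1 / 2. *)
Lemma sin_ge_half (x : R) : 0 <= x <= pi / 2 -> x / 2 <= sin x.
Proof.
move=> /andP[x0 xpi]; have pi0 := pi_gt0 R.
have c4 : cos (pi / 4) ^+ 2 = 1 / 2 :> R.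
  have := cos_pihalf R; rewrite (_ : pi / 2 = (pi / 4) *+ 2); last by rewrite -mulr_natr; field.
  by rewrite cos_mulr2n; lra.
have cge (c : R) : `|c| <= pi / 4 -> cos (pi / 4) <= cos c.
  move=> h; have -> : cos c = cos `|c|.
    by case: (ler0P c) => // _; rewrite cosN.
  have := @ltr_cos R (pi / 4) `|c|; rewrite !in_itv /= !leNgt => ->; first by rewrite -leNgt.
    by rewrite -!leNgt; apply/andP; split; lra.
  by rewrite -!leNgt normr_ge0 /=; lra.
have cp : 0 < cos (pi / 4) :> R by apply: cos_gt0_pihalf; apply/andP; split; lra.
have [c hc] := MVT_from0 (x / 2) (@is_derive_sin R).
rewrite sin0 subr0 => hs.
have x2 : `|x / 2| = x / 2 by rewrite ger0_norm //; lra.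
have h1 := cge c; have h2 := cge (x / 2).
rewrite x2 in h2 hc.
have {1}-> : x = (x / 2) * 2 by rewrite divfK.
have -> : sin x = 2 * (sin (x / 2) * cos (x / 2)).
  have {1}-> : x = (x / 2) *+ 2 by rewrite -mulr_natr divfK.
  by rewrite sin_mulr2n; ring.
rewrite hs; have {}h1 : cos (pi / 4) <= cos c by apply: h1; lra.
have {}h2 : cos (pi / 4) <= cos (x / 2) by apply: h2; lra.
have : cos (pi / 4) ^+ 2 <= cos c * cos (x / 2) by rewrite expr2 ler_pM // ltW.
rewrite c4; nra.
Qed.

Lemma norm_expRB1_le (x : R) : `|expR x - 1| <= `|x| * expR `|x|.
Proof.
have [c hc] := MVT_from0 x (@is_derive_expR R).
rewrite expR0 => ->; rewrite normrM mulrC ler_wpM2l //.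
by rewrite ger0_norm ?expR_ge0 // ler_expR (le_trans (ler_norm _)).
Qed.

Lemma norm_expRB1B_le (x : R) : `|expR x - 1 - x| <= x ^+ 2 * expR `|x|.
Proof.
have [c hc] := MVT_from0 x (@is_derive_expR R).
rewrite expR0 => ->; rewrite (_ : _ - x = (expR c - 1) * x); last by ring.
rewrite normrM -[x ^+ 2]real_normK ?num_real // expr2 mulrAC ler_wpM2r //.
apply: le_trans (norm_expRB1_le c) _.
by rewrite ler_pM ?expR_ge0 // ler_expR.
Qed.

Lemma eeE (z : C) : ee z = (expR (- (2 * pi * complex.Im z)))%:C *
  (cos (2 * pi * complex.Re z) +i* sin (2 * pi * complex.Re z)).
Proof.
case: z => a b; rewrite /ee /cexp /=.
congr (_ * _); first by congr (expR _)%:C; ring.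
by congr (cos _ +i* sin _); ring.
Qed.

Lemma eeD (x y : C) : ee (x + y) = ee x * ee y.
Proof.
rewrite !eeE; case: x y => a b [c d] /=.
apply/eqP; rewrite eq_complex /= !mulrDr opprD expRD cosD sinD.
by apply/andP; split; apply/eqP; ring.
Qed.

Lemma ee0 : ee (0 : C) = 1.
Proof.
rewrite eeE /= !mulr0 oppr0 expR0 cos0 sin0 mul1r.
by apply/eqP; rewrite eq_complex /= !eqxx.
Qed.

Lemma normc_ee (z : C) : normc (ee z) = expR (- (2 * pi * complex.Im z)).
Proof.
rewrite eeE normcM normc_real ger0_norm ?expR_ge0 //.
by rewrite /= cos2Dsin2 sqrtr1 mulr1.
Qed.

Lemma ee_neq0 (z : C) : ee z != 0.
Proof.
apply/eqP => h; have := normc_ee z; rewrite h normc0 => /eqP.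
by rewrite lt_eqF ?expR_gt0.
Qed.

Lemma eeN (z : C) : ee (- z) = (ee z)^-1.
Proof. by apply: (mulIf (ee_neq0 z)); rewrite -eeD addNr ee0 mulVf ?ee_neq0. Qed.

Lemma ee1 : ee (1 : C) = 1.
Proof.
rewrite eeE /= mulr0 oppr0 expR0 mulr1 mul1r mulr_natl cos2pi sin_mulr2n sinpi.
by rewrite mulr0 mul0rn; apply/eqP; rewrite eq_complex /= !eqxx.
Qed.

Lemma ee_nat n : ee (n%:R : C) = 1.
Proof. by elim: n => [|n IH]; rewrite ?ee0 // -natr1 eeD IH ee1 mulr1. Qed.

Lemma ee_int (n : int) : ee (n%:~R : C) = 1.
Proof.
case: n => n; first by rewrite -pmulrn ee_nat.
by rewrite NegzE mulrNz eeN -pmulrn ee_nat invr1.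
Qed.

Lemma ee_shift (x y : C) (n : int) : x - y = n%:~R -> ee x = ee y.
Proof. by move=> h; rewrite -[x](subrK y) h eeD ee_int mul1r. Qed.

Lemma ee_real (a : R) : ee a%:C = cos (2 * pi * a) +i* sin (2 * pi * a).
Proof. by rewrite eeE /= mulr0 oppr0 expR0 mul1r. Qed.

(** The three summands of the proof are the second order errors of the real
    exponential, of the trigonometric part, and of their interaction. *)
Lemma ee_taylor (z : C) :
  normc (ee z - 1 - 2 * pi%:C * 'i%C * z) <=
  4 * (2 * pi * normc z) ^+ 2 * expR (2 * pi * normc z).
Proof.
set r := 2 * pi * normc z; have pi0 := pi_gt0 R.
set a := - (2 * pi * complex.Im z); set b := 2 * pi * complex.Re z.
have ha : `|a| <= r.
  rewrite /a normrN normrM ger0_norm; last by lra.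
  by rewrite ler_wpM2l ?Im_le_normc //; lra.
have hb : `|b| <= r.
  rewrite /b normrM ger0_norm; last by lra.
  by rewrite ler_wpM2l ?Re_le_normc //; lra.
have -> : ee z - 1 - 2 * pi%:C * 'i%C * z = (expR a - 1 - a)%:C +
    (expR a)%:C * ((cos b - 1) +i* (sin b - b)) + (b * (expR a - 1))%:C * 'i%C.
  rewrite eeE -/a -/b; apply/eqP; rewrite eq_complex /a /b; case: (z) => u v /=.
  by apply/andP; split; apply/eqP; ring.
have ea : expR a <= expR r by rewrite ler_expR (le_trans (ler_norm _)).
have eb : expR `|a| <= expR r by rewrite ler_expR.
have r0 : 0 <= r by apply: le_trans ha.
have e0 := expR_gt0 r.
have sq (x : R) : `|x| <= r -> x ^+ 2 <= r ^+ 2.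
  by move=> h; rewrite -real_normK ?num_real // ler_sqr ?nnegrE.
have h1 : normc (expR a - 1 - a)%:C <= r ^+ 2 * expR r.
  rewrite normc_real; apply: le_trans (norm_expRB1B_le a) _.
  by rewrite ler_pM ?sqr_ge0 ?expR_ge0 ?sq.
have h2 : normc ((cos b - 1) +i* (sin b - b)) <= 2 * r ^+ 2.
  apply: le_trans (normc_le_ReIm _) _ => /=.
  have := norm_1Bcos_le2 b; have := norm_sinB_le b; have := sq b hb.
  by rewrite [ `|cos b - 1| ]distrC; lra.
have h3 : normc (b * (expR a - 1))%:C <= r * (r * expR r).
  rewrite normc_real normrM ler_pM //; apply: le_trans (norm_expRB1_le a) _.
  by rewrite ler_pM ?expR_ge0.
apply: le_trans (le_normcD _ _) _; rewrite normcM [normc 'i%C](_ : _ = 1); last first.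
  by rewrite /= expr0n expr1n add0r sqrtr1.
have h4 : normc ((expR a)%:C * ((cos b - 1) +i* (sin b - b))) <= expR r * (2 * r ^+ 2).
  rewrite normcM ler_pM ?normc_ge0 // normc_real ger0_norm ?expR_ge0 //.
have := le_normcD (expR a - 1 - a)%:C ((expR a)%:C * ((cos b - 1) +i* (sin b - b))).
rewrite mulr1; move: h1 h3 h4.
set x1 := normc _; set x2 := normc _; set x3 := normc _; set x4 := normc _.
set E := expR r; nra.
Qed.

End Elementary.

(** * Dominated convergence and sums over the integers *)

Section Tannery.
Variable R : realType.
Local Notation C := (R[i]).

(** This replaces ordering the index set: a finite set of indices carries almost
    all of the sum, so sums over sets disjoint from it are small. *)
Lemma tail_small (I : choiceType) (g : I -> R) M (e : R) : (forall i, 0 <= g i) ->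
  (forall A : {fset I}, \sum_(i <- A) g i <= M) -> 0 < e ->
  exists A0 : {fset I}, forall A : {fset I}, [disjoint A & A0]%fset ->
    \sum_(i <- A) g i < e.
Proof.
move=> g0 gM e0; have [s hs] := nonneg_hasSum g0 gM.
have e2 : 0 < e / 2 by lra.
have [A0 hA0] := hs _ e2; exists A0 => A dis.
have := hA0 A0 (fsubset_refl _); have := hA0 (A0 `|` A)%fset (fsubsetUl _ _).
rewrite (_ : \sum_(i <- (A0 `|` A)%fset) (g i)%:C =
  \sum_(i <- A0) (g i)%:C + \sum_(i <- A) (g i)%:C); last first.
  rewrite (big_fsetID _ [in A0]) /=; congr (_ + _); apply: eq_fbigl => i; rewrite !inE /=.
    by case: (i \in A0); rewrite ?andbT ?andbF.
  case iA0 : (i \in A0) => /=; last by rewrite andbT.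
  by apply/esym/negbTE; apply/negP => iA; move/fdisjointP: dis => /(_ _ iA); rewrite iA0.
set x := \sum_(i <- A0) _; set y := \sum_(i <- A) _ => h1 h2.
have : normc y < e.
  rewrite (_ : y = (x + y - s) - (x - s)); last by ring.
  by apply: le_lt_trans (le_normcD _ _) _; rewrite normcN; lra.
by rewrite /y -rmorph_sum normc_real /= ger0_norm // sumr_ge0.
Qed.

(** Dominated convergence for sums. *)
Lemma tannery (I : choiceType) (f : nat -> I -> C) (g : I -> R) M :
  (forall A : {fset I}, \sum_(i <- A) g i <= M) ->
  (forall n i, normc (f n i) <= g i) ->
  (forall i (e : R), 0 < e -> exists n0, forall n, (n0 <= n)%N -> normc (f n i) < e) ->
  forall e : R, 0 < e -> exists n0, forall n, (n0 <= n)%N -> normc (csum (f n)) <= e.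
Proof.
move=> gM fg f0 e e0.
have g0 i : 0 <= g i by apply: le_trans (fg 0%N i); exact: normc_ge0.
have e2 : 0 < e / 2 by lra.
have [A0 hA0] := tail_small g0 gM e2.
have e1 : 0 < e / 2 / (size A0).+1%:R by rewrite divr_gt0 ?ltr0Sn.
have [n0 hn0] : exists n0, forall n, (n0 <= n)%N -> forall i, i \in A0 ->
    normc (f n i) <= e / 2 / (size A0).+1%:R.
  move: e1; set c := e / 2 / _ => e1.
  suff : forall s : seq I, exists n0, forall n, (n0 <= n)%N -> forall i, i \in s ->
    normc (f n i) <= c by move=> /(_ A0).
  elim=> [|i s [n1 h1]]; first by exists 0%N.
  have [n2 h2] := f0 i _ e1.
  exists (maxn n1 n2) => n; rewrite geq_max => /andP[/h1 hn1 /h2 hn2] k.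
  by rewrite inE => /orP[/eqP ->|/hn1//]; exact: ltW.
exists n0 => n /hn0 hn; apply: normc_csum_le => A.
rewrite (big_fsetID _ [in A0]) /= [leRHS](_ : e = e / 2 + e / 2); last by lra.
apply: lerD.
  apply: (@le_trans _ _ (\sum_(i <- A0) normc (f n i))).
    apply: fsum_sub => [i|]; first exact: normc_ge0.
    by apply/fsubsetP => i; rewrite !inE /= => /andP[].
  apply: (@le_trans _ _ (\sum_(i <- A0) e / 2 / (size A0).+1%:R)).
    by rewrite !big_seq; apply: ler_sum => i /hn.
  rewrite big_const_seq count_predT iter_addr_0 -[X in X <= _]mulr_natr mulrAC ler_pdivrMr; last first.
    exact: ltr0Sn.
  by rewrite ler_wpM2l ?(ltW e2) // ler_nat.
apply: le_trans (ltW (hA0 [fset x | x in A & x \notin A0]%fset _)).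
  by apply: ler_sum => i _.
by apply/fdisjointP => i; rewrite !inE /= => /andP[].
Qed.

(** A common majorant for all Gaussians: it is summable over every lattice in R, and
    up to constants insensitive to translations. *)
Definition rho (x : R) : R := (1 + x ^+ 2)^-1.

Lemma rho_den (x : R) : 0 < 1 + x ^+ 2.
Proof. by have := sqr_ge0 x; lra. Qed.

Lemma rho_gt0 x : 0 < rho x.
Proof. by rewrite invr_gt0 rho_den. Qed.

(** Half of the Gaussian decay absorbs the linear exponent, the other half beats
    the polynomial 1 + x ^ 2. *)
Lemma gauss_rho (a b : R) : 0 < a ->
  exists2 K, 0 < K & forall x, expR (- a * x ^+ 2 + b * `|x|) <= K * rho x.
Proof.
move=> a0; pose d := Num.min 1 (a / 2).
have d0 : 0 < d by rewrite lt_min; apply/andP; split; lra.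
have d1 : d <= 1 by rewrite ge_min lexx.
have d2 : d <= a / 2 by rewrite ge_min lexx orbT.
exists (d^-1 * expR (b ^+ 2 / (2 * a))).
  by rewrite mulr_gt0 ?invr_gt0 ?expR_gt0.
move=> x; rewrite ler_pdivlMr ?rho_den // mulrC.
have h1 : 1 + x ^+ 2 <= d^-1 * expR (d * x ^+ 2).
  rewrite -ler_pdivrMl ?invr_gt0 // invrK.
  by apply: le_trans (expR_ge1Dx _); have := sqr_ge0 x; nra.
apply: (@le_trans _ _ (d^-1 * expR (d * x ^+ 2) * expR (- a * x ^+ 2 + b * `|x|))).
  by rewrite ler_wpM2r ?expR_ge0.
rewrite -mulrA -expRD ler_wpM2l ?invr_ge0 ?(ltW d0) // ler_expR.
have q : 0 <= (a / 2) * (`|x| - b / a) ^+ 2 by rewrite mulr_ge0 ?sqr_ge0 //; lra.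
have e : (a / 2) * (`|x| - b / a) ^+ 2 = (a / 2) * `|x| ^+ 2 - b * `|x| + b ^+ 2 / (2 * a).
  by field; lra.
rewrite real_normK ?num_real // in e; rewrite e in q.
by have := sqr_ge0 x; nra.
Qed.

(** Sums over finite sets of integers are controlled by the sums over the
    nonnegative and over the nonpositive integers. *)
Lemma int_sum_le (g : int -> R) (B : R) : (forall k, 0 <= g k) ->
  (forall n, \sum_(j < n) g j%:Z <= B) -> (forall n, \sum_(j < n) g (- j%:Z) <= B) ->
  forall A : {fset int}, \sum_(k <- A) g k <= 2 * B.
Proof.
move=> g0 h1 h2 A; pose n := (\max_(k <- A) absz k).+1.
have An k : k \in A -> (absz k < n)%N.
  by move=> kA; rewrite ltnS; apply: leq_bigmax_seq kA _.
have one (c : int) : \sum_(k <- A) (k == c)%:R <= 1 :> R.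
  have [cA|cA] := boolP (c \in A).
    rewrite (big_fsetD1 c) //= eqxx big1_seq ?addr0 // => k /andP[_].
    by rewrite !inE => /andP[/negbTE -> _].
  rewrite big1_seq ?ler01 // => k /andP[_ kA].
  by case: eqP kA cA => [->|_ _ _] // ->.
have le k : k \in A ->
    g k <= \sum_(j < n) (g j%:Z * (k == j%:Z)%:R + g (- j%:Z) * (k == - j%:Z)%:R).
  move=> /An kn; rewrite (bigD1 (Ordinal kn)) //=.
  apply: ler_wpDr; first by apply: sumr_ge0 => j _; rewrite addr_ge0 ?mulr_ge0.
  case: (lerP 0 k) => k0.
    by rewrite gez0_abs // eqxx mulr1 lerDl mulr_ge0.
  by rewrite ltz0_abs // opprK eqxx mulr1 lerDr mulr_ge0.
apply: (@le_trans _ _ (\sum_(k <- A) \sum_(j < n)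
    (g j%:Z * (k == j%:Z)%:R + g (- j%:Z) * (k == - j%:Z)%:R))).
  by rewrite !big_seq; apply: ler_sum => k /le.
rewrite exchange_big /= mulr2n mulrDl !mul1r.
apply: le_trans (lerD (h1 n) (h2 n)); rewrite -big_split /=.
apply: ler_sum => j _; rewrite big_split /= -!mulr_sumr.
by apply: lerD; rewrite ler_piMr.
Qed.
End Tannery.

(** * Bounds for complex Gaussians *)

Section Gauss.
Variable R : realType.
Local Notation C := (R[i]).

(** N / (N ^ 2 + j ^ 2) is at most 4 N times the difference of 1 / (N + j) and
    1 / (N + j + 1), and the latter telescopes. *)
Lemma riemann_rho_nat (N n : nat) : (0 < N)%N ->
  \sum_(j < n) N%:R^-1 * rho (j%:R / N%:R) <= 4 :> R.
Proof.
move=> N0; have Np : 0 < N%:R :> R by rewrite ltr0n.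
suff : \sum_(j < n) N%:R^-1 * rho (j%:R / N%:R) <= 4 * N%:R * (N%:R^-1 - (N%:R + n%:R)^-1) :> R.
  move=> h; apply: le_trans h _.
  rewrite mulrBr -mulrA mulfV ?gt_eqF // mulr1 lerBlDr lerDl.
  by rewrite !mulr_ge0 ?invr_ge0 ?addr_ge0 // ltW.
elim: n => [|n IH]; first by rewrite big_ord0 addr0 subrr mulr0.
rewrite big_ord_recr /=; apply: le_trans (lerD IH (lexx _)) _.
have n0 : 0 <= n%:R :> R by [].
rewrite -natr1; set x : R := N%:R in Np *; set y : R := n%:R in n0 *.
rewrite -lerBrDl /rho.
rewrite (_ : x^-1 * (1 + (y / x) ^+ 2)^-1 = x / (x ^+ 2 + y ^+ 2)); last first.
  by field; rewrite !gt_eqF //=; nra.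
rewrite [leRHS](_ : _ = 4 * x / ((x + y) * (x + y + 1))); last first.
  by field; rewrite !gt_eqF //=; nra.
have N1 : 1 <= x by rewrite ler1n.
rewrite ler_pdivlMr; last by nra.
rewrite mulrAC ler_pdivrMr; last by nra.
rewrite -[leRHS]mulrA [leRHS]mulrCA ler_wpM2l ?(ltW Np) //.
have h1 : 0 <= (x + y) * (x + y - 1) by apply: mulr_ge0; lra.
have h2 := sqr_ge0 (x - y); lra.
Qed.

Lemma rhoN (x : R) : rho (- x) = rho x.
Proof. by rewrite /rho sqrrN. Qed.

Lemma rho_shift (x u : R) : rho (x + u) <= 2 * (1 + x ^+ 2) * rho u.
Proof.
rewrite /rho ler_pdivlMr ?rho_den // mulrC ler_pdivrMr ?rho_den //.
by have := sqr_ge0 x; have := sqr_ge0 (2 * x + u); have := sqr_ge0 (x * (x + u)); nra.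
Qed.

Lemma riemann_rho (N : nat) (x : R) (A : {fset int}) : (0 < N)%N ->
  \sum_(j <- A) rho (x + j%:~R / N%:R) <= 16 * (1 + x ^+ 2) * N%:R.
Proof.
move=> N0; have Np : 0 < N%:R :> R by rewrite ltr0n.
have := @int_sum_le R (fun j => N%:R^-1 * rho (j%:~R / N%:R)) 4.
move=> /(_ _ _ _ A) h.
have {}h : \sum_(k <- A) N%:R^-1 * rho (k%:~R / N%:R) <= 2 * 4 :> R.
  apply: h => [k|n|n].
  - by apply: mulr_ge0; [rewrite invr_ge0 ler0n|exact/ltW/rho_gt0].
  - exact: riemann_rho_nat.
  - under eq_bigr do rewrite mulrNz mulNr rhoN; exact: riemann_rho_nat.
rewrite -mulr_sumr ler_pdivrMl // in h.
apply: (@le_trans _ _ (\sum_(j <- A) 2 * (1 + x ^+ 2) * rho (j%:~R / N%:R))).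
  by apply: ler_sum => j _; exact: rho_shift.
rewrite -mulr_sumr; have := rho_den x; nra.
Qed.

Definition gauss (t z : C) : C := ee (2^-1 * t * z ^+ 2).

Lemma normc_le_ReB (z : C) B : `|complex.Im z| <= B -> normc z <= `|complex.Re z| + B.
Proof. by move=> h; apply: le_trans (normc_le_ReIm _) _; rewrite lerD2l. Qed.

(** For bounded imaginary part of z, the modulus of the Gaussian decays like a
    real Gaussian in Re z, faster than exp (L |z|) grows. *)
Lemma gauss_bound (t : C) (B L : R) : 0 < complex.Im t ->
  exists2 K, 0 < K & forall z : C, `|complex.Im z| <= B ->
    normc (gauss t z) * expR (L * normc z) <= K * rho (complex.Re z).
Proof.
case: t => r s s0; rewrite /= in s0; have pi0 := pi_gt0 R.
have a0 : 0 < pi * s by rewrite mulr_gt0.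
have [K K0 hK] := gauss_rho (2 * pi * `|r| * `|B| + `|L|) a0.
exists (K * expR (pi * s * B ^+ 2 + `|L| * `|B|)).
  by rewrite mulr_gt0 ?expR_gt0.
move=> z zB; have zz := normc_le_ReB zB; move: zB zz; rewrite /gauss normc_ee -expRD.
case: z => x y; rewrite [complex.Re _]/= [complex.Im _]/= => yB zz.
rewrite [leRHS]mulrAC; apply: le_trans (ler_wpM2r (expR_ge0 _) (hK x)).
rewrite -expRD ler_expR.
have -> : complex.Im (2^-1 * (r +i* s) * (x +i* y) ^+ 2) =
   2^-1 * s * (x ^+ 2 - y ^+ 2) + r * x * y.
  have -> : (2^-1 : C) = ((2^-1 : R)%:C) by rewrite fmorphV rmorph_nat.
  by rewrite [(x +i* y) ^+ 2]expr2 /=; field.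
have h1 : - (r * x * y) <= `|r| * `|x| * `|B|.
  apply: le_trans (ler_norm _) _; rewrite normrN !normrM ler_wpM2l ?mulr_ge0 //.
  exact: le_trans yB (ler_norm _).
have h2 : L * normc (x +i* y) <= `|L| * (`|x| + `|B|).
  apply: (@le_trans _ _ (`|L| * normc (x +i* y))).
    by rewrite ler_wpM2r ?normc_ge0 // ler_norm.
  rewrite ler_wpM2l //; apply: le_trans zz _; rewrite lerD2l; exact: ler_norm.
have h3 : y ^+ 2 <= B ^+ 2.
  have B0 : 0 <= B by apply: le_trans yB.
  by rewrite -[y ^+ 2]real_normK ?num_real // ler_sqr ?nnegrE.
move: h1 h2; set n := normc _; move=> h1 h2.
have h4 := ler_wpM2l (ltW pi0) h1.
have h5 := ler_wpM2l (ltW a0) h3.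
lra.
Qed.

Lemma gaussD (t z h : C) : gauss t (z + h) = gauss t z * ee (t * z * h + 2^-1 * t * h ^+ 2).
Proof. by rewrite /gauss -eeD; congr ee; field. Qed.

Lemma sqr_le_expR (x : R) : 0 <= x -> x ^+ 2 <= 2 * expR x.
Proof.
move=> x0; have := @expR_ge1Dxn R x 1 x0.
by rewrite (_ : 2`! = 2)%N // => h; have := sqr_ge0 x; nra.
Qed.

(** The second order remainder is bounded by the square of the step, with a
    constant that is summable over a mesh.  This is where holomorphy of the
    Gaussian enters: the step h is complex and the linear term is complex linear
    in h. *)
Lemma gauss_taylor (t : C) (B L : R) : 0 < complex.Im t ->
  exists2 K, 0 < K & forall z h : C, `|complex.Im z| <= B -> normc h <= L ->
    normc (gauss t (z + h) - gauss t z - 2 * pi%:C * 'i%C * (t * z * h) * gauss t z) <=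
      K * normc h ^+ 2 * rho (complex.Re z).
Proof.
move=> t0; have pi0 := pi_gt0 R; set T := normc t.
have T0 : 0 <= T by exact: normc_ge0.
have [K1 K10 hK1] := gauss_bound B (1 + 2 * pi * L * T) t0.
have [K2 K20 hK2] := gauss_bound B 0 t0.
pose c1 := 4 * (2 * pi) ^+ 2 * T ^+ 2 * (2 * expR `|L|) * expR (2 * pi * T * L ^+ 2).
exists (c1 * K1 + pi * T * K2 + 1).
  have := expR_gt0 `|L|; have := expR_gt0 (2 * pi * T * L ^+ 2) => e1 e2.
  by rewrite ltr_wpDl // addr_ge0 ?mulr_ge0 ?sqr_ge0 // ltW.
move=> z h zB hL; set w := t * z * h + 2^-1 * t * h ^+ 2.
have L0 : 0 <= L by apply: le_trans hL; exact: normc_ge0.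
have n0 := normc_ge0 h; have m0 := normc_ge0 z.
have n2 : normc (2^-1 : C) = 2^-1 by rewrite normcV -(rmorph_nat (real_complex R)) normc_real normr_nat.
have wb : normc w <= normc h * T * (normc z + L).
  apply: le_trans (le_normcD _ _) _; rewrite expr2 !normcM n2.
  rewrite -/T; have : T * normc h * normc h <= T * normc h * L by rewrite ler_wpM2l ?mulr_ge0.
  have := mulr_ge0 (mulr_ge0 T0 n0) n0; lra.
have -> : gauss t (z + h) - gauss t z - 2 * pi%:C * 'i%C * (t * z * h) * gauss t z =
  gauss t z * ((ee w - 1 - 2 * pi%:C * 'i%C * w) + pi%:C * 'i%C * t * h ^+ 2).
  by rewrite gaussD -/w /w; field.
rewrite normcM; set P := normc (gauss t z); have P0 : 0 <= P by exact: normc_ge0.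
have e1 : normc (ee w - 1 - 2 * pi%:C * 'i%C * w) <=
   c1 * normc h ^+ 2 * expR ((1 + 2 * pi * L * T) * normc z).
  apply: le_trans (ee_taylor w) _.
  have q1 : 2 * pi * normc w <= 2 * pi * L * T * normc z + 2 * pi * T * L ^+ 2.
    have := ler_wpM2r (mulr_ge0 T0 (addr_ge0 m0 L0)) hL; nra.
  have q2 : normc w ^+ 2 <= normc h ^+ 2 * T ^+ 2 * (2 * expR `|L| * expR (normc z)).
    apply: (@le_trans _ _ ((normc h * T * (normc z + L)) ^+ 2)).
      by rewrite ler_sqr ?nnegrE ?normc_ge0 ?mulr_ge0 // addr_ge0.
    rewrite !exprMn ler_wpM2l ?mulr_ge0 ?sqr_ge0 //.
    rewrite -mulrA -expRD; apply: le_trans (sqr_le_expR (addr_ge0 m0 L0)) _.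
    by rewrite ler_wpM2l // ler_expR addrC lerD2r ler_norm.
  have q3 : expR (2 * pi * normc w) <= expR (2 * pi * L * T * normc z) * expR (2 * pi * T * L ^+ 2).
    by rewrite -expRD ler_expR.
  rewrite [(1 + _) * _]mulrDl mul1r [expR (normc z + _)]expRD /c1.
  apply: (@le_trans _ _ (4 * (2 * pi) ^+ 2 *
    (normc h ^+ 2 * T ^+ 2 * (2 * expR `|L| * expR (normc z))) *
    (expR (2 * pi * L * T * normc z) * expR (2 * pi * T * L ^+ 2)))).
    apply: ler_pM q3; [|exact: expR_ge0|].
      by apply: mulr_ge0 => //; exact: sqr_ge0.
    rewrite [(2 * pi * normc w) ^+ 2]exprMn mulrA ler_wpM2l //.
    by apply: mulr_ge0 => //; exact: sqr_ge0.
  by rewrite le_eqVlt; apply/orP; left; apply/eqP; ring.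
have e2 : normc (pi%:C * 'i%C * t * h ^+ 2) = pi * T * normc h ^+ 2.
  rewrite expr2 !normcM normc_real ger0_norm ?(ltW pi0) // [normc 'i%C](_ : _ = 1).
    by rewrite -/T; ring.
  by rewrite /= expr0n expr1n add0r sqrtr1.
apply: (@le_trans _ _ (P * (c1 * normc h ^+ 2 * expR ((1 + 2 * pi * L * T) * normc z) +
   pi * T * normc h ^+ 2))).
  rewrite ler_wpM2l //; apply: le_trans (le_normcD _ _) _; rewrite e2 lerD2r; exact: e1.
have := hK1 z zB; have := hK2 z zB; rewrite mul0r expR0 mulr1 -/P => r1 r2.
have c10 : 0 <= c1 by rewrite /c1 !mulr_ge0 ?expR_ge0 ?(ltW pi0).
have h20 := sqr_ge0 (normc h); have rh := rho_gt0 (complex.Re z).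
have r3 := ler_wpM2l (mulr_ge0 c10 h20) r2.
have r4 := ler_wpM2l (mulr_ge0 (mulr_ge0 (ltW pi0) T0) h20) r1.
move: r3 r4; set E := expR _; set r := rho _ => r3 r4.
have := mulr_ge0 h20 (ltW rh); rewrite -/r; lra.
Qed.

End Gauss.

(** * Riemann sums of a Gaussian *)

Section Poisson1.
Variable R : realType.
Local Notation C := (R[i]).

Definition mesh (N : nat) (j : int) : C := (j%:~R / N%:R : R)%:C.

Lemma meshE N j : mesh N j = j%:~R / N%:R.
Proof. by rewrite /mesh rmorphM fmorphV rmorph_int rmorph_nat. Qed.

Lemma meshD N i j : mesh N (i + j) = mesh N i + mesh N j.
Proof. by rewrite !meshE intrD mulrDl. Qed.

Lemma Re_mesh z N j : complex.Re (z + mesh N j) = complex.Re z + j%:~R / N%:R.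
Proof. by case: z. Qed.

Lemma Im_mesh z N j : complex.Im (z + mesh N j) = complex.Im z.
Proof. by case: z => a b /=; rewrite addr0. Qed.

Lemma csum_shift (f : int -> C) (a : int) : absSum f -> csum (fun j => f (j + a)) = csum f.
Proof.
move=> af; have K1 : cancel (fun j => j + a) (fun j => j - a) by move=> j; rewrite addrK.
have K2 : cancel (fun j => j - a) (fun j => j + a) by move=> j; rewrite subrK.
exact: (csum_bij K1 K2 af).
Qed.

Lemma absSum_shift (f : int -> C) (a : int) : absSum f -> absSum (fun j => f (j + a)).
Proof. by apply: absSum_inj => x y /addIr. Qed.

Lemma Im_opp_inv (t : C) : 0 < complex.Im t -> 0 < complex.Im (- t^-1).
Proof.
case: t => a b /= b0; rewrite opprK divr_gt0 //.
by have := sqr_ge0 a; have := exprn_gt0 2 b0; lra.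
Qed.

Lemma Im_neq0 (t : C) : 0 < complex.Im t -> t != 0.
Proof. by move=> t0; apply/eqP => e; move: t0; rewrite e /= ltxx. Qed.

Lemma ee_real_eq1 (a : R) : ee a%:C = 1 -> exists n : int, a = n%:~R.
Proof.
pose n := Num.floor a; pose f := a - n%:~R.
have /andP[f0 f1] : 0 <= f < 1.
  by have := floor_itv a; rewrite intrD /f -/n => /andP[]; lra.
have -> : a = f + n%:~R by rewrite subrK.
rewrite rmorphD /= rmorph_int eeD ee_int mulr1 ee_real => -[c1 _].
exists n; suff -> : f = 0 by rewrite add0r.
apply/eqP; rewrite eq_le f0 andbT leNgt; apply/negP => fp.
have pi0 := pi_gt0 R.
have : 0 < sin (pi * f) by apply: sin_gt0_pi; apply/andP; split; nra.
have := cos_half (2 * pi * f); rewrite c1 (_ : 2 * pi * f / 2 = pi * f); last by field.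
by nra.
Qed.

(** Orthogonality of the characters of Z / N; the summation window is shifted by M
    so that it can be centred at 0. *)
Lemma orth_sum (N : nat) (M : int) (j : int) : (0 < N)%N ->
  \sum_(i < N) ee (- ((i%:Z - M)%:~R * mesh N j)) =
    if (N%:Z %| j)%Z then N%:R else 0 :> C.
Proof.
move=> N0; have Np : N%:R != 0 :> C by rewrite pnatr_eq0 -lt0n.
case: ifP => [/dvdzP [q ->]|nd].
  rewrite (eq_bigr (fun=> 1)) => [|i _]; first by rewrite sumr_const card_ord.
  rewrite meshE intrM mulfK // -intrM -rmorphN; exact: ee_int.
pose z := ee (- mesh N j).
have zX n : z ^+ n = ee (- (n%:R * mesh N j)).
  rewrite /z; elim: n => [|n IH]; first by rewrite mul0r oppr0 ee0.
  by rewrite exprS IH -eeD -natr1; congr ee; ring.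
have -> : \sum_(i < N) ee (- ((i%:Z - M)%:~R * mesh N j)) =
    ee (M%:~R * mesh N j) * \sum_(i < N) z ^+ i.
  rewrite mulr_sumr; apply: eq_bigr => i _.
  rewrite zX.
  by rewrite -eeD; congr ee; rewrite intrD rmorphN /=; ring.
have zN : z ^+ N = 1.
  by rewrite zX meshE mulrCA mulfV // mulr1 -rmorphN; exact: ee_int.
have z1 : z != 1.
  apply/eqP; rewrite /z -rmorphN => /ee_real_eq1 [q h].
  have Nr : N%:R != 0 :> R by rewrite pnatr_eq0 -lt0n.
  move/negP: nd; apply; apply/dvdzP; exists (- q).
  have : (j%:~R : R) = (- q * N%:Z)%:~R by rewrite intrM rmorphN /= -h opprK divfK.
  by move/intr_inj.
have /eqP := subrX1 z N; rewrite zN subrr eq_sym mulf_eq0 subr_eq0 (negbTE z1) /=.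
by move/eqP ->; rewrite mulr0.
Qed.

Section WithT.
Variable t : C.
Hypothesis t0 : 0 < complex.Im t.

Definition gauss_sample (N : nat) (z : C) (j : int) : C := gauss t (z + mesh N j).

Lemma gauss_sample_le z : exists2 K, 0 < K & forall N j, normc (gauss_sample N z j) <= K * rho (j%:~R / N%:R).
Proof.
have [K K0 hK] := gauss_bound `|complex.Im z| 0 t0.
exists (K * (2 * (1 + complex.Re z ^+ 2))).
  by rewrite mulr_gt0 // mulr_gt0 // rho_den.
move=> N j; have := hK (z + mesh N j); rewrite Im_mesh lexx => /(_ isT).
rewrite mul0r expR0 mulr1 Re_mesh => h; apply: le_trans h _.
by rewrite -mulrA ler_wpM2l ?(ltW K0) // rho_shift.
Qed.

Lemma gauss_sample_bound z : exists2 K, 0 < K & forall N (A : {fset int}), (0 < N)%N ->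
  \sum_(j <- A) normc (gauss_sample N z j) <= K * N%:R.
Proof.
have [K K0 hK] := gauss_sample_le z; exists (16 * K); first by rewrite mulr_gt0.
move=> N A N0; apply: (@le_trans _ _ (\sum_(j <- A) K * rho (0 + j%:~R / N%:R))).
  by apply: ler_sum => j _; rewrite add0r.
rewrite -mulr_sumr [16 * K]mulrC -mulrA ler_wpM2l ?(ltW K0) //.
by have := riemann_rho (0 : R) A N0; rewrite expr0n addr0 mulr1.
Qed.

Lemma gauss_sample_abs N z : (0 < N)%N -> absSum (gauss_sample N z).
Proof. by move=> N0; have [K _ hK] := gauss_sample_bound z; exists (K * N%:R) => A; exact: hK. Qed.

(** Up to a negligible error this is the integral of the Gaussian along the
    horizontal line through z. *)
Definition riemann_sum (N : nat) (z : C) : C := N%:R^-1 * csum (gauss_sample N z).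

Lemma normc_nat n : normc (n%:R : C) = n%:R.
Proof. by rewrite -(rmorph_nat (real_complex R)) normc_real normr_nat. Qed.

Lemma riemann_sum_bound z : exists2 K, 0 < K & forall N, (0 < N)%N -> normc (riemann_sum N z) <= K.
Proof.
have [K K0 hK] := gauss_sample_bound z; exists K => // N N0.
rewrite /riemann_sum normcM normcV normc_nat mulrC ler_pdivrMr ?ltr0n //.
by apply: normc_csum_le => A; exact: hK.
Qed.

(** A discrete form of the independence of a contour integral from the contour.
    Moving z by u / N changes the Riemann sum by O (1 / N ^ 2): to first order the
    change is u times the change caused by moving z by 1 / N, and the latter is
    exactly 0, since it only renumbers the mesh.  N such steps lead from z0 to
    z0 + u. *)
Lemma riemann_sum_shift (z0 u : C) : exists2 K, 0 < K &
  forall N, (0 < N)%N -> normc (riemann_sum N (z0 + u) - riemann_sum N z0) <= K / N%:R.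
Proof.
set U := normc u; have U0 : 0 <= U by exact: normc_ge0.
pose B := `|complex.Im z0| + U; pose B' := `|complex.Re z0| + U.
have [K K0 hK] := gauss_taylor B (U + 1) t0.
pose K1 := K * (U ^+ 2 + U) * (16 * (1 + B' ^+ 2)).
have K10 : 0 <= K1.
  by rewrite /K1 !mulr_ge0 ?addr_ge0 ?sqr_ge0 // ltW.
have step (z : C) N : (0 < N)%N -> `|complex.Im z| <= B -> `|complex.Re z| <= B' ->
    normc (riemann_sum N (z + u / N%:R) - riemann_sum N z) <= K1 / N%:R ^+ 2.
  move=> N0 zB zB'; have Np : 0 < N%:R :> R by rewrite ltr0n.
  have N1 : 1 <= N%:R :> R by rewrite ler1n.
  (* T is the second order remainder; the linear terms of the two steps u / N and
     1 / N cancel after weighting with u. *)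
  pose T (h : C) (j : int) := gauss t (z + mesh N j + h) - gauss t (z + mesh N j) -
     2 * pi%:C * 'i%C * (t * (z + mesh N j) * h) * gauss t (z + mesh N j).
  have -> : riemann_sum N (z + u / N%:R) - riemann_sum N z =
     N%:R^-1 * csum (fun j => T (u / N%:R) j - u * T (N%:R^-1) j).
    rewrite /riemann_sum -mulrBr; congr (_ * _).
    have a1 := gauss_sample_abs z N0; have a2 := gauss_sample_abs (z + u / N%:R) N0.
    have e1 : csum (gauss_sample N (z + u / N%:R)) - csum (gauss_sample N z) =
       csum (fun j => gauss_sample N (z + u / N%:R) j + (-1) * gauss_sample N z j).
      by rewrite csumD ?csumZ // ?mulN1r //; exact: absSumZ.
    have a3 := absSumD (absSum_shift 1 a1) (absSumZ (-1) a1).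
    have e2 : csum (fun j => gauss_sample N z (j + 1) + (-1) * gauss_sample N z j) = 0.
      rewrite csumD ?csumZ ?csum_shift // ?mulN1r ?subrr //; first exact: absSum_shift.
      exact: absSumZ.
    rewrite e1 -[LHS]addr0 -[X in _ + X](mulr0 (- u)) -e2 -csumZ // -csumD; last 2 first.
    - by apply: absSumD => //; exact: absSumZ.
    - exact: absSumZ.
    apply: eq_csum => j; rewrite /T /gauss_sample meshD addrA [mesh N 1]meshE mul1r.
    by rewrite [z + mesh N j + u / _]addrAC; field; rewrite pnatr_eq0 -lt0n.
  rewrite normcM normcV normc_nat expr2 invfM mulrA mulrC ler_wpM2r ?invr_ge0 ?(ltW Np) //.
  apply: normc_csum_le => A.
  have hu : normc (u / N%:R) = U / N%:R by rewrite normcM normcV normc_nat.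
  apply: (@le_trans _ _ (\sum_(j <- A) K * (U ^+ 2 + U) / N%:R ^+ 2 * rho (complex.Re z + j%:~R / N%:R))).
    apply: ler_sum => j _; rewrite -Re_mesh.
    have h1 : normc (T (u / N%:R) j) <= K * (U / N%:R) ^+ 2 * rho (complex.Re (z + mesh N j)).
      rewrite -hu; apply: hK; first by rewrite Im_mesh.
      by rewrite hu ler_pdivrMr // mulrDl mul1r; have := ler_wpM2l U0 N1; lra.
    have h2 : normc (T N%:R^-1 j) <= K * (N%:R^-1) ^+ 2 * rho (complex.Re (z + mesh N j)).
      have e : normc (N%:R^-1 : C) = N%:R^-1 by rewrite normcV normc_nat.
      rewrite -[in leRHS]e; apply: hK; first by rewrite Im_mesh.
      by rewrite e; apply: (@le_trans _ _ 1); [rewrite invf_le1|lra].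
    apply: le_trans (le_normcD _ _) _; rewrite normcN normcM -/U.
    have h3 := ler_wpM2l U0 h2; apply: le_trans (lerD h1 h3) _.
    by rewrite le_eqVlt; apply/orP; left; apply/eqP; field; rewrite gt_eqF.
  rewrite -mulr_sumr.
  apply: (@le_trans _ _ (K * (U ^+ 2 + U) / N%:R ^+ 2 * (16 * (1 + complex.Re z ^+ 2) * N%:R))).
    rewrite ler_wpM2l ?riemann_rho //.
    by apply: divr_ge0; rewrite ?sqr_ge0 // mulr_ge0 ?addr_ge0 ?sqr_ge0 // ltW.
  have h4 : complex.Re z ^+ 2 <= B' ^+ 2.
    rewrite -[complex.Re z ^+ 2]real_normK ?num_real // ler_sqr ?nnegrE //.
    exact: le_trans zB'.
  apply: (@le_trans _ _ (K * (U ^+ 2 + U) / N%:R ^+ 2 * (16 * (1 + B' ^+ 2) * N%:R))).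
    rewrite ler_wpM2l //.
      by apply: divr_ge0; rewrite ?sqr_ge0 // mulr_ge0 ?addr_ge0 ?sqr_ge0 // ltW.
    by rewrite ler_wpM2r ?(ltW Np) // ler_wpM2l // lerD2l.
  by rewrite le_eqVlt /K1; apply/orP; left; apply/eqP; field; rewrite gt_eqF.
exists (K1 + 1); first by lra.
move=> N N0; have Np : 0 < N%:R :> R by rewrite ltr0n.
pose w (m : nat) := z0 + m%:R * (u / N%:R).
have -> : riemann_sum N (z0 + u) - riemann_sum N z0 = \sum_(0 <= m < N) (riemann_sum N (w m.+1) - riemann_sum N (w m)).
  rewrite telescope_sumr // /w mul0r addr0 mulrCA mulfV ?mulr1 //.
  by rewrite pnatr_eq0 -lt0n.
apply: (@le_trans _ _ (K1 / N%:R)); last first.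
  by rewrite ler_wpM2r ?invr_ge0 ?(ltW Np) //; lra.
apply: le_trans (normc_sum _ _ _) _.
apply: (@le_trans _ _ (\sum_(0 <= m < N) (K1 / N%:R ^+ 2))).
  rewrite !big_nat; apply: ler_sum => m /andP[_ mN].
  have nw : normc (m%:R * (u / N%:R)) <= U.
    rewrite !normcM normcV !normc_nat mulrCA -[leRHS]mulr1 ler_wpM2l ?normc_ge0 //.
    by rewrite ler_pdivrMr // mul1r ler_nat ltnW.
  rewrite (_ : w m.+1 = w m + u / N%:R); last by rewrite /w -natr1; ring.
  apply: step => //.
    rewrite /w raddfD /=; apply: le_trans (ler_normD _ _) _; rewrite lerD2l.
    exact: le_trans (Im_le_normc _) nw.
  rewrite /w raddfD /=; apply: le_trans (ler_normD _ _) _; rewrite lerD2l.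
  exact: le_trans (Re_le_normc _) nw.
rewrite sumr_const_nat subn0 -mulr_natr le_eqVlt; apply/orP; left.
by apply/eqP; field; rewrite gt_eqF.
Qed.

End WithT.
End Poisson1.

(** * Poisson summation in one variable *)

Section Poisson1b.
Variable R : realType.
Local Notation C := (R[i]).
Variable t : C.
Hypothesis t0 : 0 < complex.Im t.

Definition fourier_term (N : nat) (x : C) (k j : int) : C :=
  gauss_sample t N x j * ee (- (k%:~R * mesh R N j)).

Definition fourier_coef (N : nat) (x : C) (k : int) : C := N%:R^-1 * csum (fourier_term N x k).

Lemma normc_ee_mesh N k j : normc (ee (- (k%:~R * mesh R N j))) = 1.
Proof.
rewrite normc_ee -(rmorph_int (real_complex R)) -rmorphM -rmorphN /=.
by rewrite mulr0 oppr0 expR0.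
Qed.

Lemma fourier_term_abs N x k : (0 < N)%N -> absSum (fourier_term N x k).
Proof.
move=> N0; apply: absSum_le (gauss_sample_abs t0 x N0) => j.
by rewrite normcM normc_ee_mesh mulr1.
Qed.

(** Completing the square: the character shifts the Gaussian by k / t, a complex
    amount. *)
Lemma fourier_coefE N x k : (0 < N)%N ->
  fourier_coef N x k = ee (- (k%:~R ^+ 2 / (2 * t)) + k%:~R * x) * riemann_sum t N (x - k%:~R / t).
Proof.
move=> N0; rewrite /riemann_sum mulrCA -csumZ; last exact: gauss_sample_abs.
congr (_ * _); apply: eq_csum => j.
rewrite /fourier_term /gauss_sample /gauss -!eeD; congr ee.
by field; rewrite pnatr_eq0 -lt0n N0 (Im_neq0 t0).
Qed.

Lemma csum_dvd (N : nat) (f : int -> C) : (0 < N)%N -> absSum f ->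
  csum (fun j => f j * (if (N%:Z %| j)%Z then N%:R else 0)) =
  N%:R * csum (fun p => f (p * N%:Z)).
Proof.
move=> N0 af; have Nz : N%:Z != 0 by rewrite eqz_nat -lt0n.
have inj : injective (fun p => p * N%:Z) by move=> p q /(mulIf Nz).
have ag : absSum (fun p => f (p * N%:Z)) by exact: absSum_inj af.
rewrite -csumZ //; apply: hasSum_csum.
have /csumP := absSumZ N%:R ag; set s := csum _ => hs e /hs [A hA].
exists [fset p * N%:Z | p in A]%fset => B AB.
pose B' := [fset (j %/ N%:Z)%Z | j in B & (N%:Z %| j)%Z]%fset.
have AB' : (A `<=` B')%fset.
  apply/fsubsetP => p pA; apply/imfsetP; exists (p * N%:Z); last by rewrite mulzK.
  rewrite !inE /= dvdz_mull // andbT.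
  by apply: (fsubsetP AB); apply/imfsetP; exists p.
have := hA B' AB'; congr (normc (_ - _) < e).
rewrite big_imfset /=; last first.
  move=> a b /andP[_ da] /andP[_ db] h.
  by rewrite -(divzK da) -(divzK db) h.
rewrite big_filter big_mkcond /=; apply: eq_bigr => j _.
by case: ifP => d; rewrite ?mulr0 // divzK // mulrC.
Qed.

(** Finite Fourier inversion: summing over all frequencies modulo N singles out
    the mesh points that are integers. *)
Lemma fourier_decomp (M : nat) x : let N := M.*2.+1 in
  csum (gauss_sample t 1 x) = \sum_(i < N) fourier_coef N x (i%:Z - M%:Z).
Proof.
move=> N; have N0 : (0 < N)%N by [].
have Np : N%:R != 0 :> C by rewrite pnatr_eq0.
transitivity (csum (fun j => \sum_(i < N) N%:R^-1 * fourier_term N x (i%:Z - M%:Z) j)); last first.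
  apply: hasSum_csum; apply: (hasSum_sum (index_enum 'I_N)) => i.
  by apply: hasSumZ; apply: csumP; exact: fourier_term_abs.
have -> : (fun j => \sum_(i < N) N%:R^-1 * fourier_term N x (i%:Z - M%:Z) j) =
   (fun j => N%:R^-1 * (gauss_sample t N x j * (if (N%:Z %| j)%Z then N%:R else 0))).
  apply/funext => j; rewrite -(orth_sum R M j N0) -!mulr_sumr.
  by congr (_ * _).
have a1 := gauss_sample_abs t0 x N0.
rewrite csumZ; last first.
  apply: absSum_le (absSumZ N%:R a1) => j; rewrite [leLHS]normcM [leRHS]normcM [leRHS]mulrC.
  apply: ler_wpM2l; first exact: normc_ge0.
  by case: (_ %| j)%Z; rewrite // normc0 normc_ge0.
rewrite csum_dvd // mulrA mulVf // mul1r; apply: eq_csum => p.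
by rewrite /gauss_sample !meshE intrM mulfK // divr1.
Qed.

(** Multiplying the k-th coefficient by z + z^-1 - 2, with z = e(k / N), replaces
    the Gaussian by its second difference on the mesh, which is O (1 / N ^ 2); and
    |z + z^-1 - 2| is at least (k / N) ^ 2 as long as |k| <= N / 2. *)
Lemma fourier_coef_decay x : exists2 K, 0 < K & forall (M : nat) (k : int), (`|k| <= M)%N ->
  normc (fourier_coef M.*2.+1 x k) <= K * rho (k%:~R : R).
Proof.
have [Kd Kd0 hKd] := riemann_sum_bound t0 x.
have [K K0 hK] := gauss_taylor `|complex.Im x| 1 t0.
pose K1 := 2 * K * (16 * (1 + complex.Re x ^+ 2)).
have K10 : 0 < K1 by rewrite !mulr_gt0 // rho_den.
exists (Kd + 2 * K1); first by lra.
move=> M k kM; set N := M.*2.+1; have N0 : (0 < N)%N by [].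
have Np : 0 < N%:R :> R by rewrite ltr0n.
have N1 : 1 <= N%:R :> R by rewrite ler1n.
have rk := rho_gt0 (k%:~R : R).
case: (eqVneq k 0) => [->|k0].
  rewrite fourier_coefE // expr0n mul0r oppr0 mul0r addr0 ee0 mul1r mul0r subr0.
  rewrite /rho expr0n addr0 invr1 mulr1.
  by apply: le_trans (hKd N N0) _; lra.
pose G := fourier_term N x k; have aG : absSum G by exact: fourier_term_abs.
pose E j := ee (- (k%:~R * mesh R N j)); pose z := ee (k%:~R * mesh R N 1).
have z0 : z != 0 by exact: ee_neq0.
have meshN : mesh R N (-1) = - mesh R N 1 by rewrite !meshE mulNr.
have Ep j : E j = E (j + 1) * z.
  by rewrite /E /z -eeD meshD; congr ee; ring.
have Em j : E j = E (j + -1) * z^-1.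
  by rewrite /E /z -eeN -eeD meshD meshN; congr ee; ring.
pose f := gauss_sample t N x.
have key : csum (fun j => (f (j + 1) + f (j + -1) - 2 * f j) * E j) = (z + z^-1 - 2) * csum G.
  transitivity (csum (fun j => z * G (j + 1) + (z^-1 * G (j + -1) + (-2) * G j))).
    apply: eq_csum => j; rewrite /G /fourier_term -/f -!/(E _).
    have -> : z * (f (j + 1) * E (j + 1)) = f (j + 1) * E j by rewrite (Ep j); ring.
    have -> : z^-1 * (f (j + -1) * E (j + -1)) = f (j + -1) * E j by rewrite (Em j); ring.
    by ring.
  have b1 := absSum_shift 1 aG; have b2 := absSum_shift (-1) aG.
  rewrite csumD; [|exact: absSumZ|by apply: absSumD; exact: absSumZ].
  rewrite csumD; [|exact: absSumZ|exact: absSumZ].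
  by rewrite !csumZ // !csum_shift //; ring.
have lo : (k%:~R / N%:R) ^+ 2 <= normc (z + z^-1 - 2).
  set a : R := k%:~R / N%:R.
  have -> : z + z^-1 - 2 = (2 * cos (2 * pi * a) - 2)%:C.
    rewrite /z -eeN meshE mulrA mulr1 -(rmorph_int (real_complex R)).
    rewrite -(rmorph_nat (real_complex R) N) -fmorphV -rmorphM -/a -rmorphN !ee_real.
    rewrite mulrN cosN sinN; apply/eqP; rewrite eq_complex /=.
    by apply/andP; split; apply/eqP; ring.
  rewrite normc_real (_ : 2 * cos _ - 2 = - (4 * sin (pi * a) ^+ 2)); last first.
    have := cos_half (2 * pi * a); rewrite (_ : 2 * pi * a / 2 = pi * a); last by field.
    by lra.
  rewrite normrN ger0_norm; last by apply: mulr_ge0 => //; exact: sqr_ge0.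
  have pi0 := pi_gt0 R; have pi2 := pi_ge2 R.
  have an : `|a| <= 2^-1.
    rewrite /a normrM [ `|N%:R^-1| ]ger0_norm ?invr_ge0 // ler_pdivrMr //.
    rewrite -intr_norm -abszE.
    have : ((absz k)%:R : R) <= M%:R by rewrite ler_nat.
    have : (N%:R : R) = 2 * M%:R + 1 by rewrite /N -natr1 -mul2n natrM.
    by lra.
  have s1 : pi * `|a| / 2 <= sin (pi * `|a|).
    apply: sin_ge_half; apply/andP; split; first by rewrite mulr_ge0 // ltW.
    by have := ler_wpM2l (ltW pi0) an.
  have -> : sin (pi * a) ^+ 2 = sin (pi * `|a|) ^+ 2.
    by case: (ler0P a) => // _; rewrite mulrN sinN sqrrN.
  rewrite -[a ^+ 2]real_normK ?num_real //; have a0 := normr_ge0 a.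
  have s2 : `|a| <= sin (pi * `|a|) by apply: le_trans s1; nra.
  nra.
have up : normc (csum (fun j => (f (j + 1) + f (j + -1) - 2 * f j) * E j)) <= K1 / N%:R.
  apply: normc_csum_le => A.
  apply: (@le_trans _ _ (\sum_(j <- A) 2 * K / N%:R ^+ 2 * rho (complex.Re x + j%:~R / N%:R))).
    apply: ler_sum => j _; rewrite normcM normc_ee_mesh mulr1.
    have n1 : normc (mesh R N 1) = N%:R^-1.
      by rewrite normc_real mul1r ger0_norm // invr_ge0.
    have n1' : normc (mesh R N 1) <= 1 by rewrite n1 invf_le1.
    have h1 := hK (x + mesh R N j) (mesh R N 1); rewrite Im_mesh lexx in h1.
    have h2 := hK (x + mesh R N j) (mesh R N (-1)); rewrite Im_mesh lexx meshN normcN in h2.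
    have {}h1 := h1 isT n1'; have {}h2 := h2 isT n1'; rewrite n1 Re_mesh in h1 h2.
    have := le_trans (le_normcD _ _) (lerD h1 h2); rewrite exprVn => h.
    rewrite /f /gauss_sample !meshD !addrA meshN.
    apply: le_trans (le_trans _ h) _; last by lra.
    by rewrite le_eqVlt; apply/orP; left; apply/eqP; congr normc; ring.
  rewrite -mulr_sumr.
  apply: (@le_trans _ _ (2 * K / N%:R ^+ 2 * (16 * (1 + complex.Re x ^+ 2) * N%:R))).
    rewrite ler_wpM2l ?riemann_rho // divr_ge0 ?sqr_ge0 // mulr_ge0 // ltW //.
  by rewrite le_eqVlt /K1; apply/orP; left; apply/eqP; field; rewrite gt_eqF.
rewrite key normcM in up.
rewrite /fourier_coef normcM normcV normc_nat -/G; set g := normc (csum G) in up *.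
have g0 : 0 <= g by exact: normc_ge0.
have k1 : 1 <= (k%:~R : R) ^+ 2.
  rewrite -rmorphXn -[1]/(1%:~R) ler_int.
  have : 0 < k ^+ 2 by rewrite exprn_even_gt0.
  by rewrite -gtz0_ge1.
have up2 : (k%:~R / N%:R) ^+ 2 * g <= K1 / N%:R.
  by apply: le_trans (ler_wpM2r g0 lo) up.
have up3 : N%:R^-1 * g <= K1 / k%:~R ^+ 2.
  rewrite ler_pdivlMr; last by lra.
  have := ler_wpM2l (ltW Np) up2; rewrite [N%:R * (K1 / _)]mulrC divfK ?gt_eqF //.
  by rewrite (_ : N%:R * _ = N%:R^-1 * g * k%:~R ^+ 2) //; field; rewrite gt_eqF.
apply: le_trans up3 _; rewrite /rho.
rewrite ler_pdivrMr; last by lra.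
rewrite mulrAC ler_pdivlMr ?rho_den //; nra.
Qed.

(** The summand of the dual series; it is the limit shape of the k-th discrete
    Fourier coefficient. *)
Definition dual_theta (x : C) (k : int) : C := ee (- (k%:~R ^+ 2 / (2 * t)) + k%:~R * x).

Lemma dual_theta_decay x : exists2 K, 0 < K & forall k,
  normc (dual_theta x k) <= K * rho (k%:~R : R).
Proof.
have tn := Im_neq0 t0.
have [K K0 hK] := gauss_sample_le (Im_opp_inv t0) (- (t * x)).
exists (normc (ee (2^-1 * t * x ^+ 2)) * K + 1).
  by rewrite ltr_wpDl // mulr_ge0 ?normc_ge0 // ltW.
move=> k; have -> : dual_theta x k = ee (2^-1 * t * x ^+ 2) * gauss_sample (- t^-1) 1 (- (t * x)) k.
  by rewrite /gauss_sample /gauss -eeD meshE; congr ee; field.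
rewrite normcM mulrDl mul1r -[X in _ <= X + _]mulrA; apply: ler_wpDr; first exact/ltW/rho_gt0.
by apply: ler_wpM2l; [exact: normc_ge0|have := hK 1%N k; rewrite divr1].
Qed.

Lemma rho_int_sum (A : {fset int}) : \sum_(k <- A) rho (k%:~R : R) <= 16.
Proof.
have := @riemann_rho R 1 0 A isT; rewrite expr0n addr0 !mulr1.
by under eq_bigr do rewrite add0r divr1.
Qed.

Lemma decay_absSum (f : int -> C) K : (forall k, normc (f k) <= K * rho (k%:~R : R)) ->
  absSum f.
Proof.
move=> h; have K0 : 0 <= K.
  have := le_trans (normc_ge0 _) (h 0); rewrite /rho expr0n addr0 invr1 mulr1 //.
exists (K * 16) => A; apply: (@le_trans _ _ (\sum_(k <- A) K * rho (k%:~R : R))).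
  by apply: ler_sum => k _.
by rewrite -mulr_sumr ler_wpM2l // rho_int_sum.
Qed.

Lemma dual_theta_abs x : absSum (dual_theta x).
Proof. by have [K _ /decay_absSum] := dual_theta_decay x. Qed.

(** Each frequency contributes dual_theta x k times a Riemann sum along a line that
    depends on k; by riemann_sum_shift all these Riemann sums may be replaced by the
    one at 0, and the decay of the coefficients allows doing so under the sum. *)
Lemma poisson_limit x (e : R) : 0 < e -> exists n0, forall M, (n0 <= M)%N ->
  normc (csum (gauss_sample t 1 x) - riemann_sum t M.*2.+1 0 * csum (dual_theta x)) <= e.
Proof.
move=> e0; pose S (M : nat) (k : int) :=
  if (`|k| <= M)%N then fourier_coef M.*2.+1 x k else 0.
pose g M k := S M k + (- riemann_sum t M.*2.+1 0) * dual_theta x k.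
have [K1 K10 h1] := fourier_coef_decay x.
have [K2 K20 h2] := dual_theta_decay x.
have [K3 K30 h3] := riemann_sum_bound t0 0.
have Sb M k : normc (S M k) <= K1 * rho (k%:~R : R).
  rewrite /S; case: ifP => [/h1//|_]; rewrite normc0 mulr_ge0 ?ltW //; exact: rho_gt0.
have hS M : csum (S M) = csum (gauss_sample t 1 x).
  rewrite (fourier_decomp M).
  pose h (i : 'I_(M.*2.+1)) : int := (nat_of_ord i)%:Z - M%:Z.
  pose A := [fset h i | i in 'I_(M.*2.+1)]%fset.
  have AP k : (k \in A) = (`|k| <= M)%N.
    apply/imfsetP/idP => [[i _ ->]|kM].
      by rewrite /h; have := ltn_ord i; lia.
    have kN : (absz ((k : int) + M%:Z)%R < M.*2.+1)%N by lia.
    by exists (Ordinal kN) => //; rewrite /h /=; lia.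
  have := @hasSum_finite _ _ (S M) A.
  move=> /(_ _)/hasSum_csum -> => [|k]; last by rewrite AP /S => /negbTE ->.
  rewrite big_imfset /=; last by move=> i j _ _; rewrite /h => ij; apply/val_inj => /=; lia.
  rewrite big_enum /=; apply: eq_bigr => i _; rewrite /S ifT // /h.
  by have := ltn_ord i; lia.
have gb M k : normc (g M k) <= (K1 + K3 * K2) * rho (k%:~R : R).
  rewrite /g mulrDl; apply: le_trans (le_normcD _ _) _; apply: lerD => //.
  by rewrite normcM normcN -mulrA ler_pM ?normc_ge0 // h3.
have g0 k (d : R) : 0 < d -> exists n0, forall n, (n0 <= n)%N -> normc (g n k) < d.
  move=> d0; have [L L0 hL] := riemann_sum_shift t0 0 (x - k%:~R / t).
  pose T := normc (dual_theta x k); have T0 : 0 <= T by exact: normc_ge0.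
  have LT0 : 0 <= L * T / d by rewrite divr_ge0 ?mulr_ge0 // ltW.
  pose n1 := (Num.truncn (L * T / d)).+1.
  exists (maxn (absz k) n1) => n; rewrite geq_max => /andP[kn n1n].
  rewrite /g /S kn fourier_coefE // -/(dual_theta x k) mulNr mulrC -mulrBl normcM -/T.
  have := hL n.*2.+1 isT; rewrite add0r => h.
  apply: le_lt_trans (ler_wpM2r T0 h) _.
  have Np : 0 < (n.*2.+1)%:R :> R by rewrite ltr0n.
  rewrite mulrAC ltr_pdivrMr // [d * _]mulrC -ltr_pdivrMr //.
  have h4 : L * T / d < n1%:R by exact: truncnS_gt.
  apply: lt_le_trans h4 _; rewrite ler_nat.
  by apply: leq_trans n1n _; rewrite -addnn -addnS leq_addr.
have gs A : \sum_(k <- (A : {fset int})) (K1 + K3 * K2) * rho (k%:~R : R) <= (K1 + K3 * K2) * 16.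
  rewrite -mulr_sumr ler_wpM2l ?rho_int_sum // addr_ge0 ?mulr_ge0 // ltW //.
have [n0 hn0] := tannery gs gb g0 e0.
exists n0 => M /hn0.
rewrite /g csumD ?csumZ ?hS ?mulNr //.
- exact: dual_theta_abs.
- exact: decay_absSum (Sb M).
- by apply: absSumZ; exact: dual_theta_abs.
Qed.

End Poisson1b.

Section Poisson1c.
Variable R : realType.
Local Notation C := (R[i]).

(** For every x the left hand side is the limit of the dual series multiplied by the
    same sequence of Riemann sums, so the quotient of the two does not depend on x.  If the dual series
    vanishes identically then so does the left hand side. *)
Lemma poisson1_gauss (t : C) : 0 < complex.Im t -> exists kappa : C, forall x,
  csum (gauss_sample t 1 x) = kappa * csum (dual_theta t x).
Proof.
move=> t0; have [[x1 h1]|h] := pselect (exists x1, csum (dual_theta t x1) != 0); last first.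
  exists 0 => x; rewrite mul0r; apply: normc_small => e e0.
  have [n0 /(_ _ (leqnn _))] := poisson_limit t0 x (divr_gt0 e0 (ltr0Sn R 1)).
  have -> : csum (dual_theta t x) = 0.
    by apply/eqP/negPn/negP => hx; apply: h; exists x.
  by rewrite mulr0 subr0 => he; apply: le_lt_trans he _; lra.
exists (csum (gauss_sample t 1 x1) / csum (dual_theta t x1)) => x.
apply: (mulIf h1); rewrite mulrAC divfK // [RHS]mulrC [RHS]mulrC.
apply/eqP; rewrite -subr_eq0; apply/eqP/normc_small => e e0.
set a := csum (gauss_sample t 1 x); set b := csum (dual_theta t x).
set a1 := csum (gauss_sample t 1 x1); set b1 := csum (dual_theta t x1).
pose m := normc b + normc b1 + 1.
have m0 : 0 < m by rewrite ltr_wpDl // addr_ge0 ?normc_ge0.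
have [n1 k1] := poisson_limit t0 x (divr_gt0 e0 m0).
have [n2 k2] := poisson_limit t0 x1 (divr_gt0 e0 m0).
have {k1} := k1 _ (leq_maxl n1 n2); have {k2} := k2 _ (leq_maxr n1 n2).
rewrite -/a -/b -/a1 -/b1; set d := riemann_sum _ _ _ => k2 k1.
rewrite (_ : a * b1 - _ = (a - d * b) * b1 - (a1 - d * b1) * b); last by ring.
apply: le_lt_trans (le_normcD _ _) _; rewrite normcN !normcM.
apply: le_lt_trans (lerD (ler_wpM2r (normc_ge0 _) k1) (ler_wpM2r (normc_ge0 _) k2)) _.
rewrite -mulrDr mulrAC ltr_pdivrMr // ltr_pM2l // /m; lra.
Qed.

Lemma gauss1_abs (t z : C) : 0 < complex.Im t ->
  absSum (fun p : int => ee (2^-1 * t * p%:~R ^+ 2 + p%:~R * z)).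
Proof.
move=> t0; apply: absSum_le (absSumZ (ee (- (z ^+ 2 / (2 * t)))) (gauss_sample_abs t0 (z / t) (ltnSn 0))) => p.
rewrite le_eqVlt; apply/orP; left; apply/eqP; congr normc.
by rewrite /gauss_sample /gauss meshE -eeD; congr ee; field; rewrite Im_neq0.
Qed.

(** The substitution x = z / t. *)
Lemma poisson1 (t : C) : 0 < complex.Im t -> exists kappa : C, forall z,
  csum (fun p : int => ee (2^-1 * t * p%:~R ^+ 2 + p%:~R * z)) =
  kappa * csum (fun n : int => ee (- ((z + n%:~R) ^+ 2 / (2 * t)))).
Proof.
move=> t0; have tn := Im_neq0 t0; have [kappa hk] := poisson1_gauss t0; exists kappa => z.
have a1 := gauss_sample_abs t0 (z / t) (ltnSn 0); have a2 := dual_theta_abs t0 (z / t).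
have := congr1 (fun c => ee (- (z ^+ 2 / (2 * t))) * c) (hk (z / t)).
rewrite mulrCA -(csumZ _ a1) -(csumZ (ee _) a2) => e.
transitivity (csum (fun p => ee (- (z ^+ 2 / (2 * t))) * gauss_sample t 1 (z / t) p)).
  apply: eq_csum => p; rewrite /gauss_sample /gauss meshE -eeD; congr ee; by field.
rewrite e; congr (_ * _).
have K : cancel (fun n : int => - n) (fun n : int => - n) by move=> n; rewrite opprK.
rewrite -(csum_bij K K (absSumZ _ a2)).
apply: eq_csum => n /=; rewrite /dual_theta -eeD rmorphN /=; congr ee; by field.
Qed.

End Poisson1c.

(** * Quadratic forms and block matrices *)

Section QuadForm.
Variable K : comPzRingType.

Definition qf (n : nat) (T : 'M[K]_n) (x : 'rV[K]_n) : K := (x *m T *m x^T) 0 0.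
Definition bil (n : nat) (x y : 'rV[K]_n) : K := (x *m y^T) 0 0.

Lemma bilE n (x y : 'rV[K]_n) : bil x y = \sum_i x 0 i * y 0 i.
Proof. by rewrite /bil mxE; apply: eq_bigr => i _; rewrite mxE. Qed.

Lemma bilC n (x y : 'rV[K]_n) : bil x y = bil y x.
Proof. by rewrite !bilE; apply: eq_bigr => i _; rewrite mulrC. Qed.

Lemma bilDl n (x y z : 'rV[K]_n) : bil (x + y) z = bil x z + bil y z.
Proof. by rewrite /bil mulmxDl mxE. Qed.

Lemma bilDr n (x y z : 'rV[K]_n) : bil z (x + y) = bil z x + bil z y.
Proof. by rewrite ![bil z _]bilC bilDl. Qed.

Lemma bilZl n a (x y : 'rV[K]_n) : bil (a *: x) y = a * bil x y.
Proof. by rewrite /bil -scalemxAl mxE. Qed.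

Lemma bilZr n a (x y : 'rV[K]_n) : bil x (a *: y) = a * bil x y.
Proof. by rewrite bilC bilZl bilC. Qed.

Lemma bilNl n (x y : 'rV[K]_n) : bil (- x) y = - bil x y.
Proof. by rewrite -scaleN1r bilZl mulN1r. Qed.

Lemma bilNr n (x y : 'rV[K]_n) : bil x (- y) = - bil x y.
Proof. by rewrite bilC bilNl bilC. Qed.

Lemma qfE n (T : 'M[K]_n) x : qf T x = bil (x *m T) x.
Proof. by []. Qed.

Lemma bil_sym n (T : 'M[K]_n) x y : T^T = T -> bil (x *m T) y = bil (y *m T) x.
Proof.
move=> Ts; rewrite [RHS]bilC /bil trmx_mul Ts mulmxA.
by [].
Qed.

Lemma qfD n (T : 'M[K]_n) x y : T^T = T ->
  qf T (x + y) = qf T x + 2 * bil (x *m T) y + qf T y.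
Proof.
move=> Ts; rewrite !qfE mulmxDl bilDl !bilDr (bil_sym y x Ts); ring.
Qed.

Lemma qfZ n (T : 'M[K]_n) a x : qf T (a *: x) = a ^+ 2 * qf T x.
Proof. by rewrite !qfE -scalemxAl bilZl bilZr; ring. Qed.

Lemma qfDm n (T U : 'M[K]_n) x : qf (T + U) x = qf T x + qf U x.
Proof. by rewrite !qfE mulmxDr bilDl. Qed.

Lemma qfZm n (T : 'M[K]_n) a x : qf (a *: T) x = a * qf T x.
Proof. by rewrite !qfE -scalemxAr bilZl. Qed.

Lemma bil0r n (x : 'rV[K]_n) : bil x 0 = 0.
Proof. by rewrite bilE big1 // => i _; rewrite mxE mulr0. Qed.

Lemma qf0 n (T : 'M[K]_n) : qf T 0 = 0.
Proof. by rewrite qfE bil0r. Qed.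

Lemma qfN n (T : 'M[K]_n) x : qf T (- x) = qf T x.
Proof. by rewrite -scaleN1r qfZ sqrrN expr1n mul1r. Qed.

Lemma qfNm n (T : 'M[K]_n) x : qf (- T) x = - qf T x.
Proof. by rewrite -scaleN1r qfZm mulN1r. Qed.

Lemma bil_row n (a b : K) (x y : 'rV[K]_n) :
  bil (row_mx a%:M x : 'rV_(1 + n)) (row_mx b%:M y) = a * b + bil x y.
Proof.
by rewrite /bil tr_row_mx mul_row_col mxE tr_scalar_mx -scalar_mxM !mxE eqxx mulr1n.
Qed.

Lemma bil_mulmx n (s : 'rV[K]_n) x : x *m s^T = (bil x s)%:M.
Proof. by rewrite [LHS]mx11_scalar. Qed.

Lemma row_mul_block n (a x0 : K) (s x : 'rV[K]_n) (T : 'M[K]_n) :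
  (row_mx x0%:M x : 'rV_(1 + n)) *m (block_mx a%:M s s^T T) =
  row_mx (x0 * a + bil x s)%:M (x0 *: s + x *m T).
Proof.
by rewrite mul_row_block -scalar_mxM bil_mulmx -raddfD /= mul_scalar_mx.
Qed.

Lemma qf_block n (a x0 : K) (s x : 'rV[K]_n) (T : 'M[K]_n) :
  qf (block_mx a%:M s s^T T : 'M[K]_(1 + n)) (row_mx x0%:M x) =
  a * x0 ^+ 2 + 2 * x0 * bil s x + qf T x.
Proof.
by rewrite qfE row_mul_block bil_row bilDl bilZl -qfE [bil x s]bilC; ring.
Qed.

Lemma sym_block n (T : 'M[K]_(1 + n)) : T^T = T ->
  T = block_mx (T 0 0)%:M (ursubmx T) (ursubmx T)^T (drsubmx T).
Proof.
move=> Ts; rewrite -[LHS]submxK; congr block_mx.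
  by rewrite [LHS]mx11_scalar !mxE; congr (scalar_mx (T _ _)); apply/val_inj.
by rewrite trmx_ursub Ts.
Qed.

Lemma row_split n (x : 'rV[K]_(1 + n)) : x = row_mx (x 0 0)%:M (rsubmx x).
Proof.
rewrite -[LHS]hsubmxK; congr row_mx.
by rewrite [LHS]mx11_scalar !mxE; congr (scalar_mx (x _ _)); apply/val_inj.
Qed.

End QuadForm.

(** * The Siegel upper half space *)

Section SiegelSpace.
Variable R : realType.
Local Notation C := (R[i]).
Local Notation rc := (map_mx (real_complex R)).
Local Notation Im := (@complex.Im R).
Local Notation Re := (@complex.Re R).

Lemma Im_real_mul (a : R) (z : C) : Im (a%:C * z) = a * Im z.
Proof. by case: z => u v /=; rewrite mul0r addr0. Qed.

Lemma Im_mul_real (a : R) (z : C) : Im (z * a%:C) = Im z * a.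
Proof. by rewrite mulrC Im_real_mul mulrC. Qed.

Lemma Im_qf n (T : 'M[C]_n) (x : 'rV[R]_n) : Im (qf T (rc x)) = qf (map_mx Im T) x.
Proof.
rewrite /qf !mxE raddf_sum; apply: eq_bigr => j _ /=.
rewrite !mxE Im_mul_real raddf_sum; congr (_ * _); apply: eq_bigr => i _ /=.
by rewrite !mxE Im_real_mul.
Qed.

Lemma siegelP n (T : 'M[C]_n) : siegel T <->
  T^T = T /\ forall x : 'rV[R]_n, x != 0 -> 0 < Im (qf T (rc x)).
Proof. by split=> -[Ts Tp]; split=> // x /Tp; rewrite Im_qf. Qed.

Lemma siegel_ge0 n (T : 'M[C]_n) x : siegel T -> 0 <= Im (qf T (rc x)).
Proof.
move=> /siegelP [_ Tp]; case: (eqVneq x 0) => [->|/Tp/ltW//].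
by rewrite Im_qf /qf mul0mx mul0mx mxE.
Qed.

Definition cpx n (u v : 'rV[R]_n) : 'rV[C]_n := rc u + 'i%C *: rc v.

Lemma cpxE n (x : 'rV[C]_n) : x = cpx (map_mx Re x) (map_mx Im x).
Proof. by apply/rowP => i; rewrite !mxE [LHS]complexE. Qed.

Lemma sqr_iC : 'i%C * 'i%C = -1 :> C.
Proof. by rewrite -expr2 sqr_i. Qed.

(** For a symmetric matrix the Hermitian form at u + i v is the sum of the quadratic
    forms at u and at v; hence its imaginary part is positive on the Siegel space. *)
Lemma hermitian_qf n (T : 'M[C]_n) (u v : 'rV[R]_n) : T^T = T ->
  bil (cpx u v *m T) (cpx u (- v)) = qf T (rc u) + qf T (rc v).
Proof.
move=> Ts; rewrite /cpx (raddfN (map_mx (real_complex R))) /= mulmxDl !bilDl !bilDr.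
rewrite -scalemxAl !bilZl !bilZr !bilNr (bil_sym (rc v) (rc u) Ts) -!qfE.
set a := qf _ _; set b := qf _ _; set c := bil _ _.
transitivity (a - ('i%C * 'i%C) * b); last by rewrite sqr_iC; ring.
by ring.
Qed.

Lemma siegel_hermitian n (T : 'M[C]_n) (u v : 'rV[R]_n) : siegel T ->
  (u != 0) || (v != 0) -> 0 < Im (bil (cpx u v *m T) (cpx u (- v))).
Proof.
move=> sT uv; have /siegelP [Ts Tp] := sT; rewrite hermitian_qf // raddfD /=.
case/orP: uv => /Tp h; first by rewrite ltr_wpDr // siegel_ge0.
by rewrite ltr_wpDl // siegel_ge0.
Qed.

Lemma siegel_unit n (T : 'M[C]_n) : siegel T -> T \in unitmx.
Proof.
move=> sT; rewrite unitmxE unitfE; apply/det0P => -[x x0 xT].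
have := siegel_hermitian (u := map_mx Re x) (v := map_mx Im x) sT.
rewrite -cpxE xT /bil mul0mx mxE /= ltxx => /(_ _)/notF; apply.
rewrite -negb_and; apply: contra x0 => /andP[/eqP h1 /eqP h2].
by rewrite (cpxE x) h1 h2 /cpx !map_mx0 scaler0 addr0.
Qed.

(** With x = - y T^-1 the value of - T^-1 at y is x y^T, whose imaginary part is that
    of the Hermitian form of T at x. *)
Lemma siegel_opp_inv n (T : 'M[C]_n) : siegel T -> siegel (- invmx T).
Proof.
move=> sT; have /siegelP [Ts Tp] := sT; have Tu := siegel_unit sT.
apply/siegelP; split; first by rewrite raddfN /= trmx_inv Ts.
move=> y y0; set x := - rc y *m invmx T.
have xT : x *m T = - rc y by rewrite mulmxKV.
have xe := cpxE x; set u := map_mx Re x in xe; set v := map_mx Im x in xe.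
have uv : (u != 0) || (v != 0).
  rewrite -negb_and; apply: contra y0 => /andP[/eqP h1 /eqP h2].
  have : rc y = 0.
    by rewrite -[LHS]opprK -xT xe h1 h2 /cpx !map_mx0 scaler0 addr0 mul0mx oppr0.
  by move/eqP; rewrite map_mx_eq0.
have := siegel_hermitian sT uv; rewrite -xe xT.
have -> : qf (- invmx T) (rc y) = bil x (rc y) by rewrite qfE /x mulNmx mulmxN.
rewrite xe /cpx (raddfN (map_mx (real_complex R))) /= !bilDl !bilDr !bilNl !bilZr !bilZl bilNr.
have rr (a b : 'rV[R]_n) : bil (rc a) (rc b) = (bil a b)%:C.
  by rewrite !bilE rmorph_sum; apply: eq_bigr => i _; rewrite !mxE rmorphM.
by rewrite !rr [bil y v]bilC /=; congr (0 < _); ring.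
Qed.

Lemma rc_row n (x0 : R) (x : 'rV[R]_n) :
  rc (row_mx x0%:M x : 'rV_(1 + n)) = row_mx (x0%:C)%:M (rc x).
Proof. by rewrite map_row_mx map_scalar_mx. Qed.

Lemma row_neq0 n (x : 'rV[R]_n) : x != 0 -> (row_mx (0 : R)%:M x : 'rV_(1 + n)) != 0.
Proof. by rewrite raddf0 row_mx_eq0 eqxx. Qed.

Definition block_sym n (a : C) (s : 'rV[C]_n) (T : 'M[C]_n) : 'M[C]_(1 + n) :=
  block_mx a%:M s s^T T.

Definition schur n (a : C) (s : 'rV[C]_n) (T : 'M[C]_n) : 'M[C]_n :=
  T - a^-1 *: (s^T *m s).

(** The image of block_sym a s T under the symplectic inversion of the first
    coordinate alone. *)
Definition partial_inv n (a : C) (s : 'rV[C]_n) (T : 'M[C]_n) : 'M[C]_(1 + n) :=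
  block_sym (- a^-1) (- a^-1 *: s) (schur a s T).

Lemma block_sym_tr n a (s : 'rV[C]_n) T : T^T = T -> (block_sym a s T)^T = block_sym a s T.
Proof. by move=> Ts; rewrite /block_sym tr_block_mx tr_scalar_mx trmxK Ts. Qed.

Lemma qf_schur n a (s : 'rV[C]_n) T x : qf (schur a s T) x = qf T x - a^-1 * bil s x ^+ 2.
Proof.
rewrite /schur qfDm; congr (_ + _); rewrite -scaleNr qfZm mulNr; congr (- (_ * _)).
rewrite qfE mulmxA bil_mulmx mul_scalar_mx bilZl [bil x s]bilC; by rewrite expr2.
Qed.

Lemma qf_partial_inv n a (s : 'rV[C]_n) T x0 x : a != 0 ->
  qf (partial_inv a s T) (row_mx x0%:M x) = qf T x - (x0 + bil s x) ^+ 2 / a.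
Proof. by move=> a0; rewrite qf_block qf_schur bilZl; field. Qed.

Section Block.
Variables (n : nat) (a : C) (s : 'rV[C]_n) (T : 'M[C]_n).
Hypothesis sB : siegel (block_sym a s T).

Let Ts : T^T = T.
Proof.
have /siegelP [h _] := sB; have := congr1 drsubmx h.
by rewrite -trmx_drsub /block_sym block_mxKdr.
Qed.

Lemma block_Im_gt0 : 0 < Im a.
Proof.
have /siegelP [_ /(_ (row_mx 1%:M 0))] := sB.
rewrite rc_row /block_sym qf_block /qf /bil map_mx0 trmx0 !mulmx0 !mxE mulr0 !addr0.
rewrite rmorph1 expr1n mulr1; apply; rewrite row_mx_eq0 negb_and; apply/orP; left.
by apply/eqP => /(congr1 (fun M : 'M[R]_1 => M 0 0)) /eqP; rewrite !mxE oner_eq0.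
Qed.

(** Solve the first coordinate w of a complex vector from the real data (m, p) by
    a w + s p = - m.  Then the Hermitian form of the original matrix at (w, p) and
    the partially inverted quadratic form at (m, p) have the same imaginary part. *)
Lemma partial_inv_siegel : siegel (partial_inv a s T).
Proof.
have a0 : a != 0 := Im_neq0 block_Im_gt0.
have Ss : (schur a s T)^T = schur a s T.
  by rewrite /schur linearB /= linearZ /= trmx_mul trmxK Ts.
apply/siegelP; split; first exact: block_sym_tr.
move=> y y0; rewrite (row_split y) rc_row; set m := y 0 0; set p := rsubmx y.
pose w := - (bil s (rc p) + m%:C) / a; pose u : 'rV[R]_(1 + n) := row_mx (Re w)%:M p.
pose v : 'rV[R]_(1 + n) := row_mx (Im w)%:M 0.
have uv : (u != 0) || (v != 0).
  rewrite -negb_and; apply: contra y0; rewrite /u /v !row_mx_eq0.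
  have sc0 (r : R) : (r%:M == 0 :> 'M[R]_1) = (r == 0).
    by rewrite -scalemx1 scaler_eq0 oner_eq0 orbF.
  rewrite !sc0 => /andP[/andP[/eqP r0 /eqP p0] /andP[/eqP i0 _]].
  have w0 : w = 0 by rewrite [w]complexE r0 i0 mulr0 addr0.
  move/eqP: w0; rewrite mulf_eq0 invr_eq0 (negbTE a0) orbF oppr_eq0 p0 map_mx0.
  rewrite /bil trmx0 mulmx0 mxE add0r => /eqP [m0].
  by rewrite (row_split y) -/m -/p m0 p0 raddf0 row_mx0.
have := siegel_hermitian sB uv; rewrite hermitian_qf; last exact: block_sym_tr.
rewrite /u /v !rc_row map_mx0 qf_partial_inv // /block_sym !qf_block.
rewrite bil0r qf0 mulr0 !addr0.
set q := qf T _; have aw : a * w = - (bil s (rc p) + m%:C) by rewrite /w mulrC divfK.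
set b := bil s _ in aw *.
have wE : w = - (b + m%:C) / a by [].
have -> : (m%:C + b) ^+ 2 / a = a * w * w by rewrite aw wE; field.
have b' : b = - (a * w) - m%:C by rewrite aw; ring.
rewrite b'; congr (0 < _).
have -> : (Re w)%:C = (w + w^*) / 2 :> C by rewrite ReJ_add.
have -> : (Im w)%:C = (w^* - w) / 2 * 'i%C :> C by rewrite ImJ_sub.
transitivity (Im (q - a * w * w - m%:C * (w + w^*))).
  congr Im; have -> : ((w^* - w) / 2 * 'i%C) ^+ 2 = - ((w^* - w) / 2) ^+ 2.
    by rewrite exprMn sqr_i mulrN1.
  by field.
rewrite raddfB /= [X in _ - X](_ : _ = 0) ?subr0 //.
by rewrite addcJ mulrCA -rmorphM -(rmorph_nat (real_complex R)) -rmorphM.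
Qed.

Lemma schur_siegel : siegel (schur a s T).
Proof.
have /siegelP [h Tp] := partial_inv_siegel; apply/siegelP; split.
  by have := congr1 drsubmx h; rewrite -trmx_drsub /partial_inv /block_sym block_mxKdr.
move=> x x0; have := Tp _ (row_neq0 x0); rewrite rc_row /partial_inv /block_sym qf_block.
by rewrite rmorph0 expr0n !mulr0 mul0r !add0r.
Qed.

(** Inversion of a block matrix by elimination of the first coordinate. *)
Lemma qf_invmx_block (u0 : C) (u : 'rV[C]_n) :
  qf (invmx (block_sym a s T)) (row_mx u0%:M u) =
  u0 ^+ 2 / a + qf (invmx (schur a s T)) (u - (u0 / a) *: s).
Proof.
have a0 : a != 0 := Im_neq0 block_Im_gt0.
set S := schur a s T; have Su : S \in unitmx := siegel_unit schur_siegel.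
have Bu := siegel_unit sB.
set w := (u - (u0 / a) *: s) *m invmx S.
have wS : w *m S = u - (u0 / a) *: s by rewrite mulmxKV.
pose w0 := (u0 - bil w s) / a.
have hT : T = S + a^-1 *: (s^T *m s) by rewrite /S /schur subrK.
have h : row_mx w0%:M w *m block_sym a s T = row_mx u0%:M u.
  rewrite /block_sym row_mul_block; congr row_mx; first by rewrite /w0 divfK ?subrK.
  rewrite {1}hT mulmxDr wS -scalemxAr mulmxA bil_mulmx mul_scalar_mx scalerA.
  rewrite addrCA -addrA -scaleNr -!scalerDl -[RHS]addr0; congr (_ + _).
  by rewrite -[RHS](scale0r s); congr (_ *: _); rewrite /w0; field.
rewrite qfE -{1}h mulmxK // bil_row [qf (invmx S) _]qfE -/w bilDr bilNr bilZr.
by rewrite /w0; field.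
Qed.

End Block.

End SiegelSpace.

(** * Poisson summation in several variables *)

Section RealQuadratic.
Variable R : realType.

Definition nrm2 n (x : 'rV[R]_n) : R := bil x x.

Lemma nrm2_ge0 n (x : 'rV[R]_n) : 0 <= nrm2 x.
Proof. by rewrite /nrm2 bilE sumr_ge0 // => i _; rewrite -expr2 sqr_ge0. Qed.

Lemma nrm2_eq0 n (x : 'rV[R]_n) : nrm2 x = 0 -> x = 0.
Proof.
rewrite /nrm2 bilE => /eqP; rewrite psumr_eq0 => [|i _]; last by rewrite -expr2 sqr_ge0.
move/allP => h; apply/rowP => i; rewrite mxE; apply/eqP.
by have := h i (mem_index_enum i); rewrite /= mulf_eq0 orbb.
Qed.

Lemma cauchy_schwarz n (x y : 'rV[R]_n) : bil x y ^+ 2 <= nrm2 x * nrm2 y.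
Proof.
case: (eqVneq (nrm2 y) 0) => [y0|y0].
  by rewrite (nrm2_eq0 y0) bil0r /nrm2 bil0r expr0n mulr0.
have yp : 0 < nrm2 y by rewrite lt_neqAle eq_sym y0 nrm2_ge0.
have := nrm2_ge0 (nrm2 y *: x - bil x y *: y).
have -> : nrm2 (nrm2 y *: x - bil x y *: y) = nrm2 y * (nrm2 x * nrm2 y - bil x y ^+ 2).
  rewrite {1}/nrm2 bilDl !bilDr !bilNl !bilNr !bilZl !bilZr -/(nrm2 x) -/(nrm2 y) [bil y x]bilC.
  by ring.
by rewrite pmulr_rge0 // subr_ge0.
Qed.

(** Induction on the dimension, completing the square in the first variable. *)
Lemma posdef_lower n (Y : 'M[R]_n) : Y^T = Y -> (forall x, x != 0 -> 0 < qf Y x) ->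
  exists2 c, 0 < c & forall x, c * nrm2 x <= qf Y x.
Proof.
elim: n Y => [|n IH] Y Ys Yp.
  by exists 1 => // x; rewrite mul1r /nrm2 bilE big_ord0 /qf mxE big_ord0.
move: (Y : 'M[R]_(1 + n)) Ys Yp => {}Y Ys Yp.
rewrite (sym_block Ys) in Yp *; set a := Y 0 0 in Yp *; set s := ursubmx Y in Yp *.
set T := drsubmx Y in Yp *.
have Ts : T^T = T by rewrite /T trmx_drsub Ys.
have a0 : 0 < a.
  have nz : (row_mx 1%:M 0 : 'rV[R]_(1 + n)) != 0.
    rewrite row_mx_eq0 negb_and; apply/orP; left.
    by apply/eqP => /(congr1 (fun M : 'M[R]_1 => M 0 0)) /eqP; rewrite !mxE oner_eq0.
  by have := Yp _ nz; rewrite qf_block bil0r qf0 mulr0 !addr0 expr1n mulr1.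
pose S := T - a^-1 *: (s^T *m s).
have qS x : qf S x = qf T x - a^-1 * bil s x ^+ 2.
  rewrite /S qfDm -scaleNr qfZm mulNr; congr (_ - _ * _).
  by rewrite qfE mulmxA bil_mulmx mul_scalar_mx bilZl [bil x s]bilC expr2.
have key x0 x : qf (block_mx a%:M s s^T T : 'M[R]_(1 + n)) (row_mx x0%:M x) =
    a * (x0 + bil s x / a) ^+ 2 + qf S x.
  by rewrite qf_block qS; field; rewrite gt_eqF.
have [|x x0|c c0 hc] := IH S.
- by rewrite /S linearB /= linearZ /= trmx_mul trmxK Ts.
- have nz : (row_mx (- (bil s x / a))%:M x : 'rV[R]_(1 + n)) != 0.
    by rewrite row_mx_eq0 negb_and x0 orbT.
  by have := Yp _ nz; rewrite key addNr expr0n mulr0 add0r.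
(* L bounds the cost of replacing x0 by x0 + E in the norm, by Cauchy-Schwarz. *)
pose L := 2 * nrm2 s / a ^+ 2 + 1.
have L0 : 0 < L by rewrite /L ltr_wpDl // divr_ge0 ?sqr_ge0 // mulr_ge0 // nrm2_ge0.
pose d := Num.min (a / 2) (c / L).
have d0 : 0 < d by rewrite lt_min !divr_gt0.
have d1 : d <= a / 2 by rewrite ge_min lexx.
have d2 : d * L <= c by rewrite -ler_pdivlMr // ge_min lexx orbT.
exists d => // x; rewrite (@row_split _ n x); set x0 := x 0 0; set y := rsubmx _.
rewrite key {1}/nrm2 bil_row -/(nrm2 y).
have hy := hc y; have ny := nrm2_ge0 y; set E := bil s y / a.
have hE : E ^+ 2 <= nrm2 s / a ^+ 2 * nrm2 y.
  by rewrite /E expr_div_n [leRHS]mulrAC ler_wpM2r ?invr_ge0 ?sqr_ge0 // cauchy_schwarz.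
have sq : 0 <= (x0 + 2 * E) ^+ 2 by exact: sqr_ge0.
have h1 : x0 * x0 + nrm2 y <= 2 * (x0 + E) ^+ 2 + L * nrm2 y by rewrite /L; lra.
have h2 := ler_wpM2l (ltW d0) h1.
have h3 := ler_wpM2r ny d2.
have h4 := ler_wpM2r (sqr_ge0 (x0 + E)) d1.
lra.
Qed.

Lemma prod_rho_abs n : absSum (fun p : 'rV[int]_n => (\prod_i rho ((p 0 i)%:~R : R))%:C).
Proof.
elim: n => [|n IH].
  exists 1 => A; apply: (@le_trans _ _ (\sum_(p <- [fset (0 : 'rV[int]_0)]%fset) 1)).
    apply: le_trans (fsum_sub (A := A) _ _).
    - by apply: ler_sum => p _; rewrite big_ord0 normc_real normr1.
    - by move=> p; exact: ler01.
    - by apply/fsubsetP => p _; rewrite inE [p]thinmx0.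
  by rewrite big_seq_fset1.
case: IH => M hM.
have P0 m (p : 'rV[int]_m) : 0 <= \prod_i rho ((p 0 i)%:~R : R).
  by apply: prodr_ge0 => i _; exact/ltW/rho_gt0.
pose g (x : int * 'rV[int]_n) : R[i] :=
  (rho (x.1%:~R : R) * \prod_i rho ((x.2 0 i)%:~R : R))%:C.
have ag : absSum g.
  apply: (absSum_tensor (a := fun k : int => rho (k%:~R : R))
    (b := fun p : 'rV[int]_n => \prod_i rho ((p 0 i)%:~R : R)) (Ma := 16) (Mb := M)) => //.
  - by move=> k; exact/ltW/rho_gt0.
  - exact: rho_int_sum.
  - move=> A; apply: le_trans (hM A); apply: ler_sum => p _.
    by rewrite normc_real ger0_norm.
  - by move=> x; rewrite normc_real ger0_norm // mulr_ge0 //; exact/ltW/rho_gt0.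
pose h (p : 'rV[int]_(1 + n)) := (p 0 0, rsubmx p).
have inj : injective h.
  by move=> p q [h1 h2]; rewrite (row_split p) (row_split q) h1 h2.
have := absSum_inj inj ag; congr absSum; apply/funext => p.
rewrite /g /h /= big_ord_recl; congr (_ * _)%:C.
apply: eq_bigr => i _; rewrite mxE; congr rho; congr (p _ _)%:~R; exact/val_inj.
Qed.

End RealQuadratic.

Section PoissonN.
Variable R : realType.
Local Notation C := (R[i]).
Local Notation rc := (map_mx (real_complex R)).
Local Notation Im := (@complex.Im R).
Local Notation Re := (@complex.Re R).

Definition intC n (p : 'rV[int]_n) : 'rV[C]_n := map_mx intr p.

Definition gauss_term n (T : 'M[C]_n) (z : 'rV[C]_n) (p : 'rV[int]_n) : C :=
  ee (2^-1 * qf T (intC p) + bil (intC p) z).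

Definition dual_term n (T : 'M[C]_n) (z : 'rV[C]_n) (p : 'rV[int]_n) : C :=
  ee (- (2^-1 * qf (invmx T) (z + intC p))).

Lemma intC_real n (p : 'rV[int]_n) : intC p = rc (map_mx intr p).
Proof. by apply/rowP => i; rewrite !mxE rmorph_int. Qed.

Lemma intC_row n (p0 : int) (p : 'rV[int]_n) :
  intC (row_mx (p0%:M) p : 'rV_(1 + n)) = row_mx (p0%:~R)%:M (intC p).
Proof. by rewrite /intC map_row_mx map_scalar_mx. Qed.

(** A positive definite form dominates a multiple of the Euclidean norm, so the
    summand is bounded by a product of one-variable Gaussians. *)
Lemma gauss_term_abs n (T : 'M[C]_n) z : siegel T -> absSum (gauss_term T z).
Proof.
move=> sT; have /siegelP [Ts Tp] := sT; have pi0 := pi_gt0 R.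
have [| |c c0 hc] := @posdef_lower R n (map_mx Im T).
- by rewrite map_trmx Ts.
- by move=> x /Tp; rewrite Im_qf.
pose b i := 2 * pi * `|Im (z 0 i)|.
have pc0 : 0 < pi * c by rewrite mulr_gt0.
have hK i : {K | 0 < K & forall x : R, expR (- (pi * c) * x ^+ 2 + b i * `|x|) <= K * rho x}.
  by apply/cid2; exact: gauss_rho.
pose K i := s2val (hK i).
have K0 i : 0 < K i by rewrite /K; case: (hK i).
have KP i x : expR (- (pi * c) * x ^+ 2 + b i * `|x|) <= K i * rho x.
  by rewrite /K; case: (hK i) => ? ? /= h; exact: h.
apply: absSum_le (absSumZ (\prod_i K i)%:C (@prod_rho_abs R n)) => p.
rewrite /gauss_term normc_ee -rmorphM normc_real /= [leRHS]ger0_norm; last first.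
  by apply: mulr_ge0; apply: prodr_ge0 => i _; [exact/ltW/K0|exact/ltW/rho_gt0].
rewrite -big_split /=.
apply: (@le_trans _ _ (\prod_i expR (- (pi * c) * (p 0 i)%:~R ^+ 2 + b i * `|(p 0 i)%:~R|))); last first.
  by apply: ler_prod => i _; rewrite expR_ge0 /=; exact: KP.
rewrite -expR_sum ler_expR.
set x : 'rV[R]_n := map_mx intr p.
have e1 : Im (2^-1 * qf T (intC p) + bil (intC p) z) = 2^-1 * qf (map_mx Im T) x + \sum_i x 0 i * Im (z 0 i).
  rewrite raddfD /=; congr (_ + _).
    by rewrite intC_real -Im_qf -Im_real_mul fmorphV rmorph_nat.
  rewrite bilE raddf_sum; apply: eq_bigr => i _ /=.
  by rewrite intC_real !mxE Im_real_mul.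
rewrite e1 big_split /= -mulr_sumr.
have -> : \sum_i ((p 0 i)%:~R : R) ^+ 2 = nrm2 x.
  by rewrite /nrm2 bilE; apply: eq_bigr => i _; rewrite !mxE expr2.
have h1 := ler_wpM2l (ltW pi0) (hc x).
have h2 : - (2 * pi * \sum_i x 0 i * Im (z 0 i)) <= \sum_i b i * `|(p 0 i)%:~R|.
  rewrite mulr_sumr -sumrN; apply: ler_sum => i _; rewrite /b mxE.
  apply: le_trans (ler_norm _) _; rewrite normrN normrM [ `|2 * pi| ]ger0_norm; last by lra.
  rewrite normrM.
  by rewrite le_eqVlt; apply/orP; left; apply/eqP; ring.
move: h1 h2; set u := nrm2 x; set v := qf _ x; set w := \sum_i _; set w' := \sum_i _.
lra.
Qed.

(** The dual summand is itself a Gaussian summand, for - T^-1. *)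
Lemma dual_term_gauss n (T : 'M[C]_n) z p : siegel T ->
  dual_term T z p = ee (- (2^-1 * qf (invmx T) z)) * gauss_term (- invmx T) (- (z *m invmx T)) p.
Proof.
move=> sT; have /siegelP [Ts _] := siegel_opp_inv sT.
have Us : (invmx T)^T = invmx T.
  by move: Ts; rewrite raddfN /= => /oppr_inj.
rewrite /dual_term /gauss_term -eeD; congr ee; rewrite qfD //.
have -> : qf (- invmx T) (intC p) = - qf (invmx T) (intC p) by rewrite -scaleN1r qfZm mulN1r.
by rewrite bilNr [bil (intC p) _]bilC; field.
Qed.

Lemma dual_term_abs n (T : 'M[C]_n) z : siegel T -> absSum (dual_term T z).
Proof.
move=> sT; have h := absSumZ (ee (- (2^-1 * qf (invmx T) z)))
  (gauss_term_abs (- (z *m invmx T)) (siegel_opp_inv sT)).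
by apply: absSum_le h => p; rewrite dual_term_gauss.
Qed.

Definition join_row n (x : int * 'rV[int]_n) : 'rV[int]_(1 + n) := row_mx (x.1)%:M x.2.
Definition split_row n (p : 'rV[int]_(1 + n)) : int * 'rV[int]_n := (p 0 0, rsubmx p).

Lemma join_rowK n : cancel (@join_row n) (@split_row n).
Proof.
case=> p0 p; rewrite /split_row /join_row row_mxKr /=; congr (_, _).
rewrite mxE; case: splitP => // j; rewrite ord1 => _; by rewrite mxE eqxx.
Qed.

Lemma split_rowK n : cancel (@split_row n) (@join_row n).
Proof. by move=> p; rewrite /join_row /split_row /= -row_split. Qed.

(** Poisson summation up to a constant that depends only on T.  Split Z^(1 + n) as
    Z x Z^n, invert the first variable for fixed values of the others, exchange the
    summations, and apply the induction hypothesis to the Schur complement.  The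
    intermediate double series is a Gaussian series for the partially inverted
    matrix, hence absolutely summable. *)
Lemma poisson n (T : 'M[C]_n) : siegel T -> exists kappa : C, forall z,
  csum (gauss_term T z) = kappa * csum (dual_term T z).
Proof.
elim: n T => [|n IH] T sT.
  exists 1 => z; rewrite mul1r; apply: eq_csum => p; rewrite /gauss_term /dual_term /qf /bil.
  by rewrite !mxE !big_ord0 mulr0 oppr0 add0r.
move: (T : 'M[C]_(1 + n)) sT => {}T sT; have /siegelP [Ts _] := sT.
rewrite (sym_block Ts) in sT *; set a := T 0 0 in sT *.
set s := ursubmx T in sT *; set T' := drsubmx T in sT *.
rewrite -/(block_sym a s T') in sT *.
have Ia := block_Im_gt0 sT; have a0 : a != 0 := Im_neq0 Ia.
have [k1 h1] := poisson1 Ia; have [k2 h2] := IH _ (schur_siegel sT).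
exists (k1 * k2) => z; rewrite (@row_split _ n z); set z0 := z 0 0; set z' := rsubmx _.
pose f (x : int * 'rV[int]_n) : C := gauss_term (block_sym a s T') (row_mx z0%:M z') (join_row x).
pose g (x : int * 'rV[int]_n) : C := dual_term (block_sym a s T') (row_mx z0%:M z') (join_row x).
have af : absSum f by apply: absSum_inj (gauss_term_abs _ sT); exact: can_inj (@join_rowK n).
have ag : absSum g by apply: absSum_inj (dual_term_abs _ sT); exact: can_inj (@join_rowK n).
rewrite -(csum_bij (@join_rowK n) (@split_rowK n) (gauss_term_abs _ sT)).
rewrite -(csum_bij (@join_rowK n) (@split_rowK n) (dual_term_abs _ sT)).
rewrite -[csum (_ \o _)]/(csum f) -[X in _ * X]/(csum g).
(* The summand after inverting only the first variable. *)
pose h (x : int * 'rV[int]_n) : C :=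
  ee (2^-1 * qf T' (intC x.2) + bil (intC x.2) z') *
  ee (- ((z0 + bil s (intC x.2) + (x.1)%:~R) ^+ 2 / (2 * a))).
have hE x : h x = ee (- (z0 ^+ 2 / (2 * a))) *
   gauss_term (partial_inv a s T') (row_mx (- a^-1 * z0)%:M (z' - (z0 / a) *: s)) (join_row x).
  rewrite /h /gauss_term /join_row intC_row qf_partial_inv // bil_row bilDr bilNr bilZr.
  by rewrite -!eeD [bil (intC _) s]bilC; congr ee; field.
have ah : absSum h.
  have := absSumZ (ee (- (z0 ^+ 2 / (2 * a)))) (absSum_inj (can_inj (@join_rowK n))
    (gauss_term_abs (row_mx (- a^-1 * z0)%:M (z' - (z0 / a) *: s)) (partial_inv_siegel sT))).
  by apply: absSum_le => x; rewrite hE.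
have s1 p : csum (fun p0 : int => f (p0, p)) = k1 * csum (fun n0 : int => h (n0, p)).
  have b1 := gauss1_abs (z0 + bil s (intC p)) Ia.
  transitivity (ee (2^-1 * qf T' (intC p) + bil (intC p) z') *
     csum (fun p0 : int => ee (2^-1 * a * p0%:~R ^+ 2 + p0%:~R * (z0 + bil s (intC p))))).
    rewrite -csumZ //; apply: eq_csum => p0.
    rewrite /f /gauss_term /join_row intC_row /block_sym qf_block bil_row -eeD; congr ee; by field.
  rewrite h1 mulrCA; congr (_ * _).
  have bh : absSum (fun n0 : int => h (n0, p)).
    by apply: (absSum_inj (h := fun n0 : int => (n0, p))) ah => x y [].
  have c0 := ee_neq0 (2^-1 * qf T' (intC p) + bil (intC p) z').
  apply: (mulfI (invr_neq0 c0)); rewrite mulKf // -csumZ //.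
  by apply: eq_csum => n0; rewrite /h mulKf.
have s2 n0 : csum (fun p => h (n0, p)) = k2 * csum (fun p => g (n0, p)).
  pose y := z' - ((z0 + n0%:~R) / a) *: s.
  have e1 p : h (n0, p) = ee (- ((z0 + n0%:~R) ^+ 2 / (2 * a))) * gauss_term (schur a s T') y p.
    rewrite /h /gauss_term -!eeD qf_schur /y bilDr bilNr bilZr [bil (intC p) s]bilC.
    by congr ee; field.
  have e2 p : g (n0, p) = ee (- ((z0 + n0%:~R) ^+ 2 / (2 * a))) * dual_term (schur a s T') y p.
    rewrite /g /dual_term /join_row intC_row add_row_mx -raddfD /= qf_invmx_block // -eeD.
    have -> : z' + intC p - ((z0 + n0%:~R) / a) *: s = y + intC p by rewrite /y addrAC.
    by congr ee; field.
  under eq_csum do rewrite e1.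
  under [in RHS]eq_csum do rewrite e2.
  have sS := schur_siegel sT.
  rewrite csumZ ?csumZ; [|exact: dual_term_abs|exact: gauss_term_abs].
  by rewrite h2 mulrCA.
have ah' : absSum (fun x : 'rV[int]_n * int => h (x.2, x.1)).
  by apply: (absSum_inj (h := fun x : 'rV[int]_n * int => (x.2, x.1))) ah => -[? ?] [? ?] [-> ->].
rewrite csum_pair_swap //; under eq_csum do rewrite s1.
rewrite csumZ; last exact: (absSum_fst ah').
rewrite -mulrA; congr (_ * _).
rewrite -(csum_pair_swap ah) csum_pair //; under eq_csum do rewrite s2.
by rewrite csumZ -?csum_pair //; exact: absSum_fst.
Qed.

End PoissonN.

(** * Theta series with characteristics *)

(* Otherwise simplification unfolds the exponential down to real and imaginary parts. *)
Arguments ee : simpl never.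

Section Theta.
Variable R : realType.
Local Notation C := (R[i]).
Local Notation rc := (map_mx (real_complex R)).
Local Notation intC := (@intC R _).

Definition theta_summand n (X Y : 'rV[C]_n) (T : 'M[C]_n) (p : 'rV[int]_n) : C :=
  ee (2^-1 * qf T (intC p + X) + bil (intC p + X) Y).

Definition theta_char n (X Y : 'rV[C]_n) (T : 'M[C]_n) : C := csum (theta_summand X Y T).

Lemma intCD n (p q : 'rV[int]_n) : intC (p + q) = intC p + intC q.
Proof. exact: raddfD. Qed.

Lemma intCN n (p : 'rV[int]_n) : intC (- p) = - intC p.
Proof. exact: raddfN. Qed.

Lemma theta_summandE n (X Y : 'rV[C]_n) (T : 'M[C]_n) p : T^T = T ->
  theta_summand X Y T p = ee (2^-1 * qf T X + bil X Y) * gauss_term T (X *m T + Y) p.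
Proof.
move=> Ts; rewrite /theta_summand /gauss_term -eeD; congr ee; rewrite qfD // bilDl bilDr.
rewrite (bil_sym (intC p) X Ts) [bil (intC p) (X *m T)]bilC.
by move: (bil X Y) (bil (X *m T) _) (bil (intC p) Y) (qf T X) (qf T _) => x y z w u; field.
Qed.

Lemma theta_summand_abs n (X Y : 'rV[C]_n) T : siegel T -> absSum (theta_summand X Y T).
Proof.
move=> sT; have h := absSumZ (ee (2^-1 * qf T X + bil X Y)) (gauss_term_abs (X *m T + Y) sT).
by apply: absSum_le h => p; rewrite theta_summandE //; case: sT.
Qed.

Definition dual_summand n (X Y : 'rV[C]_n) (T : 'M[C]_n) (m : 'rV[int]_n) : C :=
  ee (- (2^-1 * qf (invmx T) (Y + intC m)) - bil X (intC m)).

Lemma dual_summandE n (X Y : 'rV[C]_n) T m : siegel T ->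
  dual_summand X Y T m = ee (2^-1 * qf T X + bil X Y) * dual_term T (X *m T + Y) m.
Proof.
move=> sT; have Tu := siegel_unit sT; have [Ts _] := sT.
have Us : (invmx T)^T = invmx T by rewrite trmx_inv Ts.
rewrite /dual_summand /dual_term -eeD -[X *m T + Y + _]addrA (qfD (X *m T) _ Us); congr ee.
have -> : qf (invmx T) (X *m T) = qf T X by rewrite qfE mulmxK // bilC.
rewrite mulmxK // bilDr.
by move: (bil X Y) (bil X (intC m)) (qf T X) (qf (invmx T) _) => x y z w; field.
Qed.

Lemma dual_summand_abs n (X Y : 'rV[C]_n) T : siegel T -> absSum (dual_summand X Y T).
Proof.
move=> sT; have h := absSumZ (ee (2^-1 * qf T X + bil X Y)) (dual_term_abs (X *m T + Y) sT).
by apply: absSum_le h => p; rewrite dual_summandE.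
Qed.

(** Poisson summation at z = X T + Y, with the exponential prefactors collected. *)
Lemma theta_inversion n (T : 'M[C]_n) : siegel T -> exists kappa : C, forall X Y,
  theta_char X Y T = kappa * csum (dual_summand X Y T).
Proof.
move=> sT; have [kappa hk] := poisson sT; exists kappa => X Y.
rewrite /theta_char; have [Ts _] := sT; under eq_csum do rewrite theta_summandE //.
under [in RHS]eq_csum do rewrite dual_summandE //.
by rewrite csumZ ?csumZ; [rewrite hk mulrCA|exact: dual_term_abs|exact: gauss_term_abs].
Qed.

Lemma Theta_char (m' m'' : 'rV[R]_5) (T : 'M[C]_5) : siegel T ->
  Theta m' m'' T = theta_char (rc m') (rc m'') T.
Proof.
move=> sT; have e : theta_term m' m'' T = theta_summand (rc m') (rc m'') T.
  apply/funext => p; rewrite /theta_summand /theta_term /qf /bil.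
  suff -> : map_mx (fun x : R => x%:C) (map_mx intr p + m') = intC p + rc m' by [].
  by apply/rowP => i; rewrite !mxE rmorphD /= rmorph_int.
by rewrite /theta_char /Theta e; apply: sum_hasSum; apply: csumP; exact: theta_summand_abs.
Qed.

Lemma theta_char_shiftX n (X Y : 'rV[C]_n) T (q : 'rV[int]_n) : siegel T ->
  theta_char (X + intC q) Y T = theta_char X Y T.
Proof.
move=> sT; have K1 : cancel (fun p : 'rV[int]_n => p + q) (fun p => p - q).
  by move=> p; rewrite addrK.
have K2 : cancel (fun p : 'rV[int]_n => p - q) (fun p => p + q).
  by move=> p; rewrite subrK.
rewrite /theta_char; etransitivity; last exact: (csum_bij K1 K2 (theta_summand_abs X Y sT)).
apply: eq_csum => p /=.
by rewrite /theta_summand intCD -addrA [intC q + X]addrC.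
Qed.

Lemma theta_char_shiftY n (X Y : 'rV[C]_n) T (q : 'rV[int]_n) : siegel T ->
  theta_char X (Y + intC q) T = ee (bil X (intC q)) * theta_char X Y T.
Proof.
move=> sT; rewrite /theta_char -csumZ; last exact: theta_summand_abs.
apply: eq_csum => p; rewrite /theta_summand -eeD.
apply: (@ee_shift _ _ _ (bil p q)).
have -> : (bil p q)%:~R = bil (intC p) (intC q) :> C.
  by rewrite !bilE rmorph_sum; apply: eq_bigr => i _; rewrite !mxE rmorphM.
by rewrite bilDr [bil (intC p + X) (intC q)]bilDl; ring.
Qed.

Lemma theta_char_opp n (X Y : 'rV[C]_n) T : siegel T -> theta_char (- X) (- Y) T = theta_char X Y T.
Proof.
move=> sT; have K : cancel (fun p : 'rV[int]_n => - p) (fun p => - p).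
  by move=> p; rewrite opprK.
rewrite /theta_char; etransitivity; last exact: (csum_bij K K (theta_summand_abs X Y sT)).
apply: eq_csum => p /=.
have e : intC (- p) + X = - (intC p - X) by rewrite intCN opprB addrC.
by rewrite /theta_summand e qfN bilNl bilNr.
Qed.

(** The Gaussian in the differences of the three summation indices, that is, the
    summand of the theta series of the root lattice A_2 tensored with T. *)
Definition A2_factor n (T : 'M[C]_n) (d : 'rV[int]_n * 'rV[int]_n) : C :=
  ee (2^-1 * (qf T (intC d.1) + qf T (intC d.2) - 3^-1 * qf T (intC (d.1 + d.2)))).

Lemma siegelZ n (T : 'M[C]_n) (k : nat) : siegel T -> siegel (k.+1%:R *: T).
Proof.
move=> /siegelP [Ts Tp]; apply/siegelP; split; first by rewrite linearZ /= Ts.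
move=> x /Tp h; rewrite qfZm -(rmorph_nat (real_complex R)) Im_real_mul.
by rewrite mulr_gt0.
Qed.

(** The indices p, p + d1, p + d2 have centre of gravity p + (d1 + d2) / 3.  The
    quadratic form splits orthogonally into three times its value at the centre of
    gravity and a form in the differences, so for fixed d1, d2 the sum over p is a
    theta series at 3 T. *)
Lemma theta_char_cube n (X Y : 'rV[C]_n) T : siegel T ->
  absSum (fun d => A2_factor T d * theta_char (X + 3^-1 *: intC (d.1 + d.2)) (3 *: Y) (3 *: T)) /\
  theta_char X Y T ^+ 3 =
    csum (fun d => A2_factor T d * theta_char (X + 3^-1 *: intC (d.1 + d.2)) (3 *: Y) (3 *: T)).
Proof.
move=> sT; have [Ts _] := sT; have sT3 : siegel (3 *: T) := siegelZ 2 sT.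
have a1 := theta_summand_abs X Y sT.
have [a2 e2] := csum_mul a1 a1; have [a3 e3] := csum_mul a1 a2.
pose V := 'rV[int]_n.
pose sh (x : V * (V * V)) : V * (V * V) := (x.1, (x.1 + x.2.1, x.1 + x.2.2)).
pose sh' (x : V * (V * V)) : V * (V * V) := (x.1, (x.2.1 - x.1, x.2.2 - x.1)).
have K1 : cancel sh sh'.
  by case=> p [q r]; rewrite /sh /sh' /= ![p + _]addrC !addrK.
have K2 : cancel sh' sh.
  by case=> p [q r]; rewrite /sh /sh' /= ![p + _]addrC !subrK.
pose f (x : V * (V * V)) : C :=
  A2_factor T x.2 * theta_summand (X + 3^-1 *: intC (x.2.1 + x.2.2)) (3 *: Y) (3 *: T) x.1.
have fE : (fun x => theta_summand X Y T x.1 * (theta_summand X Y T x.2.1 * theta_summand X Y T x.2.2)) \o sh = f.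
  apply/funext => -[p [d1 d2]] /=; rewrite /f /theta_summand /A2_factor /= -!eeD; congr ee.
  rewrite !intCD; set v := intC p + X; set x := intC d1; set y := intC d2.
  have -> : intC p + x + X = v + x by rewrite /v addrAC.
  have -> : intC p + y + X = v + y by rewrite /v addrAC.
  have -> : intC p + (X + 3^-1 *: (x + y)) = v + 3^-1 *: (x + y) by rewrite addrA.
  rewrite qfZm (qfD v x Ts) (qfD v y Ts) (qfD v _ Ts) qfZ (qfD x y Ts) !bilDl !bilZr !bilZl !bilDr !bilDl.
  move: (qf T v) (qf T x) (qf T y) (bil (v *m T) x) (bil (v *m T) y) (bil (x *m T) y) => q1 q2 q3 b1 b2 b3.
  move: (bil v Y) (bil x Y) (bil y Y) => l1 l2 l3.
  by field.
have af : absSum f by rewrite -fE; apply: absSum_inj a3; exact: can_inj K1.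
have af' : absSum (fun x : (V * V) * V => f (x.2, x.1)).
  by apply: (absSum_inj (h := fun x : (V * V) * V => (x.2, x.1))) af => -[? ?] [? ?] [-> ->].
have inner d : csum (fun p => f (p, d)) =
    A2_factor T d * theta_char (X + 3^-1 *: intC (d.1 + d.2)) (3 *: Y) (3 *: T).
  by rewrite /f /=; apply: csumZ; exact: theta_summand_abs.
split.
  by have := absSum_fst af'; congr absSum; apply/funext => d; rewrite -inner.
rewrite exprS expr2 -e2 -e3 -(csum_bij K1 K2 a3) fE (csum_pair_swap af).
by apply: eq_csum => d; exact: (inner d).
Qed.

End Theta.

(** * Inversion at a point of the ball *)

Section Ball.
Variable R : realType.
Local Notation C := (R[i]).
Local Notation intC := (@intC R _).

Definition Hsign (K : pzRingType) (i : 'I_5) : K := if i == ord_max then -1 else 1.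

Lemma mulHE (K : pzRingType) (x : 'rV[K]_5) i : (x *m Hmx K) 0 i = x 0 i * Hsign K i.
Proof. by rewrite /Hmx mul_mx_diag !mxE. Qed.

Lemma H_tr (K : pzRingType) : (Hmx K)^T = Hmx K.
Proof. exact: tr_diag_mx. Qed.

Lemma Hsign_sqr (K : pzRingType) i : Hsign K i * Hsign K i = 1.
Proof. by rewrite /Hsign; case: ifP; rewrite ?mulrNN mulr1. Qed.

Lemma mulHH (K : pzRingType) (x : 'rV[K]_5) : x *m Hmx K *m Hmx K = x.
Proof. by apply/rowP => i; rewrite !mulHE -mulrA Hsign_sqr mulr1. Qed.

Lemma HH (K : pzRingType) : Hmx K *m Hmx K = 1%:M.
Proof.
by apply/row_matrixP => i; rewrite !rowE mulmx1 mulmxA mulHH.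
Qed.

Lemma intC_mulH (p : 'rV[int]_5) : intC (p *m Hmx int) = intC p *m Hmx C.
Proof.
apply/rowP => i; rewrite mulHE [LHS]mxE mulHE [in RHS]mxE rmorphM /=; congr (_ * _).
by rewrite /Hsign; case: ifP => _; rewrite ?rmorphN rmorph1.
Qed.

Lemma qfHE (K : comPzRingType) (x : 'rV[K]_5) : qf (Hmx K) x = \sum_i Hsign K i * x 0 i ^+ 2.
Proof. by rewrite qfE bilE; apply: eq_bigr => i _; rewrite mulHE; ring. Qed.

(** Multiply the equation of the ball by H on both sides and use H ^ 2 = 1. *)
Lemma ball_invmx (tau : 'M[C]_5) : ball4 tau ->
  - invmx tau = Hmx C *m tau *m Hmx C + Hmx C.
Proof.
move=> [sT e]; have Tu := siegel_unit sT.
set H := Hmx C; have e1 : tau *m (H *m tau *m H + H) = - 1%:M.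
  apply/eqP; rewrite -addr_eq0; apply/eqP.
  have : H *m ((H *m tau) ^+ 2 + H *m tau + 1%:M) *m H = 0 by rewrite e mulmx0 mul0mx.
  rewrite expr2 -[_ * _]/(_ *m _) !mulmxDr !mulmxDl !mulmxA HH !mul1mx mulmx1 HH; exact.
by rewrite -[RHS](mulKmx Tu) e1 mulmxN mulmx1.
Qed.

Lemma qf_invmx_ball (tau : 'M[C]_5) w : ball4 tau ->
  qf (invmx tau) w = - (qf tau (w *m Hmx C) + qf (Hmx C) w).
Proof.
move=> bt; have -> : invmx tau = - (Hmx C *m tau *m Hmx C + Hmx C).
  by rewrite -ball_invmx // opprK.
have e : qf (Hmx C *m tau *m Hmx C) w = qf tau (w *m Hmx C).
  by rewrite /qf trmx_mul H_tr !mulmxA.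
by rewrite qfNm (qfDm _ _ w) e.
Qed.

(** Turns the half-integral phases p ^ 2 / 2 below into integers. *)
Definition tri (p : int) : int := (p * (p - 1) %/ 2)%Z.

Lemma triE (p : int) : (p%:~R ^+ 2 : C) = 2 * (tri p)%:~R + p%:~R.
Proof.
have h : p * (p - 1) = 2 * tri p.
  rewrite /tri [RHS]mulrC divzK //; apply/dvdzP.
  have [q [->|->]] : exists q : int, p = 2 * q \/ p = 2 * q + 1.
  - by exists (p %/ 2)%Z; lia.
  - by exists (q * (2 * q - 1)); ring.
  - by exists ((2 * q + 1) * q); ring.
have : ((p * (p - 1))%:~R : C) = (2 * tri p)%:~R by rewrite h.
rewrite !intrM rmorphB /= => h2.
by rewrite expr2 -[LHS](subrK p%:~R) -h2; ring.
Qed.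

Lemma tri_half (p : int) : ((tri p)%:~R : C) = 2^-1 * (p%:~R ^+ 2 - p%:~R).
Proof. by rewrite triE; field. Qed.

Definition omega (k : int) : C := ee (3^-1 * k%:~R).

Lemma omegaD a b : omega (a + b) = omega a * omega b.
Proof. by rewrite /omega rmorphD mulrDr eeD. Qed.

Lemma omega_mod3 a b : (3 %| a - b)%Z -> omega a = omega b.
Proof.
move=> /dvdzP [q h]; apply: (@ee_shift _ _ _ q).
by rewrite -mulrBr -rmorphB h rmorphM /=; field.
Qed.

Lemma omega_inj_mod3 a b : omega a = omega b -> (3 %| a - b)%Z.
Proof.
move=> h; have : ee ((3^-1 * (a - b)%:~R : R)%:C) = 1.
  rewrite rmorphM fmorphV rmorph_nat rmorph_int rmorphB mulrBr eeD eeN -/(omega a) -/(omega b).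
  by rewrite h mulfV // ee_neq0.
move/ee_real_eq1 => [n hn]; apply/dvdzP; exists n.
apply: (@intr_inj R); rewrite rmorphM /= -hn mulrAC mulVf ?mul1r //.
Qed.

(** The two halves of the characteristic 1/2 (1, 1) + 1/3 (- b H, b). *)
Definition char_x (b : 'rV[int]_5) : 'rV[C]_5 := const_mx 2^-1 - 3^-1 *: intC (b *m Hmx int).
Definition char_y (b : 'rV[int]_5) : 'rV[C]_5 := const_mx 2^-1 + 3^-1 *: intC b.
Definition coord_sum (b : 'rV[int]_5) : int := \sum_i b 0 i.
(** The integral vector (1 + H 1) / 2. *)
Definition plus_vec : 'rV[int]_5 := \row_i (if i == ord_max then 0 else 1).

Definition bilH (b c : 'rV[int]_5) : int := bil (b *m Hmx int) c.

Lemma bilHE b c : bilH b c = \sum_i b 0 i * Hsign int i * c 0 i.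
Proof. by rewrite /bilH bilE; apply: eq_bigr => i _; rewrite mulHE. Qed.

Lemma rvD (V : zmodType) n (x y : 'rV[V]_n) i : (x + y) 0 i = x 0 i + y 0 i.
Proof. by rewrite mxE. Qed.

Lemma rvN (V : zmodType) n (x : 'rV[V]_n) i : (- x) 0 i = - x 0 i.
Proof. by rewrite mxE. Qed.

Lemma rvZ (K : pzRingType) n a (x : 'rV[K]_n) i : (a *: x) 0 i = a * x 0 i.
Proof. by rewrite mxE. Qed.

Lemma intCE n (p : 'rV[int]_n) i : intC p 0 i = (p 0 i)%:~R.
Proof. by rewrite mxE. Qed.

Lemma char_xE b i : char_x b 0 i = 2^-1 - 3^-1 * ((b 0 i)%:~R * Hsign C i).
Proof.
by rewrite /char_x intC_mulH rvD rvN rvZ mulHE intCE mxE.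
Qed.

Lemma char_yE b i : char_y b 0 i = 2^-1 + 3^-1 * (b 0 i)%:~R.
Proof. by rewrite /char_y rvD rvZ intCE mxE. Qed.

Variable tau : 'M[C]_5.
Hypothesis bt : ball4 tau.
Let sT : siegel tau. Proof. by case: bt. Qed.

Lemma Hsign_intr i : ((Hsign int i)%:~R : C) = Hsign C i.
Proof. by rewrite /Hsign; case: ifP => _; rewrite ?rmorphN rmorph1. Qed.

Lemma flip_bij (f : 'rV[int]_5 -> C) (c : 'rV[int]_5) : absSum f ->
  csum (fun p => f (- (p *m Hmx int) - c)) = csum f.
Proof.
have K1 : cancel (fun p => - (p *m Hmx int) - c) (fun n => - ((n + c) *m Hmx int)).
  by move=> p; rewrite subrK mulNmx mulHH opprK.
have K2 : cancel (fun n => - ((n + c) *m Hmx int)) (fun p => - (p *m Hmx int) - c).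
  by move=> n; rewrite mulNmx mulHH opprK addrK.
move=> af; exact: (csum_bij K1 K2 af).
Qed.

(** Inversion maps the characteristic to itself up to an integral vector, and the
    substitution n = - p H - plus_vec matches the two series term by term.  The phase
    that remains is constant in p. *)
Lemma theta_fixed : exists kappa : C, forall b,
  theta_char (char_x b) (char_y b) tau = kappa * omega (- bilH b b) * theta_char (char_x b) (char_y b) tau.
Proof.
have [kappa hk] := theta_inversion sT; exists (kappa * ee (9 / 8)) => b.
rewrite {1}hk -(mulrA _ (omega _)) -(mulrA kappa); congr (_ * _).
have a1 := dual_summand_abs (char_x b) (char_y b) sT.
rewrite -(flip_bij plus_vec a1) [in RHS]/theta_char.
have a2 := theta_summand_abs (char_x b) (char_y b) sT.
rewrite -(csumZ _ a2) -(csumZ _ (absSumZ _ a2)).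
apply: eq_csum => p; rewrite /dual_summand /theta_summand /omega -!eeD qf_invmx_ball //.
set n := - (p *m Hmx int) - plus_vec.
have hni i : n 0 i = - (p 0 i * Hsign int i) - plus_vec 0 i.
  by rewrite /n (rvD (- _)) (rvN (_ *m _)) (rvN plus_vec) mulHE.
have hn : char_y b + intC n = - ((intC p + char_x b) *m Hmx C).
  apply/rowP => i; rewrite (rvD (char_y b)) (rvN (_ *m _)) mulHE (rvD (intC p)) char_xE char_yE !intCE.
  rewrite hni.
  rewrite mxE rmorphB rmorphN rmorphM /= Hsign_intr /Hsign; case: ifP => _ /=; by field.
have e1 : qf (Hmx C) (char_y b + intC n) = qf (Hmx C) (intC p + char_x b).
  by rewrite hn qfN /qf trmx_mul H_tr !mulmxA mulHH.
rewrite e1 hn mulNmx mulHH qfN.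
(* N is the difference of the two exponents, coordinate by coordinate; it is an
   integer because p ^ 2 and p have the same parity. *)
rewrite bilHE rmorphN rmorph_sum /=.
pose N i := if i == ord_max
  then - tri (p 0 i) - p 0 i - p 0 i - p 0 i * b 0 i - tri (b 0 i) - b 0 i
  else tri (p 0 i) + p 0 i - p 0 i * b 0 i + tri (b 0 i).
apply: (@ee_shift _ _ _ (\sum_i N i)); rewrite rmorph_sum /=.
have e98 : 9 / 8 = \sum_i 3 / 8 * Hsign C i.
  by rewrite !big_ord_recr big_ord0 /= /Hsign /=; field.
rewrite qfHE !bilE e98.
transitivity (\sum_i (2^-1 * (Hsign C i * (intC p + char_x b) 0 i ^+ 2) + - (char_x b 0 i * intC n 0 i) +
   - (3 / 8 * Hsign C i) + 3^-1 * (b 0 i * Hsign int i * b 0 i)%:~R +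
   - ((intC p + char_x b) 0 i * char_y b 0 i))).
  rewrite !big_split /= !sumrN -!mulr_sumr.
  by move: (qf tau _) (\sum_i _ * _) (\sum_i _ * _) (\sum_i _ * _) => *; field.
apply: eq_bigr => i _.
rewrite (rvD (intC p)) char_xE char_yE !intCE hni rmorphB rmorphN !intrM Hsign_intr mxE /N /Hsign.
have h1 := tri_half (p 0 i); have h2 := tri_half (b 0 i).
by case: ifP => _; rewrite !(rmorphD, rmorphN, rmorphM) /= h1 h2 ?rmorph0 ?rmorph1; field.
Qed.

End Ball.

(** * Theta series of level 3 *)

Section Mod3.
Variable R : realType.
Local Notation C := (R[i]).

Definition mod3 n (v : 'rV[int]_n) : 'rV['F_3]_n := map_mx intr v.
Definition lift3 n (c : 'rV['F_3]_n) : 'rV[int]_n := \row_i (val (c 0 i))%:Z.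

Lemma F3_val (x : 'F_3) : ((val x)%:Z)%:~R = x.
Proof. by rewrite -pmulrn natr_Zp. Qed.

Lemma lift3K n (c : 'rV['F_3]_n) : mod3 (lift3 c) = c.
Proof. by apply/rowP => i; rewrite !mxE F3_val. Qed.

Lemma F3_dvd (a : int) : (a%:~R == 0 :> 'F_3) = (3 %| a)%Z.
Proof.
by rewrite (dvdz_pcharf (pchar_Fp (isT : prime 3))).
Qed.

Lemma F3_eq (a b : int) : (a%:~R = b%:~R :> 'F_3) <-> (3 %| a - b)%Z.
Proof.
by rewrite -F3_dvd rmorphB subr_eq0; split=> /eqP.
Qed.

Lemma mod3_bil n (x y : 'rV[int]_n) : (bil x y)%:~R = bil (mod3 x) (mod3 y) :> 'F_3.
Proof. by rewrite !bilE rmorph_sum; apply: eq_bigr => i _; rewrite rmorphM !mxE. Qed.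

Lemma mod3D n (x y : 'rV[int]_n) : mod3 (x + y) = mod3 x + mod3 y.
Proof. exact: raddfD. Qed.

Lemma mod3B n (x y : 'rV[int]_n) : mod3 (x - y) = mod3 x - mod3 y.
Proof. exact: raddfB. Qed.

Lemma mod3N n (x : 'rV[int]_n) : mod3 (- x) = - mod3 x.
Proof. exact: raddfN. Qed.

Lemma mod3_mulH (x : 'rV[int]_5) : mod3 (x *m Hmx int) = mod3 x *m Hmx 'F_3.
Proof.
apply/rowP => i; rewrite mulHE [LHS]mxE mulHE [in RHS]mxE rmorphM /=; congr (_ * _).
by rewrite /Hsign; case: ifP => _; rewrite ?rmorphN rmorph1.
Qed.

Definition chi (x : 'F_3) : C := omega R (val x)%:Z.

Lemma omega_chi (a : int) : omega R a = chi a%:~R.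
Proof. by apply/omega_mod3/F3_eq; rewrite F3_val. Qed.

Lemma chiD x y : chi (x + y) = chi x * chi y.
Proof. by rewrite /chi -omegaD [RHS]omega_chi rmorphD /= !F3_val. Qed.

Lemma chi_inj : injective chi.
Proof. by move=> x y /omega_inj_mod3 /F3_eq; rewrite !F3_val. Qed.

Lemma chi0 : chi 0 = 1.
Proof. by rewrite /chi /omega mulr0 ee0. Qed.

Lemma chi_neq0 x : chi x != 0.
Proof. exact: ee_neq0. Qed.

Lemma csum_fin (T : finType) (f : T -> C) : csum f = \sum_x f x.
Proof.
pose A := [fset x | x in T]%fset.
have -> : \sum_x f x = \sum_(x <- A) f x.
  by rewrite big_imfset //= big_enum.
by apply/hasSum_csum/hasSum_finite => x; rewrite !inE.
Qed.

End Mod3.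

Section Level3.
Variable R : realType.
Local Notation C := (R[i]).
Local Notation intC := (@intC R _).
Local Notation omega := (omega R).
Local Notation chi := (@chi R).
Variable tau : 'M[C]_5.
Hypothesis bt : ball4 tau.
Let sT : siegel tau. Proof. by case: bt. Qed.
Let sT3 : siegel (3 *: tau) := siegelZ 2 sT.

Definition third_x (k : 'rV[int]_5) : 'rV[C]_5 := const_mx 2^-1 + 3^-1 *: intC k.
Definition third_y : 'rV[C]_5 := const_mx (3 / 2).
(** The theta series at 3 tau with characteristic (1/2 + k/3, 3/2).  It depends only
    on k modulo 3 and is odd in k. *)
Definition theta_third (k : 'rV[int]_5) : C := theta_char (third_x k) third_y (3 *: tau).

Lemma third_xE k i : third_x k 0 i = 2^-1 + 3^-1 * (k 0 i)%:~R.
Proof. by rewrite /third_x rvD rvZ intCE mxE. Qed.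

Lemma theta_third_mod3 k k' : mod3 k = mod3 k' -> theta_third k = theta_third k'.
Proof.
move=> h; pose j : 'rV[int]_5 := \row_i divz (k 0 i - k' 0 i) 3.
have hj i : k 0 i = k' 0 i + 3 * j 0 i.
  have := congr1 (fun v : F35 => v 0 i) h; rewrite !mxE => /F3_eq /divzK e.
  by rewrite [3 * _]mulrC e addrCA subrr addr0.
have e : third_x k = third_x k' + intC j; last by rewrite /theta_third e (theta_char_shiftX _ _ _ sT3).
apply/rowP => i; by rewrite (rvD (third_x k')) !third_xE intCE hj rmorphD rmorphM /=; field.
Qed.

Lemma ee_half : ee (2^-1 : C) = -1.
Proof.
have -> : (2^-1 : C) = (2^-1 : R)%:C by rewrite fmorphV rmorph_nat.
rewrite ee_real mulrAC divff // mul1r cospi sinpi.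
by apply/eqP; rewrite eq_complex /= oppr0 !eqxx.
Qed.

(** The characteristic (1/2, 3/2) is odd in dimension 5; the sign is e(15 / 2). *)
Lemma theta_third_opp k : theta_third (- k) = - theta_third k.
Proof.
rewrite {2}/theta_third -(theta_char_opp (third_x k) third_y sT3).
have -> : - third_x k = third_x (- k) + intC (const_mx (-1)).
  by apply/rowP => i; rewrite (rvN (third_x k)) (rvD (third_x (- k))) !third_xE intCE rvN mxE !rmorphN /=; field.
have -> : - third_y = third_y + intC (const_mx (-3)).
  by apply/rowP => i; rewrite rvN rvD intCE !mxE rmorphN /=; field.
rewrite (theta_char_shiftX _ _ _ sT3) (theta_char_shiftY _ _ _ sT3) -/(theta_third _).
have -> : bil (third_x (- k)) (intC (const_mx (-3))) = 2^-1 + (coord_sum k - 8)%:~R.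
  rewrite bilE rmorphB rmorph_sum /=.
  transitivity (\sum_i (- (3 / 2) + (k 0 i)%:~R : C)).
    by apply: eq_bigr => i _; rewrite third_xE intCE rvN mxE !rmorphN /=; field.
  by rewrite big_split /= sumr_const card_ord -mulr_natr; field.
by rewrite eeD ee_int ee_half mulr1 mulN1r opprK.
Qed.

(** Z^5 is the disjoint union of the cosets 3 Z^5 + l, with l running over the lifts
    of F_3^5. *)
Definition glue (x : 'rV[int]_5 * F35) : 'rV[int]_5 := 3 *: x.1 + lift3 x.2.
Definition unglue (M : 'rV[int]_5) : 'rV[int]_5 * F35 :=
  (\row_i divz ((M - lift3 (mod3 M)) 0 i) 3, mod3 M).

Lemma mod3_glue x : mod3 (glue x) = x.2.
Proof.
rewrite /glue mod3D lift3K (_ : mod3 _ = 0) ?add0r //; apply/rowP => i.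
by rewrite !mxE rmorphM /=; apply/eqP; rewrite mulf_eq0.
Qed.

Lemma glueK : cancel glue unglue.
Proof.
move=> x; rewrite /unglue mod3_glue /glue addrK; case: x => p c /=; congr (_, _).
by apply/rowP => i; rewrite !mxE mulKz.
Qed.

Lemma unglueK : cancel unglue glue.
Proof.
move=> M; rewrite /glue /unglue /=; apply/rowP => i.
rewrite rvD rvZ mxE mulrC divzK; first by rewrite rvD rvN subrK.
by rewrite -F3_dvd rvD rvN rmorphB subr_eq0 /= mxE F3_val mxE.
Qed.

(** Since - (3 tau)^-1 = (H tau H + H) / 3, the quadratic form of the dual series is a
    third of tau instead of three times tau; collecting its terms by their class
    modulo 3 yields theta series at 3 tau again.  The substitution n = - M H - 3 plus_vec fixes the signs so that the
    kernel is omega ^ (- l H l + k H l). *)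
Lemma theta_third_dual : exists kappa : C, forall k,
  theta_third k = kappa * \sum_(c : F35) omega (- bilH (lift3 c) (lift3 c) + bilH k (lift3 c)) * theta_third (lift3 c).
Proof.
have [kappa hk] := theta_inversion sT3; exists (kappa * ee (27 / 8)) => k.
rewrite {1}/theta_third hk -(mulrA kappa); congr (_ * _).
have a1 := dual_summand_abs (third_x k) third_y sT3.
have a1' : absSum (fun M => dual_summand (third_x k) third_y (3 *: tau) (- (M *m Hmx int) - 3 *: plus_vec)).
  apply: (absSum_inj (h := fun M => - (M *m Hmx int) - 3 *: plus_vec)) a1 => p q.
  by move/addIr/oppr_inj/(congr1 (fun v => v *m Hmx int)); rewrite !mulHH.
rewrite -(flip_bij (3 *: plus_vec) a1) -(csum_bij glueK unglueK a1').
have a2 := absSum_inj (can_inj glueK) a1'.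
rewrite (csum_pair_swap a2) csum_fin mulr_sumr; apply: eq_bigr => c _.
have a3 : absSum (theta_summand (third_x (lift3 c)) third_y (3 *: tau)) := theta_summand_abs _ _ sT3.
rewrite /theta_third /theta_char mulrA -(csumZ _ a3); apply: eq_csum => p.
rewrite /comp; set M := glue (p, c).
have -> : omega (- bilH (lift3 c) (lift3 c) + bilH k (lift3 c)) = omega (- bilH M M + bilH k M).
  apply/omega_mod3/F3_eq; rewrite !rmorphD !rmorphN /= /bilH !mod3_bil !mod3_mulH lift3K.
  by rewrite mod3_glue.
have hM i : (M 0 i)%:~R = 3 * (p 0 i)%:~R + (lift3 c 0 i)%:~R :> C.
  by rewrite /M /glue rvD rvZ rmorphD rmorphM.
clearbody M.
rewrite /dual_summand /theta_summand /omega -!eeD; set n := - (M *m Hmx int) - 3 *: plus_vec.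
set v := intC p + third_x (lift3 c).
have hv i : 3 * v 0 i = (M 0 i)%:~R + 3 / 2.
  by rewrite /v rvD third_xE intCE hM; field.
have hni i : n 0 i = - (M 0 i * Hsign int i) - 3 * plus_vec 0 i.
  by rewrite /n rvD !rvN rvZ mulHE.
have hn : third_y + intC n = - ((3 *: v) *m Hmx C).
  apply/rowP => i; rewrite rvD rvN mulHE rvZ hv intCE hni mxE rmorphB rmorphN !rmorphM /= Hsign_intr [plus_vec _ _]mxE /Hsign.
  by case: ifP => _ /=; field.
have Tu := siegel_unit sT3.
have -> : invmx (3 *: tau) = 3^-1 *: invmx tau by rewrite invmxZ.
rewrite hn qfN qfZm (qf_invmx_ball _ bt) mulHH qfZ.
have -> : qf (Hmx C) (3 *: v *m Hmx C) = \sum_i Hsign C i * ((M 0 i)%:~R + 3 / 2) ^+ 2.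
  by rewrite qfHE; apply: eq_bigr => i _; rewrite mulHE rvZ hv exprMn (expr2 (Hsign C i)) Hsign_sqr mulr1.
rewrite qfZm !bilHE rmorphD rmorphN !rmorph_sum /= !bilE.
(* M ^ 2 / 6 is congruent to M / 2 - M ^ 2 / 3 modulo 1. *)
pose N i := if i == ord_max then - tri (M 0 i) - M 0 i - M 0 i
  else tri (M 0 i) + M 0 i + k 0 i.
apply: (@ee_shift _ _ _ (\sum_i N i)); rewrite rmorph_sum /=.
have e98 : 27 / 8 = \sum_i 9 / 8 * Hsign C i.
  by rewrite !big_ord_recr big_ord0 /= /Hsign /=; field.
rewrite e98.
transitivity (\sum_i (6^-1 * (Hsign C i * ((M 0 i)%:~R + 3 / 2) ^+ 2) + - (third_x k 0 i * intC n 0 i) +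
   - (9 / 8 * Hsign C i) + 3^-1 * (M 0 i * Hsign int i * M 0 i)%:~R +
   - (3^-1 * (k 0 i * Hsign int i * M 0 i)%:~R) + - (v 0 i * third_y 0 i))).
  rewrite !big_split /= !sumrN -!mulr_sumr.
  by move: (qf tau _) (\sum_i _ * _) (\sum_i _ * _) (\sum_i _ * _) => *; field.
apply: eq_bigr => i _.
have -> : v 0 i = 3^-1 * ((M 0 i)%:~R + 3 / 2) by rewrite -hv mulKf.
rewrite third_xE intCE hni rmorphB rmorphN !intrM Hsign_intr [plus_vec _ _]mxE [third_y 0 i]mxE /N /Hsign.
have h1 := tri_half R (M 0 i).
by case: ifP => _; rewrite !(rmorphD, rmorphN, rmorphM) /= h1 ?rmorph0 ?rmorph1; field.
Qed.

End Level3.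

(** * The cubes of the theta series on F_3^5 *)

Section Level3b.
Variable R : realType.
Local Notation C := (R[i]).
Local Notation intC := (@intC R _).
Local Notation omega := (omega R).
Local Notation chi := (@chi R).
Variable tau : 'M[C]_5.
Hypothesis bt : ball4 tau.
Let sT : siegel tau. Proof. by case: bt. Qed.
Let sT3 : siegel (3 *: tau) := siegelZ 2 sT.
Local Notation H := (Hmx 'F_3).

Definition third_at (c : F35) : C := theta_third tau (lift3 c).

Lemma theta_third_at k : theta_third tau k = third_at (mod3 k).
Proof. by apply: (theta_third_mod3 bt); rewrite lift3K. Qed.

Lemma third_at_opp c : third_at (- c) = - third_at c.
Proof. by rewrite -{1}(lift3K c) -mod3N -theta_third_at (theta_third_opp bt). Qed.

Definition cube_term (b : F35) (d : 'rV[int]_5 * 'rV[int]_5) : C :=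
  A2_factor tau d * (chi (bil (mod3 (d.1 + d.2) - b *m H) b) * third_at (mod3 (d.1 + d.2) - b *m H)).

(** The cube of the theta series with characteristic m(b), as a function of b modulo 3. *)
Definition cube_sum (b : F35) : C := csum (cube_term b).

(** The second half of the characteristic enters theta_char_cube as 3/2 + b; moving
    it to 3/2 costs the phase e((1/2 + k/3) b) with k = d1 + d2 - b H, which is
    omega ^ (k b) when the coordinates of b have even sum. *)
Lemma theta_cubeE (b : 'rV[int]_5) : (2 %| coord_sum b)%Z ->
  absSum (cube_term (mod3 b)) /\ theta_char (char_x R b) (char_y R b) tau ^+ 3 = cube_sum (mod3 b).
Proof.
move=> /dvdzP [s hs2]; have [ab eb] := theta_char_cube (char_x R b) (char_y R b) sT.
suff e : (fun d => A2_factor tau d *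
    theta_char (char_x R b + 3^-1 *: intC (d.1 + d.2)) (3 *: char_y R b) (3 *: tau)) = cube_term (mod3 b).
  by rewrite -e; split=> //; rewrite eb /cube_sum -e.
apply/funext => d; rewrite /cube_term; congr (_ * _).
set k := d.1 + d.2 - b *m Hmx int.
have -> : mod3 (d.1 + d.2) - mod3 b *m H = mod3 k by rewrite /k mod3B mod3_mulH.
have -> : char_x R b + 3^-1 *: intC (d.1 + d.2) = third_x R k.
  by rewrite /char_x /third_x /k (intCD R (d.1 + d.2)) intCN scalerDr scalerN -addrA [- _ + _]addrC.
have -> : 3 *: char_y R b = third_y R + intC b.
  by apply/rowP => i; rewrite rvZ char_yE rvD intCE mxE; field.
rewrite (theta_char_shiftY _ _ _ sT3) -/(theta_third tau k) theta_third_at -mod3_bil -omega_chi; congr (_ * _).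
apply: (@ee_shift _ _ _ s); rewrite !bilE rmorph_sum /= mulr_sumr -sumrB.
have -> : s%:~R = 2^-1 * \sum_i (b 0 i)%:~R :> C.
  by rewrite -rmorph_sum -/(coord_sum b) hs2 rmorphM /=; field.
rewrite mulr_sumr; apply: eq_bigr => i _; rewrite third_xE intCE rmorphM /=; by field.
Qed.

(** Four times a lift is again a lift modulo 3, and the sum of its coordinates is
    even. *)
Definition even_lift (b : F35) : 'rV[int]_5 := 4 *: lift3 b.

Lemma mod3_even_lift b : mod3 (even_lift b) = b.
Proof.
apply/rowP => i; rewrite [LHS]mxE rvZ rmorphM /=.
have -> : (lift3 b 0 i)%:~R = b 0 i by rewrite mxE F3_val.
by rewrite (_ : 4%:~R = 1) ?mul1r //; apply/eqP.
Qed.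

Lemma coord_sum_even_lift b : (2 %| coord_sum (even_lift b))%Z.
Proof.
apply/dvdzP; exists (2 * coord_sum (lift3 b)); rewrite /coord_sum mulr_sumr mulr_suml.
by apply: eq_bigr => i _; rewrite rvZ; ring.
Qed.

Lemma cube_term_abs b : absSum (cube_term b).
Proof. by have [h _] := theta_cubeE (coord_sum_even_lift b); rewrite mod3_even_lift in h. Qed.

(** By theta_fixed two classes with nonzero theta series have the same phase. *)
Lemma cube_sum_support : exists c0 : 'F_3, forall b, cube_sum b != 0 -> bil (b *m H) b = c0.
Proof.
have [kappa hk] := theta_fixed bt.
have key b : cube_sum b != 0 -> kappa * chi (- bil (b *m H) b) = 1.
  have [_ e] := theta_cubeE (coord_sum_even_lift b); rewrite mod3_even_lift in e.
  rewrite -e expf_eq0 => t0.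
  have := hk (even_lift b); rewrite omega_chi rmorphN /= /bilH mod3_bil mod3_mulH mod3_even_lift.
  by move=> h; apply: (mulIf t0); rewrite mul1r -h.
have [[b0 h0]|no] := pselect (exists b, cube_sum b != 0); last first.
  by exists 0 => b hb; case: no; exists b.
exists (bil (b0 *m H) b0) => b /key kb.
have k0 : kappa != 0.
  by apply/eqP => k0; move: kb; rewrite k0 mul0r => /eqP; rewrite eq_sym oner_eq0.
apply: oppr_inj; apply: (@chi_inj R); apply: (mulfI k0).
exact: etrans kb (esym (key _ h0)).
Qed.

Lemma cube_sum_opp b : cube_sum (- b) = - cube_sum b.
Proof.
pose V := 'rV[int]_5; pose op (d : V * V) : V * V := (- d.1, - d.2).
have K : cancel op op by case=> x y; rewrite /op /= !opprK.
rewrite /cube_sum; transitivity (csum (fun d => (-1) * cube_term b d)); last first.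
  by rewrite csumZ ?mulN1r //; exact: cube_term_abs.
etransitivity; first by symmetry; exact: (csum_bij K K (cube_term_abs (- b))).
apply: eq_csum => d; rewrite /comp /op /cube_term /=.
have -> : A2_factor tau (- d.1, - d.2) = A2_factor tau d.
  by rewrite /A2_factor /= -opprD !intCN !qfN.
have -> : mod3 (- d.1 - d.2) - - b *m H = - (mod3 (d.1 + d.2) - b *m H).
  by rewrite -opprD mod3N mulNmx opprB opprK addrC.
by rewrite third_at_opp bilNl bilNr opprK; ring.
Qed.

Lemma bilHH (x y : F35) : bil (x *m H) (y *m H) = bil x y.
Proof. by rewrite /bil trmx_mul H_tr mulmxA -(mulmxA x) HH mulmx1. Qed.

Lemma bil_selfadj (x y : F35) : bil x (y *m H) = bil (x *m H) y.
Proof. by rewrite /bil trmx_mul H_tr mulmxA. Qed.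

(** Apply theta_third_dual inside the sum over d.  For fixed d the summation over l
    becomes a summation over c by l = d1 + d2 - c H, and the exponents that depend on
    d combine exactly to those of cube_term c d. *)
Lemma cube_sum_relation : exists kappa : C, forall b,
  cube_sum b = kappa * chi (- bil (b *m H) b) * \sum_c chi (bil (b *m H) c) * cube_sum c.
Proof.
have [kappa hk] := theta_third_dual bt; exists kappa => b.
have hg x : third_at x = kappa * \sum_(c : F35) chi (- bil (c *m H) c + bil (x *m H) c) * third_at c.
  rewrite /third_at hk; congr (_ * _); apply: eq_bigr => c _; rewrite omega_chi.
  by rewrite rmorphD rmorphN /= /bilH !mod3_bil !mod3_mulH !lift3K.
rewrite mulr_sumr; symmetry.
transitivity (csum (fun d => \sum_(c : F35)
    kappa * chi (- bil (b *m H) b) * chi (bil (b *m H) c) * cube_term c d)); first symmetry.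
  apply: hasSum_csum; rewrite [X in hasSum _ X](_ : _ = \sum_(c : F35)
    kappa * chi (- bil (b *m H) b) * chi (bil (b *m H) c) * cube_sum c); last first.
    by apply: eq_bigr => c _; rewrite mulrA.
  apply: (hasSum_sum (index_enum F35)) => c; apply: hasSumZ; apply: csumP; exact: cube_term_abs.
apply: eq_csum => d; rewrite /cube_term; set e := mod3 _; set x := e - b *m H.
rewrite hg; set A := A2_factor _ _.
transitivity (\sum_c A * (chi (bil x b) * (kappa * (chi (- bil (c *m H) c + bil (x *m H) c) * third_at c)))); last first.
  by rewrite !mulr_sumr.
have inv : injective (fun c : F35 => e - c *m H).
  by move=> u v /addrI/oppr_inj/(congr1 (fun z => z *m H)); rewrite !mulHH.
rewrite [RHS](reindex_inj inv) /=; apply: eq_bigr => c _; set l := e - c *m H.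
have -> : kappa * chi (- bil (b *m H) b) * chi (bil (b *m H) c) * (A * (chi (bil l c) * third_at l)) =
  A * kappa * third_at l * (chi (- bil (b *m H) b) * chi (bil (b *m H) c) * chi (bil l c)).
  by move: (chi _) (chi _) (chi _) (third_at l) => x1 x2 x3 x4; ring.
have -> : A * (chi (bil x b) * (kappa * (chi (- bil (l *m H) l + bil (x *m H) l) * third_at l))) =
  A * kappa * third_at l * (chi (bil x b) * chi (- bil (l *m H) l + bil (x *m H) l)).
  by move: (chi _) (chi _) (third_at l) => x1 x2 x3; ring.
congr (_ * _); rewrite -!chiD; congr chi; rewrite /x /l !mulmxBl !mulHH.
rewrite !(bilDl, bilDr, bilNl, bilNr, bilHH, bil_selfadj) ?mulHH.
rewrite [bil c e]bilC [bil b e]bilC.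
move: (bil (b *m H) b) (bil (b *m H) c) (bil e c) (bil (c *m H) c) (bil e b) (bil (e *m H) e) => *.
by ring.
Qed.

End Level3b.

(** * The vectors r_1, ..., r_5 modulo 3 *)

Section Transfer.
Definition beta_mod3 (v : F35) : F35 := v *m (map_mx intr rmx)^T.

Lemma beta_tildeE vt : beta_tilde vt = vt *m rmx^T.
Proof.
apply/rowP => i; rewrite !mxE /dot; apply: eq_bigr => j _.
by rewrite !mxE mulrC.
Qed.

Lemma mod3_beta vt : mod3 (beta_tilde vt) = beta_mod3 (mod3 vt).
Proof. by rewrite beta_tildeE /mod3 map_mxM -map_trmx. Qed.

Lemma sum5 (V : nmodType) (f : 'I_5 -> V) :
  \sum_i f i = f (inord 0) + f (inord 1) + f (inord 2) + f (inord 3) + f (inord 4).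
Proof.
by rewrite !big_ord_recr big_ord0 /= add0r; do !congr (_ + _); congr f; apply/val_inj; rewrite /= inordK.
Qed.

(** The sum r_1 + ... + r_5 = (2, 2, 0, 0, -2) is even. *)
Lemma coord_sum_beta vt : (2 %| coord_sum (beta_tilde vt))%Z.
Proof.
apply/dvdzP; exists (vt 0 (inord 0) + vt 0 (inord 1) - vt 0 (inord 4)).
by rewrite /coord_sum sum5 !mxE /dot !sum5 !mxE !inordK //=; ring.
Qed.

Lemma beta_mod3E v i : beta_mod3 v 0 i = \sum_j v 0 j * (rmx i j)%:~R.
Proof. by rewrite /beta_mod3 mxE; apply: eq_bigr => j _; rewrite !mxE. Qed.

Lemma beta_mod3_coords (v : F35) : let x (k : nat) : 'F_3 := v 0 (inord k) in
  [/\ beta_mod3 v 0 (inord 0) = x 0%N + x 1%N + x 2%N + x 3%N + x 4%N,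
      beta_mod3 v 0 (inord 1) = x 0%N - x 1%N - x 2%N - x 3%N - x 4%N,
      beta_mod3 v 0 (inord 2) = x 1%N - x 2%N,
      beta_mod3 v 0 (inord 3) = x 3%N - x 4%N
    & beta_mod3 v 0 (inord 4) = x 1%N + x 2%N - x 3%N - x 4%N].
Proof.
by move=> x; rewrite !beta_mod3E !sum5 !mxE !inordK //= -!/(x _); split; rewrite ?mulr0z ?mulr1z ?mulrN1z; ring.
Qed.

Lemma Hsign5 (K : pzRingType) : [/\ Hsign K (inord 0) = 1, Hsign K (inord 1) = 1, Hsign K (inord 2) = 1,
  Hsign K (inord 3) = 1 & Hsign K (inord 4) = -1].
Proof. by split; rewrite /Hsign -val_eqE /= inordK. Qed.

(** The rows r_i are orthogonal, with norms - H modulo 3, so r r^T = - H; hence also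
    r^T H r = - 1 modulo 3. *)
Lemma beta_mod3_form v u : bil (beta_mod3 v *m Hmx 'F_3) (beta_mod3 u) = - bil v u.
Proof.
rewrite !bilE !sum5 !mulHE.
have [-> -> -> -> ->] := Hsign5 'F_3.
have [-> -> -> -> ->] := beta_mod3_coords v; have [-> -> -> -> ->] := beta_mod3_coords u.
move: (v 0 (inord 0)) (v 0 (inord 1)) (v 0 (inord 2)) (v 0 (inord 3)) (v 0 (inord 4)).
move: (u 0 (inord 0)) (u 0 (inord 1)) (u 0 (inord 2)) (u 0 (inord 3)) (u 0 (inord 4)).
move=> u0 u1 u2 u3 u4 v0 v1 v2 v3 v4.
have three : 3 = 0 :> 'F_3 by apply/eqP.
transitivity (- (v0 * u0 + v1 * u1 + v2 * u2 + v3 * u3 + v4 * u4) + 3 *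
  ((v0 * u0 + v1 * u1 + v2 * u2 + v3 * u3 + v4 * u4) + (v1 + v2) * (u3 + u4) + (v3 + v4) * (u1 + u2)));
  last by rewrite three mul0r addr0.
by ring.
Qed.

End Transfer.

(** * Isotropic vectors orthogonal to a plane *)

Section Codes.

(** A copy of F_3 on which the operations evaluate quickly. *)
Definition trit := option bool.
Definition tval (a : trit) : 'F_3 := match a with None => 0 | Some true => 1 | Some false => -1 end.
Definition tadd (a b : trit) : trit := match a, b with
  | None, _ => b | _, None => a
  | Some true, Some true => Some false | Some false, Some false => Some true
  | _, _ => None end.
Definition tmul (a b : trit) : trit := match a, b with
  | Some x, Some y => Some (x == y) | _, _ => None end.
Definition topp (a : trit) : trit := if a is Some x then Some (~~ x) else None.

Lemma tvalD a b : tval (tadd a b) = tval a + tval b.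
Proof. by case: a b => [[]|] [[]|]; apply/eqP. Qed.

Lemma tvalM a b : tval (tmul a b) = tval a * tval b.
Proof. by case: a b => [[]|] [[]|]; apply/eqP. Qed.

Lemma tvalN a : tval (topp a) = - tval a.
Proof. by case: a => [[]|]; apply/eqP. Qed.

Lemma tval_inj : injective tval.
Proof. by move=> [[]|] [[]|] // /eqP. Qed.

Definition trit_of (x : 'F_3) : trit := nth None [:: None; Some true; Some false] (val x).

Lemma trit_ofK : cancel trit_of tval.
Proof. by case=> [[|[|[|n]]]] // h; apply/eqP. Qed.

Definition code := (trit * trit * trit * trit * trit)%type.

Definition code_val (c : code) : F35 := let: (c0, c1, c2, c3, c4) := c in
  \row_i nth 0 [:: tval c0; tval c1; tval c2; tval c3; tval c4] i.

Definition code_of (v : F35) : code :=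
  let x k := trit_of (v 0 (inord k)) in (x 0, x 1, x 2, x 3, x 4)%N.

Lemma code_ofK : cancel code_of code_val.
Proof.
move=> v; apply/rowP => i; rewrite mxE !trit_ofK.
by case: i => [[|[|[|[|[|n]]]]]] h //=; congr (v 0 _); apply/val_inj; rewrite /= inordK.
Qed.

Lemma code_val_inj : injective code_val.
Proof.
move=> [[[[a0 a1] a2] a3] a4] [[[[b0 b1] b2] b3] b4] h.
have e k : (k < 5)%N -> code_val (a0, a1, a2, a3, a4) 0 (inord k) = code_val (b0, b1, b2, b3, b4) 0 (inord k).
  by rewrite h.
have := e 0%N isT; have := e 1%N isT; have := e 2%N isT; have := e 3%N isT; have := e 4%N isT.
by rewrite !mxE !inordK //= => /tval_inj -> /tval_inj -> /tval_inj -> /tval_inj -> /tval_inj ->.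
Qed.

Definition cdot (c d : code) : trit :=
  let: (c0, c1, c2, c3, c4) := c in let: (d0, d1, d2, d3, d4) := d in
  tadd (tadd (tadd (tadd (tmul c0 d0) (tmul c1 d1)) (tmul c2 d2)) (tmul c3 d3)) (tmul c4 d4).

Lemma cdotE c d : tval (cdot c d) = dot (code_val c) (code_val d).
Proof.
case: c d => [[[[c0 c1] c2] c3] c4] [[[[d0 d1] d2] d3] d4].
by rewrite /dot sum5 !mxE !inordK //= !tvalD !tvalM.
Qed.

Definition copp (c : code) : code :=
  let: (c0, c1, c2, c3, c4) := c in (topp c0, topp c1, topp c2, topp c3, topp c4).

Lemma coppE c : code_val (copp c) = - code_val c.
Proof.
case: c => [[[[c0 c1] c2] c3] c4]; apply/rowP => i; rewrite !mxE !tvalN.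
by case: i => [[|[|[|[|[|n]]]]]].
Qed.

Definition trits : seq trit := [:: None; Some true; Some false].
Definition codes : seq code :=
  [seq (x, a) | x <- [seq (x, a) | x <- [seq (x, a) | x <- [seq (x, a) | x <- trits, a <- trits],
     a <- trits], a <- trits], a <- trits].

Lemma mem_codes c : c \in codes.
Proof.
have mt (a : trit) : a \in trits by case: a => [[]|].
by case: c => [[[[c0 c1] c2] c3] c4]; do !apply: allpairs_f => //.
Qed.

Lemma codes_uniq : uniq codes.
Proof. by vm_compute. Qed.

Lemma dotE (v u : F35) : dot v u = bil v u.
Proof. by rewrite /dot bilE. Qed.

(** If I~ contains v0 then I~ is this set: the products of its elements with v0 are
    -1, and v or - v lies in I~ for every isotropic v orthogonal to a and b. *)
Definition star (a b v0 : F35) : {set F35} :=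
  [set v | [&& v != 0, dot v v == 0, dot v a == 0, dot v b == 0 &
     (v == v0) || (dot v v0 == -1)]].

(** The odd part of Sum_(v in Y) omega ^ (v.u) is proportional to the difference of
    these two counts.  In the orthogonal complement of a plane as above there are
    four isotropic lines; for u = v in Y the other three vectors have product -1 with
    u, and for isotropic u outside Y and - Y the products +1 and -1 balance. *)
Definition balanced (Y : {set F35}) (u : F35) : bool :=
  let n (k : 'F_3) := #|[set v in Y | dot v u == k]| in
  if u \in Y then (n 1%R == 0)%N && (n (-1)%R == 3)%N
  else if - u \in Y then (n 1%R == 3)%N && (n (-1)%R == 0)%N else n 1%R == n (-1)%R.

Definition ce0 : code := (Some true, None, None, None, None).
Definition ce1 : code := (None, Some true, None, None, None).
Definition cnull (v : code) := cdot v v == None.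

Definition cstar (v0 : code) : seq code :=
  [seq v <- codes | [&& v != (None, None, None, None, None), cnull v,
     cdot v ce0 == None, cdot v ce1 == None & (v == v0) || (cdot v v0 == Some false)]].

Definition cbalanced (Y : seq code) (u : code) : bool :=
  let n k := count (fun v => cdot v u == k) Y in
  if u \in Y then (n (Some true) == 0)%N && (n (Some false) == 3)%N
  else if copp u \in Y then (n (Some true) == 3)%N && (n (Some false) == 0)%N
  else n (Some true) == n (Some false).

Definition cbalanced_all : bool :=
  let N := [seq u <- codes | cnull u] in
  all (fun v0 => all (cbalanced (cstar v0)) N)
    [seq v <- N | [&& v != (None, None, None, None, None), cdot v ce0 == None & cdot v ce1 == None]].

(** Once the plane is spanned by two coordinate vectors, only eight vectors v0 and
    eighty-one isotropic vectors u remain, and these are enumerated. *)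
Lemma cbalanced_allT : cbalanced_all.
Proof. by vm_compute. Qed.

Lemma tval_eq0 a : (tval a == 0) = (a == None).
Proof. by rewrite -(inj_eq tval_inj). Qed.

Lemma tval_eqN1 a : (tval a == -1) = (a == Some false).
Proof. by rewrite -(inj_eq tval_inj). Qed.

Lemma code_val_eq0 v : (code_val v == 0) = (v == (None, None, None, None, None)).
Proof.
rewrite -(inj_eq code_val_inj); congr (_ == _); apply/esym/rowP => i; rewrite !mxE.
by case: i => [[|[|[|[|[|n]]]]]].
Qed.

Lemma mem_cstar v v0 : (v \in cstar v0) =
  (code_val v \in star (code_val ce0) (code_val ce1) (code_val v0)).
Proof.
rewrite mem_filter mem_codes andbT inE -!cdotE !tval_eq0 tval_eqN1 code_val_eq0.
by rewrite (inj_eq code_val_inj).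
Qed.

Lemma card_cstar v0 u k :
  #|[set v in star (code_val ce0) (code_val ce1) (code_val v0) | dot v (code_val u) == tval k]| =
  count (fun v => cdot v u == k) (cstar v0).
Proof.
rewrite -size_filter -(size_map code_val) -(card_uniqP _); last first.
  by rewrite (map_inj_uniq code_val_inj) filter_uniq // filter_uniq // codes_uniq.
apply: eq_card => v; rewrite inE; apply/andP/mapP => [[vs vu]|[c]].
  exists (code_of v); last by rewrite code_ofK.
  by rewrite mem_filter mem_cstar code_ofK vs andbT -(inj_eq tval_inj) cdotE code_ofK.
by rewrite mem_filter mem_cstar => /andP[/eqP e cs] ->; rewrite cs -cdotE e.
Qed.

Lemma balanced_std v0 u : v0 \in star (code_val ce0) (code_val ce1) v0 -> dot u u = 0 ->
  balanced (star (code_val ce0) (code_val ce1) v0) u.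
Proof.
rewrite -(code_ofK v0) -(code_ofK u) -mem_cstar -cdotE.
set cv := code_of v0; set cu := code_of u => vs /eqP; rewrite tval_eq0 => uu.
have := cbalanced_allT => /allP /(_ cv).
rewrite !mem_filter !mem_codes !andbT.
move: vs; rewrite mem_filter => /andP[/and5P[-> -> -> -> _] _] /(_ isT).
move=> /allP /(_ cu); rewrite mem_filter /cnull uu mem_codes => /(_ isT).
by rewrite /cbalanced /balanced -!card_cstar !mem_cstar coppE.
Qed.

End Codes.

Section Isometry.

Definition isometry (g : F35 -> F35) := forall x y, dot (g x) (g y) = dot x y.

Lemma dot_nondeg (x : F35) : (forall z, dot x z = 0) -> x = 0.
Proof.
move=> h; apply/rowP => i; rewrite mxE -(h (delta_mx 0 i)) /dot (bigD1 i) //=.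
rewrite mxE !eqxx mulr1 big1 ?addr0 // => j ji.
by rewrite mxE (negbTE ji) andbF mulr0.
Qed.

Lemma isometry_inj g : isometry g -> injective g.
Proof.
move=> gi x y e; apply/eqP; rewrite -subr_eq0; apply/eqP/dot_nondeg => z.
by rewrite dotE bilDl bilNl -!dotE -(gi x) -(gi y) e subrr.
Qed.

Lemma isometry_surj g : isometry g -> forall y, exists x, g x = y.
Proof.
move=> /isometry_inj gi y; have [h _ hK] := injF_bij gi.
by exists (h y); rewrite hK.
Qed.

(** By nondegeneracy the products with the image of an isometry determine a vector;
    compatibility with opposites and with 0 follows from this. *)
Lemma isometry_ext g x y : isometry g -> (forall z, dot y (g z) = dot x z) -> y = g x.
Proof.
move=> gi h; apply/eqP; rewrite -subr_eq0; apply/eqP/dot_nondeg => z.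
have [z' <-] := isometry_surj gi z.
by rewrite dotE bilDl bilNl -!dotE h gi subrr.
Qed.

Lemma isometryN g x : isometry g -> g (- x) = - g x.
Proof.
move=> gi; symmetry; apply: isometry_ext => // z.
by rewrite !dotE !bilNl -!dotE gi.
Qed.

Lemma isometry0 g : isometry g -> g 0 = 0.
Proof.
move=> gi; symmetry; apply: isometry_ext => // z.
by rewrite !dotE ![bil 0 _]bilC !bil0r.
Qed.

Lemma star_isometry g a b v0 : isometry g -> star (g a) (g b) (g v0) = g @: star a b v0.
Proof.
move=> gi; have ginj := isometry_inj gi; apply/setP => y; have [x <-] := isometry_surj gi y.
by rewrite (mem_imset _ _ ginj) !inE !gi (inj_eq ginj) -{1}(isometry0 gi) (inj_eq ginj).
Qed.

Lemma balanced_isometry g (Y : {set F35}) u : isometry g -> balanced (g @: Y) (g u) = balanced Y u.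
Proof.
move=> gi; have ginj := isometry_inj gi.
have n k : #|[set v in g @: Y | dot v (g u) == k]| = #|[set v in Y | dot v u == k]|.
  rewrite -[RHS](card_imset _ ginj); apply: eq_card => y; have [x <-] := isometry_surj gi y.
  by rewrite (mem_imset _ _ ginj) !inE gi (mem_imset _ _ ginj).
by rewrite /balanced !n -(isometryN _ gi) !(mem_imset _ _ ginj).
Qed.

Lemma three0 : 3 = 0 :> 'F_3. Proof. exact/eqP. Qed.

Lemma F3_cube (x : 'F_3) : x * x * x = x.
Proof. by case: x => [[|[|[|n]]]] // h; apply/eqP. Qed.

(** Over F_3 the usual coefficient - 2 / q(n) equals q(n), and for isotropic n the
    formula still gives an isometry, the identity. *)
Definition reflection (n x : F35) : F35 := x + (dot n n * dot x n) *: n.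

Lemma reflection_isometry n : isometry (reflection n).
Proof.
move=> x y; rewrite /reflection !dotE !bilDl !bilDr !bilZl !bilZr [bil n y]bilC.
set q := bil n n; set a := bil x n; set b := bil y n.
transitivity (bil x y + (2 * q + q * q * q) * a * b); first by ring.
rewrite F3_cube; have -> : 2 * q + q = 3 * q by ring.
by rewrite three0 !mul0r addr0.
Qed.

Lemma opp_isometry : isometry (fun x => - x).
Proof. by move=> x y; rewrite !dotE bilNl bilNr opprK. Qed.

(** Either a - e is anisotropic and the reflection in it maps a to e, or a + e is, and
    the reflection in it maps a to - e.  Vectors orthogonal to a and e are fixed up
    to a common sign, which allows a second vector to be moved afterwards. *)
Lemma unit_transitive (a e : F35) : dot a a = 1 -> dot e e = 1 ->
  exists2 g, isometry g & (g a = e) /\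
    forall f, dot f a = 0 -> dot f e = 0 -> g f = f \/ g f = - f.
Proof.
move=> aa ee1.
have fixes n f : dot f n = 0 -> reflection n f = f.
  by move=> h; rewrite /reflection h mulr0 scale0r addr0.
have [ae|ae] := eqVneq (dot a e) 1.
  exists (fun x => - reflection (a + e) x).
    by move=> x y; rewrite opp_isometry reflection_isometry.
  split; last first.
    by move=> f fa fe; right; rewrite fixes // dotE bilDr -!dotE fa fe addr0.
  rewrite /reflection !dotE !bilDl !bilDr [bil e a]bilC -!dotE aa ee1 ae.
  rewrite (_ : _ * _ = -1); last by apply/eqP.
  by rewrite scaleN1r opprD opprK addrA addNr add0r.
exists (reflection (a - e)); first exact: reflection_isometry.
split; last first.
  by move=> f fa fe; left; rewrite fixes // dotE bilDr bilNr -!dotE fa fe subrr.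
rewrite /reflection !dotE !bilDl !bilDr !bilNl !bilNr [bil e a]bilC -!dotE aa ee1.
rewrite (_ : _ * _ = -1); first by rewrite scaleN1r opprB addrCA subrr addr0.
by move: (dot a e) ae => x; case: x => [[|[|[|n]]]] // h _; apply/eqP.
Qed.

(** Two isometries move an orthonormal pair to a pair of coordinate vectors, up to
    signs that do not change the orthogonal complement. *)
Lemma balanced_unit a b v0 u : dot a a = 1 -> dot b b = 1 -> dot a b = 0 ->
  v0 \in star a b v0 -> dot u u = 0 -> balanced (star a b v0) u.
Proof.
move=> aa bb ab vs uu.
set e0 := code_val ce0; set e1 := code_val ce1.
have e00 : dot e0 e0 = 1 by rewrite -cdotE.
have e11 : dot e1 e1 = 1 by rewrite -cdotE.
have e01 : dot e0 e1 = 0 by rewrite -cdotE.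
have [g gi [ga _]] := unit_transitive aa e00.
have gb : dot (g b) (g b) = 1 by rewrite gi.
have [h hi [hb hf]] := unit_transitive gb e11.
have hgi : isometry (h \o g) by move=> x y; rewrite /= hi gi.
rewrite -(balanced_isometry _ _ hgi) -(star_isometry _ _ _ hgi) /= hb ga.
have sN v : star (- e0) e1 v = star e0 e1 v.
  by apply/setP => x; rewrite !inE !(dotE x (- e0)) bilNr oppr_eq0 -dotE.
have st : (h (g v0)) \in star (h e0) e1 (h (g v0)).
  by rewrite -ga -hb (star_isometry _ _ _ hgi) (mem_imset _ _ (isometry_inj hgi)).
have hu : dot (h (g u)) (h (g u)) = 0 by rewrite hi gi.
have he : h e0 = e0 \/ h e0 = - e0.
  by apply: hf => //; rewrite -ga gi.
by case: he st => ->; rewrite ?sN => st; exact: balanced_std.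
Qed.

End Isometry.

(** * The linear relation *)

Section Final.
Variable R : realType.
Local Notation C := (R[i]).
Local Notation chi := (@chi R).
Local Notation rc := (map_mx (real_complex R)).

Lemma beta_mod3_inj : injective beta_mod3.
Proof.
move=> x y e; apply/eqP; rewrite -subr_eq0; apply/eqP/dot_nondeg => z.
rewrite dotE bilDl bilNl; apply: oppr_inj.
by rewrite opprD opprK -beta_mod3_form e beta_mod3_form addNr oppr0.
Qed.

Section WithTau.
Variable tau : 'M[C]_5.
Hypothesis bt : ball4 tau.
Let sT : siegel tau. Proof. by case: bt. Qed.

Definition cube_at (v : F35) : C := cube_sum tau (beta_mod3 v).

(** This contains the independence of the lift. *)
Lemma Theta3_cube_at vt : Theta3 vt tau = cube_at (mod3 vt).
Proof.
rewrite /cube_at -mod3_beta; have [_ <-] := theta_cubeE bt (coord_sum_beta vt).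
rewrite /Theta3 (Theta_char _ _ sT); set b := beta_tilde vt.
have toC (x : int) : (2^-1 + 3^-1 * x%:~R : R)%:C = 2^-1 + 3^-1 * x%:~R :> C.
  by rewrite rmorphD rmorphM !fmorphV !rmorph_nat rmorph_int.
have -> : rc (const_mx 2^-1 + 3^-1 *: map_mx intr b) = char_y R b.
  by apply/rowP => i; rewrite char_yE -toC !mxE.
have -> : rc (const_mx 2^-1 + 3^-1 *: map_mx intr (- (b *m Hmx int))) = char_x R b.
  apply/rowP => i; rewrite char_xE -Hsign_intr -intrM -mulrN -rmorphN -mulHE -toC.
  by rewrite [LHS]mxE rvD rvZ [const_mx _ _ _]mxE [map_mx _ _ _ _]mxE rvN.
by [].
Qed.

Lemma cube_at_opp v : cube_at (- v) = - cube_at v.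
Proof. by rewrite /cube_at /beta_mod3 mulNmx (cube_sum_opp bt). Qed.

Lemma cube_at_support : exists c0 : 'F_3, forall v, cube_at v != 0 -> dot v v = c0.
Proof.
have [c0 h] := cube_sum_support bt; exists (- c0) => v /h.
by rewrite beta_mod3_form dotE => <-; rewrite opprK.
Qed.

Lemma cube_at_relation : exists kappa : C, forall v,
  cube_at v = kappa * chi (dot v v) * \sum_u chi (- dot v u) * cube_at u.
Proof.
have [kappa h] := cube_sum_relation bt; exists kappa => v.
have <- : \sum_c chi (bil (beta_mod3 v *m Hmx 'F_3) c) * cube_sum tau c =
    \sum_u chi (- dot v u) * cube_at u.
  rewrite [LHS](reindex_inj beta_mod3_inj); apply: eq_bigr => u _.
  by rewrite beta_mod3_form -dotE.
by rewrite /cube_at {1}h beta_mod3_form opprK -dotE.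
Qed.

End WithTau.

Lemma sum_balanced (f : 'F_3 -> C) (Y : {set F35}) u : f 0 = 0 -> f (-1) = - f 1 ->
  \sum_(v in Y) f (dot v u) =
  (#|[set v in Y | dot v u == 1]|%:R - #|[set v in Y | dot v u == -1]|%:R) * f 1.
Proof.
move=> f0 fN; have F x : f x = ((x == 1)%:R - (x == -1)%:R) * f 1.
  case: x => [[|[|[|n]]]] h //.
  - by rewrite (_ : Ordinal h = 0) ?f0 ?subrr ?mul0r //; apply/val_inj.
  - by rewrite (_ : Ordinal h = 1) ?subr0 ?mul1r //; apply/val_inj.
  - by rewrite (_ : Ordinal h = -1) ?fN ?sub0r ?mulN1r //; apply/val_inj.
under eq_bigr do rewrite F.
rewrite -mulr_suml sumrB -!natr_sum; congr ((_%:R - _%:R) * _).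
  by rewrite -sum1_card [RHS]big_mkcond [LHS]big_mkcond /=; apply: eq_bigr => v _; rewrite inE; case: (v \in Y); case: eqP.
by rewrite -sum1_card [RHS]big_mkcond [LHS]big_mkcond /=; apply: eq_bigr => v _; rewrite inE; case: (v \in Y); case: eqP.
Qed.

(** The vectors w1 + w2 and w1 - w2 are orthonormal and span the same plane as w1 and
    w2.  For v in X the vectors v + w1 and v - w1 have norm -1, so the hypothesis on
    the Fourier transform applies to them; the sum of the two signs makes the weight
    psi even, so that only the odd part of the character of v contributes.  On the
    support of the result, that is on X and - X, psi is the constant 2. *)
Lemma odd_sum_isotropic (g : F35 -> C) (w1 w2 : F35) (X : {set F35}) :
  dot w1 w1 = -1 -> dot w2 w2 = -1 -> dot w1 w2 = 0 ->
  (forall v, v \in X -> X = star (w1 + w2) (w1 - w2) v) ->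
  (forall u, g (- u) = - g u) ->
  (forall u, g u != 0 -> dot u u = 0) ->
  (forall v, dot v v != 0 -> \sum_u chi (- dot v u) * g u = 0) ->
  \sum_(v in X) g v = 0.
Proof.
move=> q1 q2 q12 Xstar gN gsupp grel.
have [->|[x0 x0X]] := set_0Vmem X; first by rewrite big_set0.
set a := w1 + w2; set b := w1 - w2.
have [aa bb ab] : [/\ dot a a = 1, dot b b = 1 & dot a b = 0].
  have q21 : dot w2 w1 = 0 by rewrite dotE bilC -dotE.
  by split; rewrite /a /b !dotE !bilDl !bilDr ?bilNl ?bilNr -!dotE q1 q2 q12 q21; apply/eqP.
have Xv v : v \in X -> [/\ dot v v = 0, dot v w1 = 0 & dot v w2 = 0].
  rewrite (Xstar _ x0X) inE => /and5P[_ /eqP vv /eqP va /eqP vb _]; split=> //.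
    have : dot v a + dot v b = 0 by rewrite va vb addr0.
    rewrite !dotE -bilDr (_ : a + b = 2 *: w1) ?bilZr -?dotE; last first.
      by rewrite /a /b addrACA subrr addr0 scaler_nat mulr2n.
    by move/eqP; rewrite mulf_eq0 => /orP[|/eqP].
  have : dot v a - dot v b = 0 by rewrite va vb subr0.
  rewrite !dotE -bilNr -bilDr (_ : a - b = 2 *: w2) ?bilZr -?dotE; last first.
    by apply/rowP => i; rewrite !mxE; ring.
  by move/eqP; rewrite mulf_eq0 => /orP[|/eqP].
pose d : C := chi 1 - chi (-1).
have d0 : d != 0 by rewrite subr_eq0 (inj_eq (@chi_inj R)).
pose f x : C := chi x - chi (- x).
have count u : dot u u = 0 ->
    \sum_(v in X) f (dot v u) = 3 * d * ((- u \in X)%:R - (u \in X)%:R).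
  move=> uu; rewrite sum_balanced; last 2 first.
  - by rewrite /f oppr0 subrr.
  - by rewrite /f opprK opprB.
  have := balanced_unit aa bb ab (v0 := x0) (u := u); rewrite -(Xstar _ x0X) => /(_ x0X uu).
  rewrite /balanced; set n1 := #|_|; set n2 := #|_|; rewrite -/d.
  have notboth : u \in X -> - u \notin X.
    move=> uX; apply/negP => nX; move: (nX); rewrite (Xstar _ uX) inE => /and5P[n0 _ _ _].
    rewrite dotE bilNl -dotE uu oppr0 orbF => /eqP e.
    move: n0; rewrite e; have : (2 : 'F_3) *: u = 0 by rewrite scaler_nat mulr2n -{1}e addNr.
    by move/eqP; rewrite scaler_eq0 => /orP[//|/eqP ->]; rewrite eqxx.
  rewrite /f -/d; case: ifP => uX.
    by rewrite (negbTE (notboth uX)) => /andP[/eqP -> /eqP ->] /=; ring.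
  case: ifP => nX; first by move=> /andP[/eqP -> /eqP ->] /=; ring.
  by move=> /eqP ->; rewrite !subrr mul0r mulr0.
have tot : \sum_(v in X) (\sum_u chi (- dot (v + w1) u) * g u + \sum_u chi (- dot (v - w1) u) * g u) = 0.
  apply: big1 => v /Xv [vv v1 v2].
  have w1v : dot w1 v = 0 by rewrite dotE bilC -dotE.
  have nz (s : F35) : s = w1 \/ s = - w1 -> dot (v + s) (v + s) != 0.
    by case=> ->; rewrite !dotE !bilDl !bilDr ?bilNl ?bilNr -!dotE vv v1 w1v q1; apply/eqP.
  by rewrite (grel _ (nz _ (or_introl erefl))) (grel _ (nz _ (or_intror erefl))) addr0.
pose psi u : C := chi (dot w1 u) + chi (- dot w1 u).
have tot2 : \sum_u g u * psi u * \sum_(v in X) chi (- dot v u) = 0.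
  rewrite -[RHS]tot.
  under [RHS]eq_bigr do rewrite -big_split /=.
  rewrite exchange_big /=; apply: eq_bigr => u _; rewrite mulr_sumr; apply: eq_bigr => v _.
  rewrite !dotE !bilDl bilNl -!dotE !opprD opprK !chiD /psi; ring.
have psiN u : psi (- u) = psi u by rewrite /psi dotE bilNr -dotE opprK addrC.
have tot3 : \sum_u g u * psi u * \sum_(v in X) f (dot v u) = 0.
  transitivity (\sum_u g u * psi u * \sum_(v in X) chi (dot v u) -
     \sum_u g u * psi u * \sum_(v in X) chi (- dot v u)).
    by rewrite -sumrB; apply: eq_bigr => u _; rewrite -mulrBr -sumrB.
  rewrite tot2 subr0 (reindex_inj oppr_inj) /= -[RHS]oppr0 -[in RHS]tot2 -sumrN.
  apply: eq_bigr => u _; rewrite gN psiN !mulNr; congr (- (_ * _)).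
  by apply: eq_bigr => v _; rewrite dotE bilNr -dotE.
have psiX u : u \in X -> psi u = 2.
  move=> /Xv [_ u1 _]; rewrite /psi dotE bilC -dotE u1 oppr0.
  by rewrite chi0.
have tot4 : \sum_u g u * psi u * ((- u \in X)%:R - (u \in X)%:R) = 0.
  have nz : 3 * d != 0 by rewrite mulf_neq0.
  apply: (mulfI nz); rewrite mulr0 mulr_sumr -[RHS]tot3; apply: eq_bigr => u _.
  have [->|gu] := eqVneq (g u) 0; first by rewrite !mul0r mulr0.
  by rewrite (count _ (gsupp _ gu)); ring.
have e1 : \sum_u g u * psi u * (u \in X)%:R = 2 * \sum_(v in X) g v.
  rewrite [X in _ = 2 * X]big_mkcond mulr_sumr; apply: eq_bigr => u _.
  by case: ifP => uX; rewrite ?mulr0 // psiX // mulr1 mulrC.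
have e2 : \sum_u g u * psi u * (- u \in X)%:R = - (2 * \sum_(v in X) g v).
  rewrite -e1 (reindex_inj oppr_inj) /= -sumrN; apply: eq_bigr => u _.
  by rewrite opprK gN psiN !mulNr.
move: tot4; under eq_bigr do rewrite mulrBr.
rewrite sumrB e1 e2; set S := \sum_(v in X) _.
have -> : - (2 * S) - 2 * S = - 4 * S by ring.
by move/eqP; rewrite mulf_eq0 oppr_eq0 pnatr_eq0 => /eqP.
Qed.

(** Unfolds the encoding: points of the projective space are pairs {v, - v}, and a
    transversal picks exactly one vector from each. *)
Lemma Rpairs_representatives W X : W \in Rpairs -> good_representatives W X ->
  exists w1 w2 : F35, [/\ dot w1 w1 = -1, dot w2 w2 = -1, dot w1 w2 = 0,
    forall v, v \in X -> v \in Siso &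
    forall v, v \in X -> X = star (w1 + w2) (w1 - w2) v].
Proof.
move=> /imsetP [[w1 w2]]; rewrite inE /= => /and5P[_ _ q1 q2 /eqP q12] -> [/and3P[_ XD trX] Xm1].
have two : 2 = -1 :> 'F_3 by apply/eqP.
set W' := [set pm w1; pm w2] in XD trX.
have perpP v : reflect (dot v w1 = 0 /\ dot v w2 = 0)
    [forall P in W', forall w in P, dot v w == 0].
  have pmP w : [forall z in pm w, dot v z == 0] = (dot v w == 0).
    apply/forall_inP/eqP => [h|h z]; first by apply/eqP/h; rewrite !inE eqxx.
    by rewrite !inE => /orP[] /eqP ->; rewrite ?dotE ?bilNr -?dotE h ?oppr0.
  apply: (iffP forall_inP) => [h|[h1 h2] P].
    by split; apply/eqP; rewrite -pmP; apply: h; rewrite !inE eqxx ?orbT.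
  by rewrite !inE => /orP[] /eqP ->; rewrite pmP ?h1 ?h2.
have perp_sum v : (dot v (w1 + w2) == 0) && (dot v (w1 - w2) == 0) =
    (dot v w1 == 0) && (dot v w2 == 0).
  rewrite !dotE !bilDr bilNr -!dotE.
  by move: (dot v w1) (dot v w2) => [[|[|[|n]]] h1] // [[|[|[|m]]] h2].
have XI v : v \in X -> [/\ v \in Siso, dot v w1 = 0 & dot v w2 = 0].
  move=> /(fintype.subsetP XD) /finset.bigcupP [B /imsetP [z zI ->] vz].
  have [zS z1 z2] : [/\ z \in Siso, dot z w1 = 0 & dot z w2 = 0].
    by move: zI; rewrite inE => /andP[-> /perpP[-> ->]].
  case/set2P: vz => ->; first by [].
  move: zS; rewrite !inE oppr_eq0 => /andP[-> /=]; rewrite /qform => zz.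
  by rewrite !dotE !bilNl bilNr opprK -!dotE zz z1 z2 oppr0.
have XC v : v \in Siso -> dot v w1 = 0 -> dot v w2 = 0 -> v \in X \/ - v \in X.
  move=> vS v1 v2; have BI : pm v \in Iset W'.
    by apply/imsetP; exists v => //; rewrite inE vS; apply/perpP.
  have /forall_inP /(_ _ BI) := trX.
  case/cards1P => z /setP /(_ z); rewrite [RHS]inE eqxx => /finset.setIP [zX /set2P[] zv].
    by left; rewrite -zv.
  by right; rewrite -zv.
exists w1, w2; split.
- by rewrite -two; exact/eqP.
- by rewrite -two; exact/eqP.
- by [].
- by move=> v /XI [].
move=> x xX; have [xS x1 x2] := XI x xX; apply/setP => v; rewrite inE; apply/idP/idP.
  move=> vX; have [vS v1 v2] := XI v vX.
  move: vS; rewrite inE => /andP[-> vv]; rewrite /= -/(qform v) vv /=.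
  have -> : (dot v (w1 + w2) == 0) by have := perp_sum v; rewrite v1 v2 eqxx => /andP[].
  have -> : (dot v (w1 - w2) == 0) by have := perp_sum v; rewrite v1 v2 eqxx => /andP[].
  by have [//|ne] := eqVneq v x; rewrite Xm1 // eqxx.
case/and5P => v0 vv va vb; have := perp_sum v; rewrite va vb => /esym/andP[/eqP v1 /eqP v2].
have vS : v \in Siso by rewrite inE v0.
have [//|nX] := XC v vS v1 v2.
case/orP => [/eqP ->//|vx].
have nx : - v != x.
  apply/eqP => e; move: vx; rewrite -e dotE bilNr -dotE (eqP vv) oppr0.
  by move/eqP.
have := Xm1 _ _ nX xX nx; rewrite dotE bilNl -dotE (eqP vx) opprK => e.
by move/eqP: e.
Qed.

End Final.

Theorem corollary5p11 (R : realType) (lift : F35 -> 'rV[int]_5)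
    (lift_ok : is_lift lift)
    (W : {set {set F35}}) (W_in : W \in Rpairs)
    (I_tilde : {set F35}) (I_tilde_ok : good_representatives W I_tilde)
    (tau : 'M[R[i]]_5) (tau_in : ball4 tau) :
  \sum_(v in I_tilde) Theta3 (lift v) tau = 0.
Proof.
have [w1 [w2 [q1 q2 q12 XS Xstar]]] := Rpairs_representatives W_in I_tilde_ok.
transitivity (\sum_(v in I_tilde) cube_at tau v).
  apply: eq_bigr => v /XS vS; rewrite (Theta3_cube_at tau_in); congr cube_at.
  exact: lift_ok.
have [c0 supp] := cube_at_support tau_in.
have [kappa rel] := cube_at_relation tau_in.
have null v : v \in I_tilde -> dot v v = 0.
  by move=> /XS; rewrite inE => /andP[_ /eqP].
have [c00|c0n] := eqVneq c0 0; last first.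
  apply: big1 => v /null vv; apply/eqP/negPn/negP => /supp.
  by rewrite vv => e; move: c0n; rewrite -e eqxx.
subst c0; have [k0|kn] := eqVneq kappa 0.
  by apply: big1 => v _; rewrite rel k0 !mul0r.
apply: (odd_sum_isotropic q1 q2 q12 Xstar (cube_at_opp tau_in) supp) => v vv.
have : cube_at tau v = 0 by apply/eqP/negPn/negP => /supp e; rewrite e eqxx in vv.
rewrite rel => h; apply: (mulfI (mulf_neq0 kn (chi_neq0 R (dot v v)))).
by rewrite mulr0; exact: h.
Qed.
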